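(* Let $n\ge 2$, let $\Omega\subseteq\mathbb{R}^n$ be a bounded open set such that $|\partial\Omega|<+\infty$, let $x_0\in\Omega$, and let $z\in T(\partial\Omega,x_0)$. Let $B:=B(x_0,r)$ with $r:=|z-x_0|=\mathrm{dist}(x_0,\partial\Omega)$, i.e. $B$ is the biggest ball centered at $x_0$ and contained in $\Omega$. Then $$\mathcal{K}(\partial\Omega,x_0)\ \geq\ \frac{|\partial\Omega|-S_z(\partial\Omega,x_0)\,|\partial B|}{|\partial\Omega|}.$$
   Context: Notation: $\sigma$ is the $(n-1)$-dimensional Hausdorff measure in $\mathbb{R}^n$, $|\partial\Omega|$ and $|\partial B|$ denote the $(n-1)$-Hausdorff measures of these topological boundaries, $\fint_{\partial\Omega}u\,d\sigma=\frac1{|\partial\Omega|}\int_{\partial\Omega}u\,d\sigma$, $\omega_n$ is the Lebesgue measure of the unit ball of $\mathbb{R}^n$, $B(x,\rho)$ is the open Euclidean ball. Touching set: for $\Omega$ open and $x_0\in\Omega$, $T(\partial\Omega,x_0):=\{z\in\partial\Omega: |x_0-z|=\mathrm{dist}(\partial\Omega,x_0)\}$. Kuran function: for $\alpha\in\mathbb{R}^n$, $k_\alpha(x):=1+h_\alpha(x)$, where $h_\alpha(x):=|\alpha|^{n-2}\frac{|x|^2-|\alpha|^2}{|x-\alpha|^n}$, $x\in\mathbb{R}^n\setminus\{\alpha\}$. Kuran gap: if $0\in\Omega$, $\mathcal{K}(\partial\Omega,0):=\sup_{\alpha\notin\overline\Omega}\left|k_\alpha(0)-\fint_{\partial\Omega}k_\alpha\,d\sigma\right|=\sup_{\alpha\notin\overline\Omega}\left|\fint_{\partial\Omega}k_\alpha\,d\sigma\right|$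 (note $k_\alpha(0)=0$). For general $x_0\in\Omega$, $\mathcal{K}(\partial\Omega,x_0):=\mathcal{K}(-x_0+\partial\Omega,0)$, the gap at $0$ of the translated set $-x_0+\Omega$. It takes values in $[0,+\infty]$. Spherical flatness index: let $\Omega$ be open with every compact subset of $\partial\Omega$ of finite $(n-1)$-Hausdorff measure, $x_0\in\Omega$, $z\in T(\partial\Omega,x_0)$, $r:=|z-x_0|$. Then $$S_z(\partial\Omega,x_0):=\frac{2}{n\omega_n r}\liminf_{R\searrow0}\left(\liminf_{\alpha\to z,\ \alpha\notin\overline\Omega}\int_{\partial\Omega\cap B(z,R)}\frac{\langle\alpha-x,\alpha-x_0\rangle}{|x-\alpha|^n}\,d\sigma(x)\right)\in[-\infty,+\infty],$$ where the inner $\liminf$ is $+\infty$ (the standard convention $\inf\emptyset=+\infty$) if no points $\alpha\notin\overline\Omega$ converge to $z$. Inequalities are understood in the extended reals. *)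

(* Defs.v *)
From HB Require Import structures.
From mathcomp Require Import all_boot all_order all_algebra.
From mathcomp Require Import all_classical all_reals all_analysis.

Set Implicit Arguments.
Unset Strict Implicit.
Unset Printing Implicit Defensive.

Import Order.TTheory GRing.Theory Num.Theory.
Import numFieldNormedType.Exports.

Local Open Scope classical_set_scope.
Local Open Scope ring_scope.

Section euclidean.
Context {R : realType} {n : nat}.
Implicit Types (x y : 'rV[R]_n) (A : set 'rV[R]_n).

(* The library's norm and balls on ['rV[R]_n] are those of the sup norm; they
   only serve here for the topology and for boundedness. *)
Definition dotp x y : R := \sum_i x 0 i * y 0 i.

Definition enorm x : R := Num.sqrt (dotp x x).

Definition eball x (r : R) : set 'rV[R]_n := [set y | enorm (y - x) < r].

Definition edist x A : R := inf [set enorm (x - y) | y in A].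

Definition boundary A : set 'rV[R]_n := closure A `\` interior A.

(* [0] is added so that the empty set has diameter [0]. *)
Definition ediam A : \bar R :=
  ereal_sup ([set 0%E] `|` [set (enorm (p.1 - p.2))%:E | p in A `*` A]).

End euclidean.

(* Iterated (Tonelli) form of the product of k copies of the one-dimensional
   Lebesgue measure; it is the Lebesgue measure on Borel sets, and is used only
   for the unit ball. *)
Fixpoint lebesgue_rV {R : realType} (k : nat) : set 'rV[R]_k -> \bar R :=
  match k with
  | 0%N => fun A => (\1_A (0 : 'rV[R]_0))%:E
  | k'.+1 => fun A => (\int[lebesgue_measure]_(t in [set: R])
      lebesgue_rV [set v : 'rV[R]_k' | A (row_mx (t%:M : 'rV[R]_1) v)])%E
  end.

Definition omega (R : realType) (k : nat) : R :=
  fine (lebesgue_rV (eball (0 : 'rV[R]_k) 1)).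

Section hausdorff.
Context {R : realType} {n : nat}.
Local Notation V := 'rV[R]_n.
Local Open Scope ereal_scope.
Implicit Types (A : set V) (d : R) (m : nat).

(* Only meaningful for sets of finite diameter: [fine +oo = 0], but covers are
   by sets of diameter at most d. The case split settles [0 ^+ 0] for set0. *)
Definition hausdorff_gauge m A : \bar R :=
  if A == set0 then 0
  else (omega R m * (fine (ediam A) / 2) ^+ m)%:E.

Definition fine_cover d A : set ((set V)^nat) :=
  [set F | A `<=` \bigcup_k F k /\ forall k, ediam (F k) <= d%:E].

Definition hausdorff_content m d A : \bar R :=
  ereal_inf [set \sum_(k <oo) hausdorff_gauge m (F k) | F in fine_cover d A].

(* The supremum over d > 0 is the limit as d tends to 0. The constant
   [omega R m / 2 ^ m] of the gauge is the usual normalization, for which the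
   m-dimensional measure on R^m is the Lebesgue measure. *)
Definition hausdorff m A : \bar R :=
  ereal_sup [set hausdorff_content m d A | d in [set d : R | (0 < d)%R]].

Lemma ediam_ge0 A : 0 <= ediam A.
Proof. by apply: ereal_sup_ubound; left. Qed.

Lemma ediam0 : ediam (set0 : set V) = 0.
Proof.
by rewrite /ediam setX0 image_set0 setU0 ereal_sup1.
Qed.

Lemma lebesgue_rV_ge0 k (A : set 'rV[R]_k) : 0 <= lebesgue_rV A.
Proof.
by elim: k A => [|k IH] A //=; apply: integral_ge0 => t _; exact: IH.
Qed.

Lemma omega_ge0 m : (0 <= omega R m)%R.
Proof. by apply: fine_ge0; exact: lebesgue_rV_ge0. Qed.

Lemma hausdorff_gauge_ge0 m A : 0 <= hausdorff_gauge m A.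
Proof.
rewrite /hausdorff_gauge; case: ifP => // _; rewrite lee_fin.
by rewrite mulr_ge0 ?omega_ge0// exprn_ge0// divr_ge0// fine_ge0// ediam_ge0.
Qed.

Lemma hausdorff_content_ge0 m d A : 0 <= hausdorff_content m d A.
Proof.
apply: le_ereal_inf_tmp => _ [F _ <-]; apply: nneseries_ge0 => k _ _.
exact: hausdorff_gauge_ge0.
Qed.

Lemma le_hausdorff_content m d :
  {homo hausdorff_content m d : A B / A `<=` B >-> A <= B}.
Proof.
move=> A B AB; apply: ereal_inf_le_tmp => _ [F [BF dF] <-].
by exists F => //; split => //; exact: subset_trans AB BF.
Qed.

Lemma hausdorff_content_sigma_subadditive m d :
  sigma_subadditive (hausdorff_content m d).
Proof.
move=> A; set mu := hausdorff_gauge m.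
have [[i ioo]|] := pselect (exists i, hausdorff_content m d (A i) = +oo).
  rewrite (eseries_pinfty _ _ ioo) ?leey// => k _.
  by rewrite -ltNye (lt_le_trans _ (hausdorff_content_ge0 _ _ _)).
rewrite -forallNE => Aoo.
suff add2e (e : {posnum R}) : hausdorff_content m d (\bigcup_n A n) <=
    \sum_(i <oo) hausdorff_content m d (A i) + e%:num%:E.
  by apply/lee_addgt0Pr => _/posnumP[].
rewrite (le_trans _ (epsilon_trick _ _ _))//; last first.
  by move=> k; exact: hausdorff_content_ge0.
pose P k (B : (set V)^nat) := fine_cover d (A k) B /\
  \sum_(j <oo) mu (B j) <= hausdorff_content m d (A k) +
                           (e%:num / (2 ^ k.+1)%:R)%:E.
have [G PG] : {G : ((set V)^nat)^nat & forall k, P k (G k)}.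
  apply: (@choice _ _ P) => k; rewrite /P /hausdorff_content.
  set S := (X in ereal_inf X).
  have Sfin : ereal_inf S \is a fin_num.
    rewrite ge0_fin_numE; last exact: hausdorff_content_ge0.
    by rewrite ltey; apply/eqP; exact: Aoo.
  have en1 : (0 < e%:num / (2 ^ k.+1)%:R)%R by [].
  have [_ [B AB <-] muB] := lb_ereal_inf_adherent en1 Sfin.
  by exists B; split => //; exact/ltW.
apply: (@le_trans _ _ (\esum_(i in setT) (mu \o uncurry G) i)).
  apply: ereal_inf_lbound => /=.
  have /card_esym/ppcard_eqP[f] := card_nat2.
  exists (uncurry G \o f).
    split => [t [i _] Ait|i /=].
      have [j _ Gt] := (PG i).1.1 _ Ait.
      by exists (f^-1%FUN (i, j)) => //=; rewrite invK ?inE.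
    by case: (f i) => a b; exact: (PG a).1.2.
  rewrite -(esum_pred_image (mu \o uncurry G) _ xpredT) ?[fun=> _]set_true//.
    by rewrite image_eq.
  by move=> *; exact: hausdorff_gauge_ge0.
rewrite (_ : esum _ _ = \sum_(i <oo) \sum_(j <oo) mu (G i j)); last first.
  pose J : nat -> set (nat * nat) := fun i => [set (i, j) | j in setT].
  rewrite (_ : setT = \bigcup_k J k); last first.
    by rewrite predeqE => -[a b]; split => // _; exists a => //; exists b.
  rewrite esum_bigcupT /=; last 2 first.
    - apply/trivIsetP => i j _ _ ij.
      rewrite predeqE => -[k l] /=; split => //= -[] [_] _ [<-{k} _].
      by move=> [l' _] [] /esym/eqP; rewrite (negbTE ij).
    - by move=> *; exact: hausdorff_gauge_ge0.
  rewrite -(image_id [set: nat]) -fun_true esum_pred_image//; last first.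
    by move=> k _; apply: esum_ge0 => *; exact: hausdorff_gauge_ge0.
  apply: eq_eseriesr => /= j _.
  rewrite -(esum_pred_image (mu \o uncurry G) (pair j) predT)//=; last 2 first.
    by move=> *; exact: hausdorff_gauge_ge0.
    by move=> ? ? _ _; exact: (@can_inj _ _ _ snd).
  by congr esum; rewrite predeqE => -[a b]; split; move=> [i _ <-]; exists i.
apply: lee_nneseries => [i _ _|i _].
  by apply: nneseries_ge0 => *; exact: hausdorff_gauge_ge0.
exact: (PG i).2.
Qed.

Lemma hausdorff_ge0 m A : 0 <= hausdorff m A.
Proof.
apply: le_trans (hausdorff_content_ge0 m 1 A) _.
by apply: ereal_sup_ubound; exists 1%R => //=.
Qed.

Lemma hausdorff0 m : hausdorff m set0 = 0.
Proof.
apply/eqP; rewrite eq_le hausdorff_ge0 andbT.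
apply: ge_ereal_sup => _ [d /= d0 <-]; apply: ereal_inf_lbound.
exists (fun=> set0) => /=; last first.
  by apply: eseries0 => k _ _; rewrite /hausdorff_gauge eqxx.
by split => // k; rewrite ediam0 lee_fin ltW.
Qed.

Lemma le_hausdorff m : {homo hausdorff m : A B / A `<=` B >-> A <= B}.
Proof.
move=> A B AB; apply: ge_ereal_sup => _ [d d0 <-].
apply: le_trans (le_hausdorff_content m d AB) _.
by apply: ereal_sup_ubound; exists d.
Qed.

Lemma hausdorff_sigma_subadditive m : sigma_subadditive (hausdorff m).
Proof.
move=> F; apply: ge_ereal_sup => _ [d d0 <-].
apply: le_trans (hausdorff_content_sigma_subadditive m d F) _.
apply: lee_nneseries => [i _ _|i _]; first exact: hausdorff_content_ge0.
by apply: ereal_sup_ubound; exists d.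
Qed.

HB.instance Definition _ m := isOuterMeasure.Build R V (hausdorff m)
  (hausdorff0 m) (hausdorff_ge0 m) (@le_hausdorff m)
  (hausdorff_sigma_subadditive m).

End hausdorff.

Definition hausdorff_outer (R : realType) (n m : nat) :
    {outer_measure set 'rV[R]_n -> \bar R} := @hausdorff R n m.

(* The (n-1)-dimensional Hausdorff measure on its Caratheodory sigma-algebra,
   which contains the Borel sets. *)
Definition sigma (R : realType) (n : nat) :
    {measure set (caratheodory_type (hausdorff_outer R n n.-1)) -> \bar R} :=
  hausdorff_outer R n n.-1.

Section kuran.
Context {R : realType} {n : nat}.
Local Notation V := 'rV[R]_n.
Implicit Types (Omega : set V) (alpha x z : V).

Definition surface_mean Omega (u : V -> R) : \bar R :=
  ((\int[sigma R n]_(x in boundary Omega) (u x)%:E) /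
   sigma R n (boundary Omega))%E.

Definition touching Omega x : set V :=
  [set z | boundary Omega z /\ enorm (x - z) = edist x (boundary Omega)].

Definition kuran_h alpha x : R :=
  enorm alpha ^+ (n - 2) * ((enorm x ^+ 2 - enorm alpha ^+ 2) /
                            enorm (x - alpha) ^+ n).

Definition kuran_fun alpha x : R := 1 + kuran_h alpha x.

Definition kuran_gap0 Omega : \bar R :=
  ereal_sup
    [set `| (kuran_fun alpha 0)%:E - surface_mean Omega (kuran_fun alpha) |%E
    | alpha in ~` closure Omega].

Definition kuran_gap Omega x : \bar R :=
  kuran_gap0 [set y - x | y in Omega].

(* The filter [within (~` closure Omega) (nbhs z)] is improper when no exterior
   point of Omega is near z; [limf_einf] is then [+oo]. *)
Definition flatness Omega x z : \bar R :=
  ((2 / (n%:R * omega R n * enorm (z - x)))%:E *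
   limf_einf (fun r : R =>
     limf_einf (fun alpha : V =>
       \int[sigma R n]_(y in boundary Omega `&` eball z r)
         (dotp (alpha - y) (alpha - x) / enorm (y - alpha) ^+ n)%:E)
       (within (~` closure Omega) (nbhs z)))
     (0%R : R)^'+)%E.

End kuran.

(* Main.v *)
Require Import Defs.
From HB Require Import structures.
From mathcomp Require Import all_boot all_order all_algebra.
From mathcomp Require Import all_classical all_reals all_analysis.
From mathcomp Require Import measurable_realfun zify ring lra.

Set Implicit Arguments.
Unset Strict Implicit.
Unset Printing Implicit Defensive.

Import Order.TTheory GRing.Theory Num.Theory.
Import numFieldNormedType.Exports.

Local Open Scope classical_set_scope.
Local Open Scope ring_scope.

(** Put the origin at [x0], let [r] be its distance to the boundary, [N] the area
    of the boundary, and suppose that the gap is a real number [K]. For each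
    exterior point [a] the function [k_a] vanishes at the origin, so that the gap
    bounds the mean of [k_a = 1 + h_a]: the integral of [h_a] over the boundary is
    at most [(K - 1) N]. Completing the square,
    [|x|^2 - |a|^2 = |x - a|^2 - 2 <a - x, a>], gives
    [h_a(x) >= - 2 |a|^(n - 2) <a - x, a> / |x - a|^n] ([kuran_h_ge_flux]), whose
    right-hand side is a multiple of the integrand of the flatness index. Use this
    bound on the part of the boundary near the touching point [z]. On the rest, as
    [a] tends to [z], [h_a] is asymptotically nonnegative, because all boundary
    points have norm at least [r = |z|] ([kuran_h_ge_far]). Hence the flux
    integrals near [z] have lower limit at least
    [(1 - K) N / (2 r^(n - 2))] ([flux_limit_ge]), and therefore
    [S_z * |dB| >= (1 - K) N] ([flatness_ge]), which is the theorem, once the area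
    of the sphere is known to be [n omega_n r^(n - 1)].

    That formula ([hausdorff_sphere]) concerns the Hausdorff measure defined by
    covers, normalized by the volume of the unit ball one dimension lower. Both
    inequalities compare a piece of the sphere with the volume of the cone over it.
    For the lower bound, the cones over the sets of a cover fill the ball, and the
    isodiametric inequality, applied to the plane sections of a cone, bounds its
    volume by the gauge of its base ([lebesgue_rV_cone_le]). For the upper bound,
    fill the sphere greedily with disjoint caps of radii [delta / 2^j]
    ([exists_sphere_packing]). The cones over them have total volume at most that
    of the ball; what the first stages leave uncovered lies in the doubled caps of
    the later ones, and these make up the tail of a convergent series.

    The isodiametric inequality comes from comparing a set with its reflection
    through the origin by the midpoint form of the Brunn-Minkowski inequality
    ([brunn_minkowski_midpoint]), itself proved by induction on the dimension from
    the one-dimensional Prékopa-Leindler inequality. Volumes are computed with the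
    iterated integral [lebesgue_rV]; its invariance under reflections and its
    behaviour under scaling follow from the uniqueness of translation-invariant
    measures ([invariant_measure_cross]).

    Integrating over the boundary also requires the Borel sets to be measurable
    for the Hausdorff measure, which is Carathéodory's criterion for metric outer
    measures ([sublevel_caratheodory]). *)

(** * Euclidean geometry *)

Section euclidean_geometry.
Context {R : realType} {n : nat}.
Implicit Types (x y z : 'rV[R]_n) (a : R).

Lemma dotpC x y : dotp x y = dotp y x.
Proof. by apply: eq_bigr => i _; rewrite mulrC. Qed.

Lemma dotpDl x y z : dotp (x + y) z = dotp x z + dotp y z.
Proof. by rewrite -big_split; apply: eq_bigr => i _; rewrite mxE mulrDl. Qed.

Lemma dotpDr x y z : dotp z (x + y) = dotp z x + dotp z y.
Proof. by rewrite !(dotpC z) dotpDl. Qed.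

Lemma dotpZl a x y : dotp (a *: x) y = a * dotp x y.
Proof. by rewrite mulr_sumr; apply: eq_bigr => i _; rewrite mxE mulrA. Qed.

Lemma dotpZr a x y : dotp x (a *: y) = a * dotp x y.
Proof. by rewrite dotpC dotpZl dotpC. Qed.

Lemma dotpNl x y : dotp (- x) y = - dotp x y.
Proof. by rewrite -scaleN1r dotpZl mulN1r. Qed.

Lemma dotpNr x y : dotp x (- y) = - dotp x y.
Proof. by rewrite dotpC dotpNl dotpC. Qed.

Definition dotpE := (dotpDl, dotpDr, dotpNl, dotpNr, dotpZl, dotpZr).

Lemma dotp_ge0 x : 0 <= dotp x x.
Proof. by apply: sumr_ge0 => i _; rewrite -expr2 sqr_ge0. Qed.

Lemma dotp_eq0 x : dotp x x = 0 -> x = 0.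
Proof.
move=> /eqP; rewrite psumr_eq0 => [/allP xx0|i _]; last first.
  by rewrite -expr2 sqr_ge0.
apply/rowP => i; rewrite mxE; apply/eqP; rewrite -sqrf_eq0 expr2.
exact: (xx0 i (mem_index_enum i)).
Qed.

Lemma sqr_enorm x : enorm x ^+ 2 = dotp x x.
Proof. by rewrite sqr_sqrtr ?dotp_ge0. Qed.

Lemma enorm_ge0 x : 0 <= enorm x.
Proof. exact: sqrtr_ge0. Qed.

Lemma enorm0 : enorm (0 : 'rV[R]_n) = 0.
Proof.
by rewrite /enorm /dotp big1 ?sqrtr0// => i _; rewrite mxE mul0r.
Qed.

Lemma enorm_eq0 x : enorm x = 0 -> x = 0.
Proof. by move=> x0; apply: dotp_eq0; rewrite -sqr_enorm x0 expr0n. Qed.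

Lemma enorm_gt0 x : x != 0 -> 0 < enorm x.
Proof.
move=> x0; rewrite lt_neqAle enorm_ge0 andbT eq_sym.
by apply: contra x0 => /eqP/enorm_eq0 ->.
Qed.

Lemma enormN x : enorm (- x) = enorm x.
Proof. by rewrite /enorm dotpNl dotpNr opprK. Qed.

Lemma enormB x y : enorm (x - y) = enorm (y - x).
Proof. by rewrite -opprB enormN. Qed.

Lemma enormZ a x : enorm (a *: x) = `|a| * enorm x.
Proof.
by rewrite /enorm dotpZl dotpZr mulrA -expr2 sqrtrM ?sqr_ge0// sqrtr_sqr.
Qed.

Lemma le_enorm x a : 0 <= a -> (enorm x <= a) = (dotp x x <= a ^+ 2).
Proof. by move=> a0; rewrite -sqr_enorm ler_sqr ?nnegrE ?enorm_ge0. Qed.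

Lemma dotp_le_enorm x y : dotp x y <= enorm x * enorm y.
Proof.
have [y0|y0] := eqVneq (dotp y y) 0.
  rewrite (dotp_eq0 y0) enorm0 mulr0 dotpC /dotp big1// => i _.
  by rewrite mxE mul0r.
have yy : 0 < dotp y y by rewrite lt_neqAle eq_sym y0 dotp_ge0.
suff : dotp x y ^+ 2 <= (enorm x * enorm y) ^+ 2.
  move=> h; apply: le_trans (ler_norm _) _.
  by rewrite -ler_sqr ?nnegrE ?mulr_ge0 ?enorm_ge0 ?real_normK ?num_real.
rewrite exprMn !sqr_enorm -subr_ge0 -(pmulr_rge0 _ yy).
have := dotp_ge0 (dotp y y *: x - dotp x y *: y).
by rewrite !dotpE (dotpC y x); congr (_ <= _); ring.
Qed.

Lemma enormD x y : enorm (x + y) <= enorm x + enorm y.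
Proof.
rewrite le_enorm ?addr_ge0 ?enorm_ge0// sqrrD !sqr_enorm !dotpE (dotpC y x).
have := dotp_le_enorm x y; lra.
Qed.

Lemma enorm_triangle y x z : enorm (x - z) <= enorm (x - y) + enorm (y - z).
Proof.
by apply: le_trans (enormD _ _); rewrite addrA subrK.
Qed.

Lemma ler_enormB x y : `|enorm x - enorm y| <= enorm (x - y).
Proof.
rewrite ler_norml; have := enormD (x - y) y; have := enormD (y - x) x.
by rewrite !subrK (enormB y x); lra.
Qed.

Lemma coord_le_enorm x i : `|x 0 i| <= enorm x.
Proof.
rewrite -ler_sqr ?nnegrE ?enorm_ge0// sqr_enorm real_normK ?num_real//.
rewrite /dotp (bigD1 i)//= -expr2 lerDl.
by apply: sumr_ge0 => j _; rewrite -expr2 sqr_ge0.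
Qed.

Lemma coord_le_norm x i : `|x 0 i| <= `|x|.
Proof.
rewrite [leRHS]/Num.norm/= mx_normrE; apply/bigmax_geP; right.
by exists (0, i).
Qed.

Lemma norm_le_enorm x : `|x| <= enorm x.
Proof.
rewrite [leLHS]/Num.norm/= mx_normrE; apply/bigmax_leP; split.
  exact: enorm_ge0.
by move=> [i j] _ /=; rewrite ord1 coord_le_enorm.
Qed.

Lemma enorm_le_norm x : enorm x <= n%:R * `|x|.
Proof.
rewrite le_enorm ?mulr_ge0//.
apply: (@le_trans _ _ (\sum_(i < n) `|x| ^+ 2)).
  apply: ler_sum => i _; rewrite -expr2 -real_normK ?num_real//.
  by rewrite ler_sqr ?nnegrE ?coord_le_norm.
rewrite sumr_const card_ord exprMn -[leLHS]mulr_natl.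
rewrite ler_wpM2r ?sqr_ge0//.
by rewrite expr2 -natrM ler_nat; case: (n) => // k; rewrite leq_pmulr.
Qed.

Lemma nbhs_eball x a : 0 < a -> nbhs x (eball x a).
Proof.
move=> a0; apply/nbhs_ballP; exists (a / n.+1%:R) => /=.
  by rewrite divr_gt0.
move=> y; rewrite -ball_normE/= -normrN opprB => xy.
apply: le_lt_trans (enorm_le_norm _) _.
have n1 : 0 < n.+1%:R :> R by [].
rewrite (ltr_pdivlMr _ _ n1) in xy.
apply: le_lt_trans xy; rewrite mulrC ler_wpM2l// ler_nat//.
Qed.

Lemma eball_ball x a : eball x a `<=` ball x a.
Proof.
move=> y; rewrite -ball_normE /eball/= -normrN opprB.
exact: le_lt_trans (norm_le_enorm _).
Qed.

Lemma nbhs_eballP x (A : set 'rV[R]_n) :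
  nbhs x A <-> exists2 a, 0 < a & eball x a `<=` A.
Proof.
split => [/nbhs_ballP[a a0 xA]|[a a0 xA]].
  by exists a => // y /eball_ball /xA.
by apply: filterS xA _; exact: nbhs_eball.
Qed.

Lemma enormB_continuous z : continuous (fun x : 'rV[R]_n => enorm (x - z)).
Proof.
move=> x A /nbhs_ballP[e /= e0 eA]; apply/nbhs_eballP; exists e => // y.
rewrite /eball/= => xy; apply: eA; rewrite -ball_normE/=.
apply: le_lt_trans (ler_enormB _ _) _.
by rewrite (_ : x - z - (y - z) = x - y) 1?enormB// opprB addrA subrK.
Qed.

Lemma open_eball x r : open (eball x r).
Proof.
have := @open_comp _ _ (fun y : 'rV[R]_n => enorm (y - x)) [set t | t < r].
by apply => [y _|]; [exact: enormB_continuous|exact: open_lt].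
Qed.

End euclidean_geometry.

(** * Borel sets of Euclidean space *)

Definition rV_display : measure_display.
Proof. exact. Qed.

Definition rV_coord (R : realType) n (i : 'I_n) (x : 'rV[R]_n) : R := x 0 i.

Section rV_measurable.
Context {R : realType} {n : nat}.

Let rV_set0 : g_sigma_preimage (@rV_coord R n) set0.
Proof. exact: sigma_algebra0. Qed.

Let rV_setC A : g_sigma_preimage (@rV_coord R n) A ->
  g_sigma_preimage (@rV_coord R n) (~` A).
Proof. exact: sigma_algebraC. Qed.

Let rV_bigcup (F : _^nat) : (forall i, g_sigma_preimage (@rV_coord R n) (F i)) ->
  g_sigma_preimage (@rV_coord R n) (\bigcup_i (F i)).
Proof. exact: sigma_algebra_bigcup. Qed.

HB.instance Definition _ := @isMeasurable.Build rV_display 'rV[R]_n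
  (g_sigma_preimage (@rV_coord R n)) rV_set0 rV_setC rV_bigcup.

End rV_measurable.

Section measurable_rV.
Context {R : realType}.

Lemma measurable_rV_coord n (i : 'I_n) :
  measurable_fun [set: 'rV[R]_n] (@rV_coord R n i).
Proof.
move=> _ Y mY; rewrite setTI; apply: sub_sigma_algebra => /=.
rewrite -bigcup_seq/=; exists i => /=; first by rewrite mem_index_enum.
by exists Y => //; rewrite setTI.
Qed.

Lemma measurable_fun_rVP d (T : measurableType d) n (f : T -> 'rV[R]_n) :
  measurable_fun [set: T] f <->
  forall i, measurable_fun [set: T] (fun t => f t 0 i).
Proof.
split=> [mf i|mf].
  exact: (measurableT_comp (measurable_rV_coord i)) mf.
suff h : g_sigma_preimage (fun i => @rV_coord R n i \o f) `<=` measurable.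
  move=> _ A mA; apply: h; rewrite g_sigma_preimage_comp.
  by exists A.
apply: smallest_sub; first exact: sigma_algebra_measurable.
move=> A; rewrite -bigcup_seq => -[i _ [B mB <-]].
exact: mf.
Qed.

(** An open set is a countable union of balls with rational centre. *)
Lemma measurable_fun_open_preimage d (T : measurableType d) n
    (f : T -> 'rV[R]_n) (U : set 'rV[R]_n) :
  (forall i, measurable_fun [set: T] (fun t => f t 0 i)) -> open U ->
  measurable (f @^-1` U).
Proof.
move=> mf oU.
pose c (q : 'rV[rat]_n) : 'rV[R]_n := \row_i ratr (q 0 i).
pose D := [set p : 'rV[rat]_n * nat | ball (c p.1) p.2.+1%:R^-1 `<=` U].
have -> : f @^-1` U =
    \bigcup_(p in D) (f @^-1` ball (c p.1) p.2.+1%:R^-1).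
  apply/seteqP; split => [t|t [p Dp]]; last by move=> ft; exact: Dp ft.
  rewrite /preimage/= => Uft.
  have /nbhs_ballP[e /= e0 eU] : nbhs (f t) U by exact: open_nbhs_nbhs.
  have [k ke] : exists k, k.+1%:R^-1 < e / 2 :> R.
    by have [|k ke] := @ltr_add_invr R 0 (e / 2); rewrite ?divr_gt0//; exists k; rewrite add0r in ke.
  have k0 : 0 < k.+1%:R^-1 :> R by rewrite invr_gt0.
  have /choice[q qP] : forall i, exists q : rat, `|f t 0 i - ratr q| < k.+1%:R^-1.
    move=> i.
    have [|q] := @rat_in_itvoo R (f t 0 i) (f t 0 i + k.+1%:R^-1).
      by rewrite ltrDl.
    rewrite in_itv/= => /andP[q1 q2]; exists q.
    rewrite ltr_norml.
    move: k0 q1 q2; move: (f t 0 i) (ratr q) (_^-1) => a b e' *.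
    apply/andP; split; lra.
  have cf : ball (c (\row_i q i)) k.+1%:R^-1 (f t).
    by split => // i j; rewrite !ord1 !mxE -ball_normE/= distrC.
  exists (\row_i q i, k) => //=.
  move=> y cy; apply: eU; apply: (@le_ball _ _ _ (k.+1%:R^-1 + k.+1%:R^-1)).
    by rewrite [leRHS]splitr lerD// ltW.
  by apply: (@ball_triangle _ _ (c (\row_i q i))) => //; exact: ball_sym.
rewrite bigcup_mkcond; apply: countable_bigcupT_measurable => [|[q k]].
  exact: countableP.
case: ifPn => // _ /=.
have -> : f @^-1` ball (c q) k.+1%:R^-1 =
    \bigcap_(i in [set: 'I_n]) (fun t => f t 0 i) @^-1` ball (c q 0 i) k.+1%:R^-1.
  apply/seteqP; split => [t [_ +] i _|t ft]; first exact.
  by split => [|i j]; rewrite ?invr_gt0// ord1; exact: ft.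
apply: fin_bigcap_measurable => // i _.
rewrite -[X in measurable X]setTI; apply: mf => //.
apply: open_measurable.
exact: ball_open.
Qed.

Lemma open_measurable_rV n (U : set 'rV[R]_n) : open U -> measurable U.
Proof.
by apply: (@measurable_fun_open_preimage _ _ _ id); exact: measurable_rV_coord.
Qed.

Lemma closed_measurable_rV n (F : set 'rV[R]_n) : closed F -> measurable F.
Proof.
move=> cF; rewrite -(setCK F); apply: measurableC.
by apply: open_measurable_rV; exact: closed_openC.
Qed.

End measurable_rV.

(** * The iterated integral is Lebesgue measure *)

Section sigma_finite_pushforward.
Context (R : realType) d1 d2 (T1 : measurableType d1)
   (T2 : measurableType d2) (m : {measure set T1 -> \bar R})
   (f : T1 -> T2) (g : T2 -> T1).
Hypothesis sfm : sigma_finite setT m.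
Hypotheses (mf : measurable_fun [set: T1] f)
  (mg : measurable_fun [set: T2] g) (fK : cancel f g).

(** The measurability and inverse arguments are phantoms: they carry the facts on
    which the structure of sigma-finite measure rests. *)
Definition iso_pushforward of measurable_fun [set: T1] f &
  measurable_fun [set: T2] g & cancel f g := pushforward m f.

Let mu := iso_pushforward mf mg fK.

Let mu0 : mu set0 = 0%E.
Proof. by rewrite /mu/iso_pushforward /pushforward preimage_set0 measure0. Qed.

Let mu_ge0 A : (0 <= mu A)%E.
Proof. exact: measure_ge0. Qed.

Let mu_sigma_additive : semi_sigma_additive mu.
Proof. by apply: (@measure_semi_sigma_additive _ _ _ (pushforward m f)). Qed.

HB.instance Definition _ := isMeasure.Build d2 T2 R
  mu mu0 mu_ge0 mu_sigma_additive.

Let mu_sigma_finite : sigma_finite setT mu.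
Proof.
have [F FT Foo] := sfm.
exists (fun n => g @^-1` F n).
  by rewrite -preimage_bigcup -FT preimage_setT.
move=> i; have [mF Fi] := Foo i; split.
  by rewrite -[X in measurable X]setTI; exact: mg.
rewrite /mu /iso_pushforward /pushforward (_ : f @^-1` _ = F i)//.
by apply/seteqP; split => x; rewrite /preimage/= fK.
Qed.

HB.instance Definition _ := Measure_isSigmaFinite.Build d2 T2 R
  mu mu_sigma_finite.

Lemma sigma_finite_pushforward :
  exists mu : {sigma_finite_measure set T2 -> \bar R},
    forall A, mu A = m (f @^-1` A).
Proof. by exists mu. Qed.
End sigma_finite_pushforward.

Section rV_cons.
Context {R : realType} {k : nat}.
Implicit Types (t : R) (v : 'rV[R]_k) (A : set 'rV[R]_k.+1).

Definition rV_cons t v : 'rV[R]_k.+1 := row_mx (t%:M : 'rV[R]_1) v.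

Definition rV_section A t : set 'rV[R]_k := [set v | A (rV_cons t v)].

Lemma rV_cons0 t v : rV_cons t v 0 ord0 = t.
Proof.
transitivity (row_mx (t%:M : 'rV[R]_1) v 0 (lshift k ord0)).
  by congr (row_mx _ _ 0 _); exact/val_inj.
by rewrite row_mxEl mxE mulr1n.
Qed.

Lemma rV_consS t v i : rV_cons t v 0 (lift ord0 i) = v 0 i.
Proof.
transitivity (row_mx (t%:M : 'rV[R]_1) v 0 (rshift 1 i)).
  by congr (row_mx _ _ 0 _); exact/val_inj.
by rewrite row_mxEr.
Qed.

Lemma rV_consP (x : 'rV[R]_k.+1) :
  x = rV_cons (x 0 ord0) (\row_i x 0 (lift ord0 i)).
Proof.
apply/rowP => i; have [j ->|->] := unliftP ord0 i.
  by rewrite rV_consS mxE.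
by rewrite rV_cons0.
Qed.

Lemma rV_consD t v t' v' :
  rV_cons t v + rV_cons t' v' = rV_cons (t + t') (v + v').
Proof.
apply/rowP => i; rewrite mxE; have [j ->|->] := unliftP ord0 i.
  by rewrite !rV_consS mxE.
by rewrite !rV_cons0.
Qed.

Lemma rV_consZ a t v : a *: rV_cons t v = rV_cons (a * t) (a *: v).
Proof.
apply/rowP => i; rewrite mxE; have [j ->|->] := unliftP ord0 i.
  by rewrite !rV_consS mxE.
by rewrite !rV_cons0.
Qed.

Lemma dotp_cons t v t' v' :
  dotp (rV_cons t v) (rV_cons t' v') = t * t' + dotp v v'.
Proof.
rewrite /dotp big_ord_recl !rV_cons0; congr (_ + _).
by apply: eq_bigr => i _; rewrite !rV_consS.
Qed.

Lemma measurable_rV_cons :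
  measurable_fun [set: R * 'rV[R]_k] (fun p => rV_cons p.1 p.2).
Proof.
apply/measurable_fun_rVP => i; have [j ->|->] := unliftP ord0 i.
  under eq_fun do rewrite rV_consS.
  exact: (measurableT_comp (measurable_rV_coord j)).
under eq_fun do rewrite rV_cons0.
exact: measurable_fst.
Qed.

Lemma measurable_rV_split : measurable_fun [set: 'rV[R]_k.+1]
  (fun x : 'rV[R]_k.+1 => (x 0 ord0, \row_i x 0 (lift ord0 i) : 'rV[R]_k)).
Proof.
apply: measurable_fun_pair; first exact: (measurable_rV_coord ord0).
apply/measurable_fun_rVP => i; under eq_fun do rewrite mxE.
exact: (measurable_rV_coord (lift ord0 i)).
Qed.

Lemma measurable_rV_section A t : measurable A -> measurable (rV_section A t).
Proof.
move=> mA; rewrite -[X in measurable X]setTI.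
exact: (measurable_fun_pair2 t measurable_rV_cons).
Qed.

End rV_cons.

Section lebesgue_rV_measure.
Context {R : realType}.

(** The iterated integral over [k + 1] coordinates is the image, under
    [rV_cons], of the product of Lebesgue measure on the line with the measure
    obtained for [k] coordinates. The countable additivity of the iterated
    integral comes from that product. *)
Lemma exists_lebesgue_rV n :
  exists mu : {sigma_finite_measure set 'rV[R]_n -> \bar R},
    forall A, measurable A -> mu A = lebesgue_rV A.
Proof.
elim: n => [|k [mu muE]].
  by exists (\d_(0 : 'rV[R]_0)).
pose m : {measure set (measurableTypeR R * 'rV[R]_k)%type -> \bar R} :=
  (lebesgue_measure \x mu)%E.
have sfm : sigma_finite setT m.
  have /sigma_finiteP[F [FT ndF Foo]] := sigma_finiteT (@lebesgue_measure R).
  have /sigma_finiteP[G [GT ndG Goo]] := sigma_finiteT mu.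
  exists (fun i => F i `*` G i) => [|i].
    apply/seteqP; split => // -[t v] _.
    have [i _ Ft] : (\bigcup_i F i) t by rewrite -FT.
    have [j _ Gv] : (\bigcup_i G i) v by rewrite -GT.
    exists (maxn i j) => //; split => /=.
      by move/subsetPset : (ndF _ _ (leq_maxl i j)); apply.
    by move/subsetPset : (ndG _ _ (leq_maxr i j)); apply.
  have [mF Fi] := Foo i; have [mG Gi] := Goo i.
  split; first exact: measurableX.
  by rewrite /m/= product_measure1E// lte_mul_pinfty// ge0_fin_numE.
have [//|||p|nu nuE] := @sigma_finite_pushforward R _ _ _ _ m
  (fun p : measurableTypeR R * 'rV[R]_k => rV_cons p.1 p.2)
  (fun x : 'rV[R]_k.+1 => (x 0 ord0, \row_i x 0 (lift ord0 i) : 'rV[R]_k)).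
- exact: measurable_rV_cons.
- exact: measurable_rV_split.
- case: p => t v /=; rewrite rV_cons0; congr pair.
  by apply/rowP => i; rewrite mxE rV_consS.
exists nu => A mA; rewrite nuE /product_measure1/=.
apply: eq_integral => t _; rewrite -muE; last exact: measurable_rV_section.
by rewrite [in LHS]/comp xsectionE.
Qed.

Context {n : nat}.

Lemma lebesgue_rV0 : lebesgue_rV (set0 : set 'rV[R]_n) = 0%E.
Proof.
by have [nu nuE] := exists_lebesgue_rV n; rewrite -nuE// measure0.
Qed.

Lemma lebesgue_rV_semi_sigma_additive : semi_sigma_additive (@lebesgue_rV R n).
Proof.
have [nu nuE] := exists_lebesgue_rV n.
move=> F mF tF mUF; rewrite -nuE// (_ : (fun _ => _) =
    fun k => (\sum_(0 <= i < k) nu (F i))%E); last first.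
  by apply/funext => k; apply: eq_bigr => i _; rewrite nuE.
exact: measure_semi_sigma_additive.
Qed.

HB.instance Definition _ := isMeasure.Build _ _ _ (@lebesgue_rV R n)
  lebesgue_rV0 (@lebesgue_rV_ge0 R n) lebesgue_rV_semi_sigma_additive.

Lemma lebesgue_rV_sigma_finite : sigma_finite setT (@lebesgue_rV R n).
Proof.
have [nu nuE] := exists_lebesgue_rV n.
have [F FT Foo] := sigma_finiteT nu.
by exists F => // i; have [mF Fi] := Foo i; rewrite -nuE.
Qed.

HB.instance Definition _ := Measure_isSigmaFinite.Build _ _ _ (@lebesgue_rV R n)
  lebesgue_rV_sigma_finite.

End lebesgue_rV_measure.

Lemma lebesgue_rVS (R : realType) k (A : set 'rV[R]_k.+1) :
  (lebesgue_rV A = \int[lebesgue_measure]_t lebesgue_rV (rV_section A t))%E.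
Proof. by []. Qed.

Lemma measurable_lebesgue_section (R : realType) k (A : set 'rV[R]_k.+1) :
  measurable A ->
  measurable_fun [set: R] (fun t => lebesgue_rV (rV_section A t)).
Proof.
move=> mA; pose B := (fun p : R * 'rV[R]_k => rV_cons p.1 p.2) @^-1` A.
have mB : measurable B.
  by rewrite -[X in measurable X]setTI; exact: measurable_rV_cons.
have := measurable_fun_xsection (@lebesgue_rV R k) mB.
by congr measurable_fun; apply/funext => t /=; rewrite xsectionE.
Qed.

Local Open Scope ereal_scope.

Section lebesgue_shift.
Context {R : realType}.
Local Notation mu := (@lebesgue_measure R).

Lemma lebesgue_measure_shift (c : R) (A : set R) : measurable A ->
  pushforward mu ((fun t => t + c)%R : _ -> measurableTypeR R) A = mu A.
Proof.
move=> mA; apply/esym/lebesgue_measure_unique => //=.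
  exact: measurable_funD.
move=> mf _ [[a b]] _ <-; rewrite /pushforward (_ : _ @^-1` _ =
    `]a - c, b - c]%classic)%R.
  rewrite !lebesgue_measure_itv/= !lte_fin ltrD2r.
  by case: ifP => // _; congr (_%:E); ring.
by apply/seteqP; split => t; rewrite /= !in_itv/= ltrBlDr lerBrDr.
Qed.

Lemma ge0_integral_shift (g : R -> \bar R) (c : R) :
  measurable_fun [set: R] g -> (forall t, 0 <= g t) ->
  \int[mu]_t g (t + c)%R = \int[mu]_t g t.
Proof.
move=> mg g0.
transitivity (\int[pushforward mu
    ((fun t => t + c)%R : _ -> measurableTypeR R)]_t g t).
  rewrite ge0_integral_pushforward//; exact: measurable_funD.
apply: eq_measure_integral; first exact: measurable_funD.
by move=> mf A mA _; exact: lebesgue_measure_shift.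
Qed.

Lemma measurable_rV_opp n : measurable_fun [set: 'rV[R]_n] -%R%R.
Proof.
apply/measurable_fun_rVP => i; under eq_fun do rewrite mxE.
by apply: measurable_funN => //; exact: (measurable_rV_coord i).
Qed.

Lemma measurable_preimageT d1 d2 (T1 : measurableType d1)
  (T2 : measurableType d2) (f : T1 -> T2) (A : set T2) :
  measurable_fun [set: T1] f -> measurable A -> measurable (f @^-1` A).
Proof. by move=> mf mA; rewrite -[X in measurable X]setTI; exact: mf. Qed.

Lemma lebesgue_rV_shift n (c : 'rV[R]_n) (A : set 'rV[R]_n) : measurable A ->
  lebesgue_rV ((fun x => x + c)%R @^-1` A) = lebesgue_rV A.
Proof.
elim: n c A => [|k IH] c A mA.
  by rewrite (_ : _ @^-1` _ = A)//; apply/seteqP; split => x;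
    rewrite /preimage/= (_ : (x + c)%R = x)//; apply/rowP => -[].
rewrite [c]rV_consP; set c0 := c _ _; set c' := (\row_i _)%R.
rewrite !lebesgue_rVS -[RHS](ge0_integral_shift c0); first last.
- by move=> t; exact: lebesgue_rV_ge0.
- exact: measurable_lebesgue_section.
apply: eq_integral => t _.
rewrite -(IH c' (rV_section A (t + c0)))//; last exact: measurable_rV_section.
congr lebesgue_rV; apply/seteqP; split => v;
  by rewrite /rV_section /preimage/= -rV_consD.
Qed.

End lebesgue_shift.

(** * Uniqueness of translation-invariant measures *)

Section invariant_measure.
Context {R : realType} {n : nat}.
Local Notation lam := (@lebesgue_rV R n).

Lemma tonelli_section d1 d2 (T1 : measurableType d1) (T2 : measurableType d2)
    (m1 : {sigma_finite_measure set T1 -> \bar R})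
    (m2 : {sigma_finite_measure set T2 -> \bar R}) (E : set (T1 * T2)) :
  measurable E ->
  \int[m1]_x m2 (xsection E x) = \int[m2]_y m1 (ysection E y).
Proof.
move=> mE; have := indic_fubini_tonelli m1 m2 mE.
by rewrite indic_fubini_tonelli_FE// indic_fubini_tonelli_GE.
Qed.

(** Both sides are the integral of [\1_A x * \1_B (x + y)] for the product of
    [mu] and Lebesgue measure: integrating in [y] first gives the left-hand
    side, and the change of variables [x := x - y] before integrating in [y]
    gives the right-hand side. *)
Lemma invariant_measure_cross
    (mu : {sigma_finite_measure set 'rV[R]_n -> \bar R}) :
  (forall (c : 'rV[R]_n) (A : set 'rV[R]_n), measurable A ->
    mu ((fun x => x + c)%R @^-1` A) = mu A) ->
  forall A B : set 'rV[R]_n, measurable A -> measurable B ->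
  mu A * lam B = mu B * lam (-%R%R @^-1` A).
Proof.
move=> muD A B mA mB.
pose E1 := [set p : 'rV[R]_n * 'rV[R]_n | A p.1 /\ B (p.1 + p.2)%R].
pose E2 := [set p : 'rV[R]_n * 'rV[R]_n | A (p.1 - p.2)%R /\ B p.1].
have madd : measurable_fun [set: 'rV[R]_n * 'rV[R]_n]
    (fun p : 'rV[R]_n * 'rV[R]_n => p.1 + p.2)%R.
  apply/measurable_fun_rVP => i; under eq_fun do rewrite mxE.
  by apply: measurable_funD;
    apply: (measurableT_comp (measurable_rV_coord i)).
have msub : measurable_fun [set: 'rV[R]_n * 'rV[R]_n]
    (fun p : 'rV[R]_n * 'rV[R]_n => p.1 - p.2)%R.
  apply/measurable_fun_rVP => i; under eq_fun do rewrite !mxE.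
  by apply: measurable_funB;
    apply: (measurableT_comp (measurable_rV_coord i)).
have mE1 : measurable E1.
  by apply: (@measurableI _ _ (fst @^-1` A)); exact: measurable_preimageT.
have mE2 : measurable E2.
  by apply: (@measurableI _ _ _ (fst @^-1` B)); exact: measurable_preimageT.
have cst_indic (C : set 'rV[R]_n) (a : \bar R) : measurable C -> 0 <= a ->
    \int[mu]_x ((\1_C x)%:E * a) = mu C * a.
  move=> mC a0; rewrite ge0_integralZr//.
    by rewrite integral_indic// setIT.
  by apply/measurable_EFinP/measurable_indic.
have -> : mu A * lam B = \int[mu]_x lam (xsection E1 x).
  rewrite -cst_indic ?lebesgue_rV_ge0//; apply: eq_integral => x _.
  rewrite indicE; have [xA|xA] := boolP (x \in A).
    rewrite mul1e -(lebesgue_rV_shift x mB); congr lebesgue_rV.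
    apply/seteqP; split => y; rewrite xsectionE /preimage/= addrC.
      by split => //; exact: set_mem.
    by case.
  rewrite mul0e (_ : xsection E1 x = set0) ?lebesgue_rV0//.
  apply/seteqP; split => y //; rewrite xsectionE => -[/= Ax _].
  by move/negP: xA; apply; rewrite inE.
have -> : mu B * lam (-%R%R @^-1` A) = \int[mu]_x lam (xsection E2 x).
  rewrite -cst_indic ?lebesgue_rV_ge0//; apply: eq_integral => x _.
  rewrite indicE; have [xB|xB] := boolP (x \in B).
    rewrite mul1e -(lebesgue_rV_shift (- x)%R); last first.
      by apply: measurable_preimageT => //; exact: measurable_rV_opp.
    congr lebesgue_rV.
    apply/seteqP; split => y; rewrite xsectionE /preimage/= opprB//.
      by split => //; exact: set_mem.
    by case.
  rewrite mul0e (_ : xsection E2 x = set0) ?lebesgue_rV0//.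
  apply/seteqP; split => y //; rewrite xsectionE => -[/= _ Bx].
  by move/negP: xB; apply; rewrite inE.
rewrite !tonelli_section//; apply: eq_integral => y _.
rewrite -(muD y (ysection E2 y)); last exact: measurable_ysection.
congr (mu _); apply/seteqP; split => x;
  by rewrite !ysectionE /preimage /E1 /E2/= addrK.
Qed.

End invariant_measure.

Section lebesgue_rV_balls.
Context {R : realType}.

Definition cube n (a : R) : set 'rV[R]_n := [set x | forall i, `|x 0 i| < a]%R.

Arguments cube n a : clear implicits.

Lemma mule_cancel (a x y : \bar R) : 0 < a -> a < +oo -> a * x = a * y ->
  x = y.
Proof.
case: a => // r; rewrite lte_fin => r0 _ /eqP rxy.
have rN0 : r != 0%R by rewrite gt_eqF.
have : (r^-1)%:E * (r%:E * y) == x by rewrite eqe_pdivrMl// eq_sym.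
by rewrite muleA -EFinM mulVf// mul1e => /eqP.
Qed.

Lemma measurable_cube n (a : R) : measurable (cube n a).
Proof.
rewrite (_ : cube n a = \bigcap_(i in [set: 'I_n])
    (@rV_coord R n i) @^-1` `]-a, a[%classic)%R.
  apply: fin_bigcap_measurable => // i _.
  by apply: measurable_preimageT => //; exact: measurable_rV_coord.
apply/seteqP; split => x /= h i => [_|]; first by rewrite /= in_itv/= -ltr_norml h.
by have := h i I; rewrite /= in_itv/= -ltr_norml.
Qed.

Lemma lebesgue_rV_cube n (a : R) : (0 < a)%R ->
  lebesgue_rV (cube n a) = ((2 * a) ^+ n)%:E.
Proof.
move=> a0; elim: n => [|k IH].
  by rewrite /= expr0 indicE mem_set// => -[].
rewrite lebesgue_rVS.
transitivity (\int[@lebesgue_measure R]_t ((\1_(`]-a, a[%classic)%R t)%:E *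
    ((2 * a) ^+ k)%:E)).
  apply: eq_integral => t _; rewrite indicE; have [ta|ta] := boolP (t \in _).
    rewrite mul1e -IH; congr lebesgue_rV; apply/seteqP; split => v.
      by move=> h i; have := h (lift ord0 i); rewrite rV_consS.
    move=> h i; have [j ->|->] := unliftP ord0 i; first by rewrite rV_consS.
    by move: ta; rewrite rV_cons0 inE/= in_itv/= -ltr_norml.
  rewrite mul0e (_ : rV_section _ _ = set0) ?lebesgue_rV0//.
  apply/seteqP; split => v // /(_ ord0); rewrite rV_cons0 => h.
  by move/negP: ta; apply; rewrite inE/= in_itv/= -ltr_norml.
rewrite ge0_integralZr//; last 2 first.
- by apply/measurable_EFinP/measurable_indic.
- by rewrite lee_fin exprn_ge0// mulr_ge0// ltW.
rewrite integral_indic// setIT exprS EFinM; congr (_ * _).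
have := @lebesgue_measure_itv R `]-a, a[%R.
rewrite /= lte_fin gtrN// -EFinD opprK => ->; congr (_%:E); ring.
Qed.

Lemma measurable_eball n (x : 'rV[R]_n) r : measurable (eball x r).
Proof. by apply: open_measurable_rV; exact: open_eball. Qed.

Lemma lebesgue_rV_eball_gt0 n (r : R) : (0 < r)%R ->
  0 < lebesgue_rV (eball (0 : 'rV[R]_n) r).
Proof.
move=> r0; have c0 : (0 < r / n.+1%:R :> R)%R by rewrite divr_gt0.
apply: (@lt_le_trans _ _ (lebesgue_rV (cube n (r / n.+1%:R)))).
  by rewrite lebesgue_rV_cube// lte_fin exprn_gt0// mulr_gt0.
apply: le_measure; rewrite ?inE; [exact: measurable_cube|exact: measurable_eball|].
move=> x h; rewrite /eball/= subr0 (le_lt_trans (enorm_le_norm _))//.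
have n1 : (0 < n.+1%:R :> R)%R by [].
have xr : (`|x| < r / n.+1%:R)%R.
  rewrite [ltLHS]/Num.norm/= mx_normrE; apply/bigmax_ltP; split => // -[i j] _ /=.
  by rewrite ord1.
rewrite ltr_pdivlMr// in xr; apply: le_lt_trans xr.
by rewrite mulrC ler_wpM2l// ler_nat.
Qed.

Lemma lebesgue_rV_eball_lty n (r : R) : (0 < r)%R ->
  lebesgue_rV (eball (0 : 'rV[R]_n) r) < +oo.
Proof.
move=> r0; apply: (@le_lt_trans _ _ (lebesgue_rV (cube n r))).
  apply: le_measure; rewrite ?inE; [exact: measurable_eball|exact: measurable_cube|].
  move=> x; rewrite /eball/= subr0 => xr i.
  exact: le_lt_trans (coord_le_enorm _ _) xr.
by rewrite lebesgue_rV_cube// ltry.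
Qed.

Lemma eball_fin_num n (r : R) : (0 < r)%R ->
  lebesgue_rV (eball (0 : 'rV[R]_n) r) \is a fin_num.
Proof.
by move=> r0; rewrite ge0_fin_numE ?lebesgue_rV_ge0// lebesgue_rV_eball_lty.
Qed.

Lemma lebesgue_rV_opp n (A : set 'rV[R]_n) : measurable A ->
  lebesgue_rV (-%R%R @^-1` A) = lebesgue_rV A.
Proof.
move=> mA; have r1 : (0 < 1 :> R)%R by [].
have := @invariant_measure_cross R n (@lebesgue_rV R n)
  (@lebesgue_rV_shift R n) A _ mA (measurable_eball 0 1).
rewrite muleC => /mule_cancel -> //.
  exact: lebesgue_rV_eball_gt0.
exact: lebesgue_rV_eball_lty.
Qed.

(** Pulling back Lebesgue measure along an additive isomorphism gives a
    translation-invariant measure, hence a multiple of Lebesgue measure. *)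
Lemma lebesgue_rV_additive n (f g : 'rV[R]_n -> 'rV[R]_n) :
  measurable_fun [set: 'rV[R]_n] f -> measurable_fun [set: 'rV[R]_n] g ->
  cancel f g -> cancel g f -> {morph f : x y / (x + y)%R} ->
  forall A B : set 'rV[R]_n, measurable A -> measurable B ->
  lebesgue_rV (f @^-1` A) * lebesgue_rV B =
  lebesgue_rV (f @^-1` B) * lebesgue_rV A.
Proof.
move=> mf mg fK gK fD A B mA mB.
have [mu muE] := sigma_finite_pushforward (sigma_finiteT (@lebesgue_rV R n)) mf mg fK.
rewrite -!muE (@invariant_measure_cross _ _ mu) ?lebesgue_rV_opp// => c C mC.
rewrite !muE -[RHS](lebesgue_rV_shift (g c)); last exact: measurable_preimageT.
by congr lebesgue_rV; apply/seteqP; split => x; rewrite /preimage/= fD gK.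
Qed.

Lemma lebesgue_rV_isometry n (f : 'rV[R]_n -> 'rV[R]_n) :
  measurable_fun [set: 'rV[R]_n] f -> cancel f f ->
  {morph f : x y / (x + y)%R} -> (forall x, enorm (f x) = enorm x) ->
  forall A : set 'rV[R]_n, measurable A ->
  lebesgue_rV (f @^-1` A) = lebesgue_rV A.
Proof.
move=> mf fK fD fE A mA.
have := lebesgue_rV_additive mf mf fK fK fD mA (measurable_eball 0 1).
rewrite (_ : f @^-1` eball 0 1 = eball 0 1)%R; last first.
  by apply/seteqP; split => x; rewrite /eball/= !subr0 fE.
rewrite muleC => /mule_cancel -> //.
  exact: lebesgue_rV_eball_gt0.
exact: lebesgue_rV_eball_lty.
Qed.

Lemma measurable_rV_scale n (a : R) :
  measurable_fun [set: 'rV[R]_n] (fun x => a *: x)%R.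
Proof.
apply/measurable_fun_rVP => i; under eq_fun do rewrite mxE.
by apply: measurable_funM => //; exact: (measurable_rV_coord i).
Qed.

Lemma lebesgue_rV_scale n (a : R) (A : set 'rV[R]_n) : (0 < a)%R ->
  measurable A ->
  lebesgue_rV A = (a ^+ n)%:E * lebesgue_rV ((fun x => a *: x)%R @^-1` A).
Proof.
move=> a0 mA.
have aN0 : a != 0%R by rewrite gt_eqF.
have := @lebesgue_rV_additive n (fun x => a *: x)%R (fun x => a^-1 *: x)%R
  (measurable_rV_scale a) (measurable_rV_scale a^-1) _ _ _ A _ mA
  (@measurable_cube n a).
rewrite (_ : (fun x => _) @^-1` cube n a = cube n 1)%R; last first.
  apply/seteqP; split => x /= h i; have := h i; rewrite !mxE normrM (gtr0_norm a0).
    by rewrite -[ltRHS]mulr1 ltr_pM2l.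
  by rewrite -[X in _ -> (_ < X)%R]mulr1 ltr_pM2l.
rewrite !lebesgue_rV_cube// => /(_ _ _ _)H.
have {H} : lebesgue_rV ((fun x => a *: x)%R @^-1` A) * ((2 * a) ^+ n)%:E =
     ((2 * 1) ^+ n)%:E * lebesgue_rV A.
  apply: H => [x|x|x y]; rewrite ?scalerA ?mulVf ?mulfV ?scale1r// scalerDr//.
rewrite mulr1 exprMn EFinM muleC -muleA => /mule_cancel -> //.
by rewrite ltry.
Qed.

Lemma omegaE n : lebesgue_rV (eball (0 : 'rV[R]_n) 1) = (omega R n)%:E.
Proof. by rewrite /omega fineK// eball_fin_num. Qed.

Lemma omega_gt0 n : (0 < omega R n)%R.
Proof. by rewrite -lte_fin -omegaE lebesgue_rV_eball_gt0. Qed.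

Lemma lebesgue_rV_eball n (x : 'rV[R]_n) (r : R) : (0 < r)%R ->
  lebesgue_rV (eball x r) = (omega R n * r ^+ n)%:E.
Proof.
move=> r0; rewrite -(lebesgue_rV_shift x)//; last exact: measurable_eball.
rewrite (_ : _ @^-1` _ = eball 0 r); last first.
  by apply/seteqP; split => y; rewrite /eball /preimage/= addrK subr0.
rewrite (lebesgue_rV_scale r0); last exact: measurable_eball.
rewrite (_ : _ @^-1` _ = eball 0 1) ?omegaE -?EFinM 1?mulrC//.
apply/seteqP; split => y; rewrite /eball /preimage/= !subr0 enormZ gtr0_norm//.
  by rewrite -[ltRHS]mulr1 ltr_pM2l.
by rewrite -[X in _ -> (_ < X)%R]mulr1 ltr_pM2l.
Qed.

End lebesgue_rV_balls.
Arguments cube {R} n a.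

Local Close Scope ereal_scope.

(** * The isodiametric inequality *)

Section brunn_minkowski_line.
Context {R : realType}.
Local Open Scope ereal_scope.
Local Notation mu := (@lebesgue_measure R).

Lemma measurable_affine (b : R) :
  measurable_fun [set: R] (fun x => 2 * x - b : measurableTypeR R)%R.
Proof. by apply: measurable_funB => //; exact: measurable_funM. Qed.

Lemma lebesgue_measure_half (b : R) (A : set R) : measurable A ->
  mu A = 2%:E * mu [set x | A (2 * x - b)%R].
Proof.
move=> mA.
have mg : measurable_fun [set: measurableTypeR R]
    (fun x => (x + b) / 2 : measurableTypeR R)%R.
  by apply: measurable_funM => //; exact: measurable_funD.
have [|nu0 nu0E] := sigma_finite_pushforward (sigma_finiteT mu)
    (measurable_affine b) mg.
  by move=> x; rewrite subrK mulrC mulKf.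
pose two : {nonneg R} := NngNum (ler0n R 2).
have -> : 2%:E * mu [set x | A (2 * x - b)%R] = mscale two nu0 A.
  by congr (_ * _); exact/esym/nu0E.
apply: lebesgue_measure_unique => //.
move=> _ [[x y] _ <-]; rewrite [RHS](_ : _ = 2%:E * mu
    [set t | (2 * t - b)%R \in `]x, y]]); last by congr (_ * _); exact: nu0E.
have -> : [set t | (2 * t - b)%R \in `]x, y]] =
    `](x + b) / 2, (y + b) / 2]%classic%R.
  apply/seteqP; split => t; rewrite /= !in_itv/= => /andP[? ?];
    by apply/andP; split; lra.
rewrite !lebesgue_measure_itv/= !lte_fin ltr_pM2r// ltrD2r.
by case: ifP => _; rewrite ?mule0// -?EFinB -EFinM; congr (_%:E); field.
Qed.

(** For [a] in [A] close to its supremum and [b] in [B] close to its infimum,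
    [C] contains the midpoints of [b] with the points of [A] below [a] and of
    [a] with the points of [B] above [b]; the former lie below [(a + b) / 2] and
    the latter above it, so that their measures add up. *)
Lemma brunn_minkowski_line (A B C : set R) (M : R) :
  measurable A -> measurable B -> measurable C ->
  A `<=` `]-M, M[%classic%R -> B `<=` `]-M, M[%classic%R -> A !=set0 -> B !=set0 ->
  (forall a b, A a -> B b -> C ((a + b) / 2)%R) ->
  mu A + mu B <= 2%:E * mu C.
Proof.
move=> mA mB mC AM BM A0 B0 ABC.
have supA : has_sup A.
  by split => //; exists M => x /AM/=; rewrite in_itv/= => /andP[_ /ltW].
have infB : has_inf B.
  by split => //; exists (- M)%R => x /BM/=; rewrite in_itv/= => /andP[/ltW].
apply/lee_addgt0Pr => e e0; have e2 : (0 < e / 2)%R by rewrite divr_gt0.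
have [a Aa aS] := sup_adherent e2 supA.
have [b Bb bI] := inf_adherent e2 infB.
pose A' := A `&` `]-oo, a[%classic; pose B' := B `&` `[b, +oo[%classic.
have mA' : measurable A' by exact: measurableI.
have mB' : measurable B' by exact: measurableI.
have muA : mu A <= mu A' + (e / 2)%:E.
  apply: (@le_trans _ _ (mu (A' `|` `[a, sup A]%classic))).
    apply: le_measure; rewrite ?inE//; first exact: measurableU.
    move=> x Ax; have [xa|ax] := ltP x a; [left|right].
      by split => //=; rewrite in_itv.
    by rewrite /= in_itv/= ax/=; apply: ub_le_sup => //; case: supA.
  apply: (@le_trans _ _ (mu A' + mu `[a, sup A]%classic)); first exact: measureU2.
  rewrite leeD2l//.
  rewrite lebesgue_measure_itv/= lte_fin; case: ifP => _; rewrite lee_fin; lra.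
have muB : mu B <= mu B' + (e / 2)%:E.
  apply: (@le_trans _ _ (mu (B' `|` `[inf B, b]%classic))).
    apply: le_measure; rewrite ?inE//; first exact: measurableU.
    move=> x Bx; have [xb|bx] := ltP x b; [right|left].
      by rewrite /= in_itv/= (ltW xb) andbT; apply: ge_inf => //; case: infB.
    by split => //=; rewrite in_itv/= bx.
  apply: (@le_trans _ _ (mu B' + mu `[inf B, b]%classic)); first exact: measureU2.
  rewrite leeD2l//.
  rewrite lebesgue_measure_itv/= lte_fin; case: ifP => _; rewrite lee_fin; lra.
apply: (le_trans (leeD muA muB)).
rewrite addeACA -EFinD -splitr leeD2r//.
rewrite (lebesgue_measure_half b mA') (lebesgue_measure_half a mB') -ge0_muleDr//.
rewrite lee_pmul2l//.
set X := [set x | _]; set Y := [set x | _].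
have mX : measurable X by exact: (measurable_preimageT (measurable_affine b)).
have mY : measurable Y by exact: (measurable_preimageT (measurable_affine a)).
rewrite -measureU//.
  apply: le_measure; rewrite ?inE//; first exact: measurableU.
  move=> x [[/= Ax _]|[/= Bx _]].
    by rewrite (_ : x = ((2 * x - b) + b) / 2)%R; [exact: ABC|field].
  by rewrite (_ : x = (a + (2 * x - a)) / 2)%R; [exact: ABC|field].
apply/seteqP; split => x // -[[_ /=]]; rewrite in_itv/= => h1 [_ /=].
rewrite in_itv/= andbT => h2; lra.
Qed.

End brunn_minkowski_line.

Section prekopa_leindler.
Context {R : realType}.
Local Open Scope ereal_scope.
Local Notation mu := (@lebesgue_measure R).

Let hypograph (u : R -> R) : set (measurableTypeR R * measurableTypeR R) :=
  [set p | (0 <= p.1 < 1)%R /\ (p.1 < u p.2)%R].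

Let measurable_hypograph (u : R -> R) : measurable_fun [set: R] u ->
  measurable (hypograph u).
Proof.
move=> mu_; rewrite (_ : hypograph u = (fst @^-1` `[0, 1[%classic)%R `&`
   (fun p => u p.2 - p.1)%R @^-1` `]0, +oo[%classic%R); last first.
  by apply/seteqP; split => -[s t] /=; rewrite !in_itv/= andbT subr_gt0.
apply: measurableI.
  by apply: measurable_preimageT => //; exact: measurable_fst.
apply: measurable_preimageT => //; apply: measurable_funB.
  exact: (measurableT_comp mu_).
exact: measurable_fst.
Qed.

Let layer_cake (u : R -> R) : measurable_fun [set: R] u -> (forall t, 0 <= u t)%R ->
  \int[mu]_s mu (xsection (hypograph u) s) = \int[mu]_t (Num.min 1 (u t))%:E.
Proof.
move=> mu_ u0; rewrite (tonelli_section mu mu)//; last exact: measurable_hypograph.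
apply: eq_integral => t _; rewrite (_ : ysection _ t =
    `[0, Num.min 1 (u t)%R[%classic%R); last first.
  apply/seteqP; split => s; rewrite ysectionE /hypograph /preimage/= in_itv/= lt_min.
    by case=> /andP[-> ->] ->.
  by case/andP=> s0 /andP[s1 su]; rewrite s0 s1.
apply: etrans (@lebesgue_measure_itv R _) _ => /=.
rewrite lte_fin; case: ifPn; first by rewrite oppr0 adde0.
rewrite -leNgt => h; congr (_%:E); apply/eqP; rewrite eq_le h andbT.
by rewrite le_min ler01 u0.
Qed.

(** Both functions having supremum 1, their superlevel sets at any height below
    1 are nonempty, and the one-dimensional Brunn-Minkowski inequality compares
    them with the superlevel set of [h]; integrate over the heights. *)
Let prekopa_leindler_normalized (f g h : R -> R) (M : R) :
  measurable_fun [set: R] f -> measurable_fun [set: R] g ->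
  measurable_fun [set: R] h ->
  (forall t, 0 <= f t <= 1)%R -> (forall t, 0 <= g t <= 1)%R ->
  (forall t, 0 <= h t)%R ->
  (forall t, 0 < f t -> t \in `]-M, M[)%R ->
  (forall t, 0 < g t -> t \in `]-M, M[)%R ->
  (forall s, s < 1 -> exists t, s < f t)%R ->
  (forall s, s < 1 -> exists t, s < g t)%R ->
  (forall s a b, 0 <= s -> s < f a -> s < g b -> s < h ((a + b) / 2))%R ->
  \int[mu]_t (f t)%:E + \int[mu]_t (g t)%:E <= 2%:E * \int[mu]_t (h t)%:E.
Proof.
move=> mf mg mh f01 g01 h0 fM gM fsup gsup fgh.
have min1 (u : R -> R) : (forall t, 0 <= u t <= 1)%R ->
    \int[mu]_t (u t)%:E = \int[mu]_t (Num.min 1 (u t))%:E.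
  move=> u01; apply: eq_integral => t _; have /andP[_ u1] := u01 t.
  by rewrite (min_idPr _).
have mx (u : R -> R) : measurable_fun [set: R] u ->
    measurable_fun [set: R] (fun s => mu (xsection (hypograph u) s)).
  by move=> mu_; apply: measurable_fun_xsection; exact: measurable_hypograph.
rewrite (min1 f)// (min1 g)// -!layer_cake//; last 2 first.
- by move=> t; have /andP[] := g01 t.
- by move=> t; have /andP[] := f01 t.
apply: (@le_trans _ _ (2%:E * \int[mu]_t (Num.min 1 (h t))%:E)); last first.
  rewrite lee_pmul2l//; apply: ge0_le_integral => //.
  - by move=> t _; rewrite lee_fin le_min ler01 h0.
  - by apply/measurable_EFinP; exact: measurable_minr.
  - exact/measurable_EFinP.
  - by move=> t _; rewrite lee_fin ge_min lexx orbT.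
rewrite -layer_cake// -ge0_integralD//; [|exact: mx..].
rewrite -ge0_integralZl//; [|exact: mx].
apply: ge0_le_integral => //.
- by move=> s _; rewrite adde_ge0.
- by apply: emeasurable_funD; exact: mx.
- by apply: measurable_funeM; exact: mx.
move=> s _; have [/andP[s0 s1]|s01] := boolP (0 <= s < 1)%R; last first.
  have x0 (u : R -> R) : xsection (hypograph u) s = set0.
    apply/seteqP; split => // t; rewrite xsectionE => -[/= h1 _].
    by rewrite h1 in s01.
  by rewrite !x0 !measure0 mule0 adde0.
have xE (u : R -> R) : xsection (hypograph u) s = [set t | (s < u t)%R].
  apply/seteqP; split => t; rewrite xsectionE /preimage /hypograph/=; first by case.
  by rewrite s0 s1.
have ms (u : R -> R) : measurable_fun [set: R] u -> measurable [set t | (s < u t)%R].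
  by move=> mu_; rewrite -xE; apply: measurable_xsection; exact: measurable_hypograph.
rewrite !xE; apply: (@brunn_minkowski_line _ _ _ _ M) => /=.
- exact: ms.
- exact: ms.
- exact: ms.
- by move=> t /(le_lt_trans s0) /fM.
- by move=> t /(le_lt_trans s0) /gM.
- exact: fsup.
- exact: gsup.
- by move=> a b sa sb; exact: fgh.
Qed.

(** Divide [f] and [g] by their suprema [F], [G] and [h] by the square root of
    [F * G]; the sum obtained in the normalized case bounds the product by the
    inequality of arithmetic and geometric means. *)
Lemma prekopa_leindler_line (f g h : R -> R) (M K : R) :
  measurable_fun [set: R] f -> measurable_fun [set: R] g ->
  measurable_fun [set: R] h ->
  (forall t, 0 <= f t <= K)%R -> (forall t, 0 <= g t <= K)%R ->
  (forall t, 0 <= h t)%R ->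
  (forall t, 0 < f t -> t \in `]-M, M[)%R ->
  (forall t, 0 < g t -> t \in `]-M, M[)%R ->
  (forall a b, f a * g b <= h ((a + b) / 2) ^+ 2)%R ->
  (\int[mu]_t (f t)%:E) * (\int[mu]_t (g t)%:E) <=
  (\int[mu]_t (h t)%:E) * (\int[mu]_t (h t)%:E).
Proof.
move=> mf mg mh fK gK h0 fM gM fgh.
have int0 (u : R -> R) : (forall t, 0 <= u t <= K)%R -> 0 <= \int[mu]_t (u t)%:E.
  by move=> uK; apply: integral_ge0 => t _; rewrite lee_fin; case/andP: (uK t).
have inth0 : 0 <= \int[mu]_t (h t)%:E.
  by apply: integral_ge0 => t _; rewrite lee_fin.
have supP (u : R -> R) : (forall t, 0 <= u t <= K)%R ->
    [/\ (0 <= sup (range u))%R, (forall t, u t <= sup (range u))%R &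
     forall s, (s < sup (range u) -> exists t, s < u t)%R].
  move=> uK; have hs : has_sup (range u).
    split; first by exists (u 0%R); exists 0%R.
    by exists K => _ [t _ <-]; case/andP: (uK t).
  have us t : (u t <= sup (range u))%R.
    by apply: ub_le_sup; [case: hs|exists t].
  split => //; first by apply: le_trans (us 0%R); case/andP: (uK 0%R).
  move=> s ss; have [|_ [t _ <-] st] := @sup_adherent _ (range u) (sup (range u) - s)%R _ hs.
    by rewrite subr_gt0.
  by exists t; rewrite subKr in st.
have [F0 fF Fsup] := supP f fK; have [G0 gG Gsup] := supP g gK.
set F := sup (range f) in F0 fF Fsup; set G := sup (range g) in G0 gG Gsup.
have nul (u : R -> R) S : (forall t, 0 <= u t <= K)%R -> (forall t, u t <= S)%R ->
   S = 0%R -> \int[mu]_t (u t)%:E = 0.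
  move=> uK uS S0; apply: integral0_eq => t _; congr (_%:E); apply/eqP.
  by rewrite eq_le -{1}S0 uS; case/andP: (uK t) => ->.
have [F00|FN0] := eqVneq F 0%R; first by rewrite (nul f F)// mul0e mule_ge0.
have [G00|GN0] := eqVneq G 0%R; first by rewrite (nul g G)// mule0 mule_ge0.
have {}F0 : (0 < F)%R by rewrite lt_neqAle eq_sym FN0.
have {}G0 : (0 < G)%R by rewrite lt_neqAle eq_sym GN0.
pose c := Num.sqrt (F * G); have c0 : (0 < c)%R by rewrite sqrtr_gt0 mulr_gt0.
have cE : (c ^+ 2 = F * G)%R by rewrite sqr_sqrtr// mulr_ge0// ltW.
have := @prekopa_leindler_normalized (fun t => f t / F)%R (fun t => g t / G)%R
  (fun t => h t / c)%R M.
have mZ (u : R -> R) (S : R) : measurable_fun [set: R] u ->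
  measurable_fun [set: R] (fun t => u t / S)%R by move=> ?; exact: measurable_funM.
have iZ (u : R -> R) (S : R) : measurable_fun [set: R] u -> (0 < S)%R ->
   (forall t, 0 <= u t)%R ->
  \int[mu]_t (u t / S)%:E = (S^-1)%:E * \int[mu]_t (u t)%:E.
  move=> mu_ S0 u0; rewrite -ge0_integralZl//.
  - by apply: eq_integral => t _; rewrite mulrC.
  - exact/measurable_EFinP.
  - by move=> t _; rewrite lee_fin.
  - by rewrite lee_fin invr_ge0 ltW.
have f0 t : (0 <= f t)%R by case/andP: (fK t).
have g0 t : (0 <= g t)%R by case/andP: (gK t).
move=> /(_ (mZ _ _ mf) (mZ _ _ mg) (mZ _ _ mh)).
rewrite !iZ// => H.
have {}H : (F^-1)%:E * \int[mu]_t (f t)%:E + (G^-1)%:E * \int[mu]_t (g t)%:E <=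
    2%:E * ((c^-1)%:E * \int[mu]_t (h t)%:E).
  apply: H => [t|t|t|t|t|s|s|s a b s0].
  - by rewrite divr_ge0 ?(ltW F0)//= ler_pdivrMr// mul1r.
  - by rewrite divr_ge0 ?(ltW G0)//= ler_pdivrMr// mul1r.
  - by rewrite divr_ge0// ltW.
  - by rewrite pmulr_lgt0 ?invr_gt0//; exact: fM.
  - by rewrite pmulr_lgt0 ?invr_gt0//; exact: gM.
  - move=> s1; have [|t st] := Fsup (s * F)%R; first by rewrite gtr_pMl.
    by exists t; rewrite ltr_pdivlMr.
  - move=> s1; have [|t st] := Gsup (s * G)%R; first by rewrite gtr_pMl.
    by exists t; rewrite ltr_pdivlMr.
  - rewrite !ltr_pdivlMr// => sf sg.
    rewrite -ltr_sqr ?nnegrE ?mulr_ge0 ?(ltW c0)//.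
    apply: lt_le_trans (fgh a b).
    rewrite exprMn cE (_ : s ^+ 2 * (F * G) = (s * F) * (s * G))%R; last by ring.
    by apply: ltr_pM => //; rewrite mulr_ge0// ltW.
have fin (u : R -> R) : measurable_fun [set: R] u -> (forall t, 0 <= u t <= K)%R ->
    (forall t, 0 < u t -> t \in `]-M, M[)%R -> \int[mu]_t (u t)%:E \is a fin_num.
  move=> mu_ uK uM; rewrite ge0_fin_numE ?int0//.
  apply: (@le_lt_trans _ _ (\int[mu]_t ((\1_(`]-M, M[%classic%R) t)%:E * K%:E))).
    apply: ge0_le_integral => //.
    - by move=> t _; rewrite lee_fin; case/andP: (uK t).
    - exact/measurable_EFinP.
    - by apply/measurable_EFinP; apply: measurable_funM => //; exact: measurable_indic.
    - move=> t _; rewrite -EFinM lee_fin indicE; have /andP[u0 uk] := uK t.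
      have [u00|uN0] := eqVneq (u t) 0%R.
        by rewrite u00 mulr_ge0// (le_trans u0).
      rewrite mem_set ?mul1r//=; apply: uM; rewrite lt_neqAle eq_sym uN0//.
  rewrite ge0_integralZr//; last 2 first.
  - by apply/measurable_EFinP; exact: measurable_indic.
  - by rewrite lee_fin; case/andP: (uK 0%R); exact: le_trans.
  rewrite integral_indic// setIT lte_mul_pinfty//.
    by have := @lebesgue_measure_itv R `]-M, M[%R => /= ->; case: ifP => _;
      rewrite ?ltry// -EFinB fin_num_fun.
  exact: ltry.
move: H; rewrite -(fineK (fin _ mf fK fM)) -(fineK (fin _ mg gK gM)).
have : (0 <= fine (\int[mu]_t (f t)%:E))%R by exact/fine_ge0/int0.
have : (0 <= fine (\int[mu]_t (g t)%:E))%R by exact/fine_ge0/int0.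
move: (fine _) (fine _) => x y y0 x0.
case: (\int[mu]_t (h t)%:E) inth0 => [z|_ _|//]; last by rewrite mulyy leey.
rewrite lee_fin -!EFinM -EFinD !lee_fin => z0 H.
have H2 : ((x / F) * (y / G) <= (z / c) ^+ 2)%R.
  have : (0 <= x / F)%R by rewrite divr_ge0// ltW.
  have : (0 <= y / G)%R by rewrite divr_ge0// ltW.
  have : (0 <= z / c)%R by rewrite divr_ge0// ltW.
  move: H; rewrite (mulrC _ x) (mulrC _ y) (mulrC _ z).
  move: (x / F)%R (y / G)%R (z / c)%R => p q w pq w0 q0 p0.
  have : ((p + q) ^+ 2 <= (2 * w) ^+ 2)%R.
    by rewrite ler_sqr ?nnegrE ?addr_ge0 ?mulr_ge0.
  have := sqr_ge0 (p - q)%R; rewrite !expr2; lra.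
move: H2; rewrite expr_div_n cE mulf_div ler_pM2r ?expr2//.
by rewrite invr_gt0 mulr_gt0.
Qed.

End prekopa_leindler.

Section isodiametric.
Context {R : realType}.
Local Open Scope ereal_scope.

Lemma lebesgue_rV_fin_num n (A : set 'rV[R]_n) (M : R) : (0 < M)%R ->
  measurable A -> A `<=` cube n M -> lebesgue_rV A \is a fin_num.
Proof.
move=> M0 mA AM; rewrite ge0_fin_numE ?lebesgue_rV_ge0//.
apply: (@le_lt_trans _ _ (lebesgue_rV (cube n M))).
  by apply: le_measure; rewrite ?inE//; exact: measurable_cube.
by rewrite lebesgue_rV_cube// ltry.
Qed.

Lemma rV_section_cube k (A : set 'rV[R]_k.+1) (M t : R) :
  A `<=` cube k.+1 M -> rV_section A t `<=` cube k M.
Proof. by move=> AM v /AM h i; have := h (lift ord0 i); rewrite rV_consS. Qed.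

(** The midpoint form of the Brunn-Minkowski inequality. The sections of
    [A], [B], [C] satisfy the hypothesis in one dimension less, so that the
    inequality for their volumes is the hypothesis of the one-dimensional
    Prékopa-Leindler inequality. *)
Lemma brunn_minkowski_midpoint n (A B C : set 'rV[R]_n) (M : R) : (0 < M)%R ->
  measurable A -> measurable B -> measurable C ->
  A `<=` cube n M -> B `<=` cube n M -> C `<=` cube n M ->
  (forall a b, A a -> B b -> C (2^-1 *: (a + b))%R) ->
  lebesgue_rV A * lebesgue_rV B <= lebesgue_rV C * lebesgue_rV C.
Proof.
move=> M0; elim: n A B C => [|k IH] A B C mA mB mC AM BM CM ABC.
  rewrite /= !indicE; have [A0|] := boolP (_ \in A); last by rewrite mul0e mule_ge0.
  have [B0|] := boolP (_ \in B); last by rewrite mule0 mule_ge0.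
  rewrite (_ : _ \in C)//; apply: mem_set.
  rewrite (_ : 0 = 2^-1 *: (0 + 0))%R; last by rewrite addr0 scaler0.
  by apply: ABC; exact: set_mem.
have fin t (D : set 'rV[R]_k.+1) : measurable D -> D `<=` cube k.+1 M ->
    lebesgue_rV (rV_section D t) \is a fin_num.
  move=> mD DM; apply: (lebesgue_rV_fin_num M0).
    exact: measurable_rV_section.
  exact: rV_section_cube.
pose f (D : set 'rV[R]_k.+1) t := fine (lebesgue_rV (rV_section D t)).
have fE (D : set 'rV[R]_k.+1) : measurable D -> D `<=` cube k.+1 M ->
    lebesgue_rV D = \int[@lebesgue_measure R]_t (f D t)%:E.
  by move=> mD DM; apply: eq_integral => t _; rewrite fineK// fin.
have mf (D : set 'rV[R]_k.+1) : measurable D -> measurable_fun [set: R] (f D).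
  move=> mD; apply: measurableT_comp => //.
  exact: measurable_lebesgue_section.
have f0 (D : set 'rV[R]_k.+1) t : (0 <= f D t)%R.
  by apply: fine_ge0; exact: lebesgue_rV_ge0.
have fK (D : set 'rV[R]_k.+1) t : measurable D -> D `<=` cube k.+1 M ->
    (0 <= f D t <= (2 * M) ^+ k)%R.
  move=> mD DM; rewrite f0/= -lee_fin fineK ?fin//.
  rewrite -lebesgue_rV_cube//; apply: le_measure; rewrite ?inE.
  - exact: measurable_rV_section.
  - exact: measurable_cube.
  - exact: rV_section_cube.
have fM (D : set 'rV[R]_k.+1) t : D `<=` cube k.+1 M -> (0 < f D t)%R ->
    t \in `]-M, M[%R.
  move=> DM; apply: contraTT => tM; rewrite -leNgt /f (_ : rV_section D t = set0).
    by rewrite lebesgue_rV0.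
  apply/seteqP; split => v // /DM /(_ ord0); rewrite rV_cons0 ltr_norml => h.
  by rewrite in_itv/= h in tM.
rewrite !fE//; apply: (@prekopa_leindler_line _ _ _ _ M ((2 * M) ^+ k)).
- exact: mf.
- exact: mf.
- exact: mf.
- by move=> t; exact: fK.
- by move=> t; exact: fK.
- exact: f0.
- by move=> t; exact: fM.
- by move=> t; exact: fM.
move=> a b; rewrite expr2 -lee_fin !EFinM !fineK ?fin//.
apply: IH; [exact: measurable_rV_section..| | | |].
- exact: rV_section_cube.
- exact: rV_section_cube.
- exact: rV_section_cube.
move=> v w Av Bw; have := ABC _ _ Av Bw.
by rewrite rV_consD rV_consZ mulrC.
Qed.

(** Apply the midpoint inequality to [A] and [- A]: the midpoints lie in the
    ball of radius [d / 2]. *)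
Lemma isodiametric n (A : set 'rV[R]_n) (d : R) : measurable A -> (0 < d)%R ->
  (forall x y, A x -> A y -> (enorm (x - y) < d)%R) ->
  lebesgue_rV A <= (omega R n * (d / 2) ^+ n)%:E.
Proof.
move=> mA d0 Ad; have d2 : (0 < d / 2)%R by rewrite divr_gt0.
have [->|/set0P[a0 Aa0]] := eqVneq A set0.
  by rewrite lebesgue_rV0 lee_fin mulr_ge0 ?omega_ge0// exprn_ge0// ltW.
rewrite -(lebesgue_rV_eball 0)//.
pose M := (enorm a0 + d)%R; have M0 : (0 < M)%R.
  by rewrite ltr_wpDl// enorm_ge0.
have AM x : A x -> (enorm x < M)%R.
  move=> Ax; have := enormD (x - a0) a0; rewrite subrK => h.
  by apply: le_lt_trans h _; rewrite addrC ltrD2l Ad.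
have cM (D : set 'rV[R]_n) : (forall x, D x -> enorm x < M)%R -> D `<=` cube n M.
  by move=> DM x /DM h i; apply: le_lt_trans (coord_le_enorm _ _) h.
have AC : A `<=` cube n M by exact: cM.
have CC : eball 0 (d / 2) `<=` cube n M.
  apply: cM => x; rewrite /eball/= subr0 => /lt_le_trans; apply.
  by rewrite /M; have := enorm_ge0 a0; lra.
have mN : measurable (-%R%R @^-1` A).
  by apply: measurable_preimageT => //; exact: measurable_rV_opp.
have mC := measurable_eball (0 : 'rV[R]_n) (d / 2).
have : lebesgue_rV A * lebesgue_rV (-%R%R @^-1` A) <=
    lebesgue_rV (eball (0 : 'rV[R]_n) (d / 2)) *
    lebesgue_rV (eball (0 : 'rV[R]_n) (d / 2)).
  apply: (@brunn_minkowski_midpoint n _ _ _ M) => //.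
    by apply: cM => x /AM; rewrite enormN.
  move=> a b Aa Ab; rewrite /eball/= subr0 enormZ gtr0_norm ?invr_gt0//.
  by rewrite mulrC ltr_pM2r ?invr_gt0//; have := Ad _ _ Aa Ab; rewrite opprK.
rewrite lebesgue_rV_opp// -(fineK (lebesgue_rV_fin_num M0 mA AC)).
rewrite -(fineK (lebesgue_rV_fin_num M0 mC CC)).
rewrite -!EFinM !lee_fin -!expr2 ler_sqr// nnegrE fine_ge0//; exact: lebesgue_rV_ge0.
Qed.

End isodiametric.

(** * Volumes of cones over spherical sets *)

Section cone_preliminaries.
Context {R : realType}.
Local Open Scope ereal_scope.

Lemma measurable_fun_inv : measurable_fun [set: R] (fun x : R => x^-1)%R.
Proof.
have D0 : measurable (~` [set 0%R : R]).
  by apply: measurableC; exact: measurable_set1.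
rewrite -(setvU [set 0%R : R]); apply/measurable_funU => //; split.
  apply: open_continuous_measurable_fun.
    by apply: closed_openC; exact/accessible_closed_set1/hausdorff_accessible/norm_hausdorff.
  by move=> x /[!inE]/= /eqP x0; exact: inv_continuous.
exact: measurable_fun_set1.
Qed.

Lemma measurable_fun_dotp d (T : measurableType d) n (f g : T -> 'rV[R]_n) :
  (forall i, measurable_fun [set: T] (fun t => f t 0%R i)) ->
  (forall i, measurable_fun [set: T] (fun t => g t 0%R i)) ->
  measurable_fun [set: T] (fun t => dotp (f t) (g t)).
Proof.
by move=> mf mg; apply: measurable_sum => i; exact: measurable_funM.
Qed.

Lemma measurable_fun_enorm d (T : measurableType d) n (f : T -> 'rV[R]_n) :
  (forall i, measurable_fun [set: T] (fun t => f t 0%R i)) ->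
  measurable_fun [set: T] (fun t => enorm (f t)).
Proof.
move=> mf; have ms : measurable_fun [set: R] (@Num.sqrt R).
  by apply: continuous_measurable_fun; exact: sqrt_continuous.
exact: (measurableT_comp ms (measurable_fun_dotp mf mf)).
Qed.

Lemma integral_exprn k (a : R) : (0 < a)%R ->
  \int[lebesgue_measure]_(t in `[0%R, a]) (k.+1%:R * t ^+ k)%:E =
  (a ^+ k.+1)%:E.
Proof.
move=> a0; have cX j : continuous (fun t : R => t ^+ j)%R by exact: exprn_continuous.
rewrite (@continuous_FTC2 _ _ (fun t : R => t ^+ k.+1)%R)//.
- by rewrite expr0n/= -EFinB subr0.
- apply: continuous_subspaceT => t; apply: cvgM; first exact: cvg_cst.
  exact: cX.
- split.
  + by move=> t _; exact: exprn_derivable.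
  + by apply: cvg_at_right_filter; exact: cX.
  + by apply: cvg_at_left_filter; exact: cX.
- by move=> t _; rewrite exp_derive1.
Qed.

Lemma isodiametric_le n (A : set 'rV[R]_n) (d : R) : measurable A -> (0 <= d)%R ->
  (forall x y, A x -> A y -> (enorm (x - y) <= d)%R) ->
  lebesgue_rV A <= (omega R n * (d / 2) ^+ n)%:E.
Proof.
move=> mA d0 Ad.
have le_e (e : R) : (0 < e)%R ->
    lebesgue_rV A <= (omega R n * ((d + e) / 2) ^+ n)%:E.
  move=> e0; apply: isodiametric => //; first by rewrite ltr_wpDl.
  by move=> x y Ax Ay; rewrite (le_lt_trans (Ad _ _ Ax Ay))// ltrDl.
have fA : lebesgue_rV A \is a fin_num.
  by rewrite ge0_fin_numE ?lebesgue_rV_ge0// (le_lt_trans (le_e 1%R _))// ltry.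
rewrite -(fineK fA) lee_fin.
have : (omega R n * ((d + e) / 2) ^+ n)%R @[e --> (0 : R)^'+] -->
    (omega R n * ((d + 0) / 2) ^+ n)%R.
  apply: cvg_at_right_filter; apply: cvgM; first exact: cvg_cst.
  apply: (@cvg_comp _ _ _ (fun e : R => (d + e) / 2)%R (fun x => x ^+ n)%R _
    (nbhs ((d + 0) / 2)%R)); last exact: (@exprn_continuous R n _).
  apply: cvgM; last exact: cvg_cst.
  by apply: cvgD; [exact: cvg_cst|exact: cvg_id].
rewrite addr0 => /cvgr_to_ge; apply; near=> e.
by rewrite -lee_fin fineK//; apply: le_e.
Unshelve. all: by end_near. Qed.

Lemma lebesgue_rV_point k (x : 'rV[R]_k.+1) : lebesgue_rV [set x] = 0.
Proof.
apply/eqP; rewrite eq_le lebesgue_rV_ge0 andbT.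
rewrite [leRHS](_ : 0 = (omega R k.+1 * (0 / 2) ^+ k.+1)%:E).
  apply: isodiametric_le => //.
    by apply: closed_measurable_rV; exact/accessible_closed_set1/hausdorff_accessible/norm_hausdorff.
  by move=> _ _ -> ->; rewrite subrr enorm0.
by rewrite mul0r expr0n mulr0.
Qed.

End cone_preliminaries.

(** The Householder reflection across the bisecting hyperplane. *)
Lemma exists_reflection (R : realType) n (x y : 'rV[R]_n) : enorm x = enorm y ->
  exists f : 'rV[R]_n -> 'rV[R]_n, [/\ measurable_fun [set: 'rV[R]_n] f,
    cancel f f, {morph f : u v / u + v}, {morph f : u / - u} &
    [/\ forall a, {morph f : u / a *: u}, forall u, enorm (f u) = enorm u &
    f x = y]].
Proof.
move=> xy; have [->|xNy] := eqVneq x y.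
  by exists id; split => //; exact: measurable_id.
have [u uE] : exists u, u = x - y by exists (x - y).
pose c := dotp u u.
have c0 : c != 0.
  by apply: contra xNy => /eqP/dotp_eq0/eqP; rewrite uE subr_eq0.
pose f (v : 'rV[R]_n) := v - (2 * dotp v u / c) *: u.
have fE v : dotp (f v) (f v) = dotp v v.
  by rewrite /f !dotpE (dotpC u v) -/c; field.
have fD : {morph f : v w / v + w}.
  move=> v w; rewrite /f !dotpE mulrDr mulrDl scalerDl opprD.
  by rewrite addrACA.
have fZ a : {morph f : v / a *: v}.
  move=> v; rewrite /f !dotpE scalerBr scalerA; congr (_ - _ *: _).
  by rewrite !mulrA (mulrC 2).
exists f; split => //.
- apply/measurable_fun_rVP => i; under eq_fun do rewrite !mxE.
  apply: measurable_funB; first exact: (measurable_rV_coord i).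
  apply: measurable_funM => //; apply: measurable_funM => //.
  apply: measurable_funM => //; apply: measurable_fun_dotp => // j.
  exact: (measurable_rV_coord j).
- move=> v; rewrite {1}/f.
  have -> : dotp (f v) u = - dotp v u by rewrite /f !dotpE -/c; field.
  by rewrite mulrN mulNr scaleNr opprK subrK.
- by move=> v; rewrite -scaleN1r fZ scaleN1r.
split => //; first by move=> v; rewrite /enorm fE.
have xxyy : dotp x x = dotp y y by rewrite -!sqr_enorm xy.
have xu : 2 * dotp x u = c.
  by rewrite /c uE !dotpE (dotpC y x) xxyy; ring.
by rewrite /f xu mulfV// scale1r uE opprB addrC subrK.
Qed.

Section cone.
Context {R : realType} {k : nat}.
Local Notation V := 'rV[R]_k.+1.
Implicit Types (r t d rho : R) (F : set V) (x y : V) (v w : 'rV[R]_k).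

Definition sphere r : set V := [set x | enorm x = r].

Definition cap r x rho : set V := [set y | enorm y = r /\ enorm (y - x) <= rho].

(** The open cone with vertex the origin over a subset [F] of the sphere. *)
Definition cone r F : set V :=
  [set p | 0 < enorm p < r /\ F ((r / enorm p) *: p)].

Lemma closed_enormB_le x r : closed [set y : V | enorm (y - x) <= r].
Proof.
rewrite (_ : [set y | _] = (fun y => enorm (y - x)) @^-1` [set` `]-oo, r]]).
  apply: preimage_closed; first by move=> y _; exact: enormB_continuous.
  exact: interval_closed.
by apply/seteqP; split => y; rewrite /preimage/= in_itv.
Qed.

Lemma closed_sphere r : closed (sphere r).
Proof.
rewrite (_ : sphere r = (fun y : V => enorm (y - 0)) @^-1` [set` `[r, r]]).
  apply: preimage_closed; first by move=> y _; exact: enormB_continuous.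
  exact: interval_closed.
apply/seteqP; split => y; rewrite /sphere /preimage/= in_itv/= subr0.
  by move=> ->; rewrite lexx.
by move=> h; apply/eqP; rewrite eq_le andbC.
Qed.

Lemma closed_cap r x rho : closed (cap r x rho).
Proof. by apply: closedI; [exact: closed_sphere|exact: closed_enormB_le]. Qed.

Lemma measurable_cone r F : closed F -> measurable (cone r F).
Proof.
move=> cF; have me : measurable_fun [set: V] (@enorm R k.+1).
  by apply: measurable_fun_enorm => i; exact: (measurable_rV_coord i).
apply: (@measurableI _ _ ((@enorm R k.+1) @^-1` [set` `]0, r[])).
  by apply: measurable_preimageT => //; exact: measurable_itv.
apply: (@measurable_preimageT _ _ _ _ (fun p : V => (r / enorm p) *: p)).
  apply/measurable_fun_rVP => i; under eq_fun do rewrite mxE.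
  apply: measurable_funM; last exact: (measurable_rV_coord i).
  by apply: measurable_funM => //; exact: (measurableT_comp measurable_fun_inv).
exact: closed_measurable_rV.
Qed.

Lemma coneU r F G : cone r (F `|` G) = cone r F `|` cone r G.
Proof.
by apply/seteqP; split => p; [move=> [? [?|?]]; [left|right]|move=> [[? ?]|[? ?]];
  split => //; [left|right]].
Qed.

Lemma cone_disj r F G : F `&` G = set0 -> cone r F `&` cone r G = set0.
Proof.
move=> FG; apply/seteqP; split => // p [[_ Fp] [_ Gp]].
by have : (F `&` G) ((r / enorm p) *: p) by []; rewrite FG.
Qed.

Lemma cone_sphere r : 0 < r -> cone r (sphere r) `|` [set 0] = eball 0 r.
Proof.
move=> r0; apply/seteqP; split => p; rewrite /eball/= subr0.
  by move=> [[/andP[]]//|->]; rewrite enorm0.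
move=> pr; have [->|p0] := eqVneq p 0; [by right|left].
have e0 := enorm_gt0 p0; split; first by rewrite e0.
by rewrite /sphere/= enormZ gtr0_norm ?divr_gt0// divfK// gt_eqF.
Qed.

(** Rotating [F] rotates its cone. *)
Lemma lebesgue_rV_cone_rotate r F x y : closed F -> enorm x = enorm y ->
  exists f : V -> V, [/\ lebesgue_rV (cone r F) = lebesgue_rV (cone r (f @^-1` F)),
    measurable (cone r (f @^-1` F)),
    (forall u u', enorm (f u - f u') = enorm (u - u')),
    (forall u, enorm (f u) = enorm u) & f x = y /\ f y = x].
Proof.
move=> cF xy; have [f [mf fK fD fN [fZ fE fx]]] := exists_reflection xy.
have E : cone r (f @^-1` F) = f @^-1` cone r F.
  by apply/seteqP; split => p; rewrite /cone /preimage/= fZ fE.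
have mC := measurable_cone r cF.
exists f; rewrite E; split => //.
- by rewrite (lebesgue_rV_isometry mf fK fD fE mC).
- exact: measurable_preimageT.
- by move=> u u'; rewrite -fN -fD fE.
- by split => //; rewrite -fx fK.
Qed.

Lemma enorm_cons_head t v : `|t| <= enorm (rV_cons t v).
Proof.
rewrite -ler_sqr ?nnegrE ?enorm_ge0// sqr_enorm dotp_cons real_normK ?num_real//.
by rewrite expr2 lerDl dotp_ge0.
Qed.

Lemma enorm_cons_tail t v : enorm v <= enorm (rV_cons t v).
Proof.
rewrite -ler_sqr ?nnegrE ?enorm_ge0// !sqr_enorm dotp_cons.
by rewrite lerDr -expr2 sqr_ge0.
Qed.

Lemma enorm_cons_le t v : enorm (rV_cons t v) <= `|t| + enorm v.
Proof.
rewrite le_enorm ?addr_ge0 ?enorm_ge0// dotp_cons sqrrD -expr2 real_normK ?num_real//.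
by rewrite -sqr_enorm addrAC lerDl mulrn_wge0// mulr_ge0 ?enorm_ge0.
Qed.

Lemma enorm_axis r : 0 <= r -> enorm (rV_cons r 0 : V) = r.
Proof.
move=> r0; rewrite /enorm dotp_cons -expr2 -[dotp 0 0]sqr_enorm enorm0.
by rewrite expr0n addr0 sqrtr_sqr ger0_norm.
Qed.

Lemma rV_consB t v t' w : rV_cons t v - rV_cons t' w = rV_cons (t - t') (v - w).
Proof. by rewrite -scaleN1r rV_consZ rV_consD !scaleN1r mulN1r. Qed.

(** Central projection to the hyperplane at height [t] expands the distances
    near the axis by a factor close to [t / r]. *)
Lemma gnomonic_diam r d t v w a b : 0 <= d -> d < r -> 0 < t ->
  let x := rV_cons (a * t) (a *: v) in let y := rV_cons (b * t) (b *: w) in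
  enorm (x - rV_cons r 0) <= d -> enorm (y - rV_cons r 0) <= d ->
  enorm (x - y) <= d -> enorm (v - w) <= t * (d * r / (r - d) ^+ 2).
Proof.
move=> d0 dr t0 x y; rewrite !rV_consB !subr0.
set x1 := a * t; set y1 := b * t; set x' := a *: v; set y' := b *: w.
move=> xd yd xyd.
have rd : 0 < r - d by rewrite subr_gt0.
have lo s (u : 'rV[R]_k) : enorm (rV_cons (s - r) u) <= d -> r - d <= s.
  by move=> /(le_trans (enorm_cons_head (s - r) u)); rewrite ler_norml => /andP[]; lra.
have x1d := lo _ _ xd; have y1d := lo _ _ yd.
have x10 : 0 < x1 by lra.
have y10 : 0 < y1 by lra.
have xy1 : `|y1 - x1| <= d.
  by rewrite distrC; exact: le_trans (enorm_cons_head _ _) xyd.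
have xy' : enorm (x' - y') <= d by exact: le_trans (enorm_cons_tail _ _) xyd.
have yd' : enorm y' <= d by exact: le_trans (enorm_cons_tail _ _) yd.
have a0 : a != 0 by apply: contraTneq x10 => a0; rewrite /x1 a0 mul0r ltxx.
have b0 : b != 0 by apply: contraTneq y10 => b0; rewrite /y1 b0 mul0r ltxx.
have -> : v - w = (t / x1) *: (x' - y') + (t * (y1 - x1) / (x1 * y1)) *: y'.
  apply/rowP => i; rewrite !mxE /x1 /y1; field.
  by rewrite a0 b0 gt_eqF.
apply: le_trans (enormD _ _) _; rewrite enormZ enormZ.
have -> : t * (d * r / (r - d) ^+ 2) =
    t / (r - d) * d + t * d / ((r - d) * (r - d)) * d.
  by field; rewrite gt_eqF.
apply: lerD; apply: ler_pM => //; rewrite ?enorm_ge0//.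
  rewrite ger0_norm ?divr_ge0 ?(ltW t0) ?(ltW x10)//.
  by rewrite ler_pM2l// lef_pV2 ?posrE.
rewrite !normrM normfV (gtr0_norm t0) (gtr0_norm (mulr_gt0 x10 y10)).
apply: ler_pM; rewrite ?mulr_ge0 ?(ltW t0)//.
- by rewrite invr_ge0 mulr_ge0 ?ltW.
- by rewrite ler_pM2l.
have rd2 := mulr_gt0 rd rd; have xy0 := mulr_gt0 x10 y10.
by rewrite lef_pV2 ?posrE//; apply: ler_pM => //; exact: ltW.
Qed.

Let lebesgue_rV_cone_le_axis r d F : 0 <= d -> d < r -> measurable (cone r F) ->
  F (rV_cons r 0) -> (forall x y, F x -> F y -> enorm (x - y) <= d) ->
  (k.+1%:R%:E * lebesgue_rV (cone r F) <=
   (omega R k * ((d * (r / (r - d)) ^+ 2) / 2) ^+ k * r)%:E)%E.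
Proof.
move=> d0 dr mC Fr Fd; have r0 : 0 < r by exact: le_lt_trans dr.
pose s := d * r / (r - d) ^+ 2; have s0 : 0 <= s.
  by apply: divr_ge0; [rewrite mulr_ge0// ltW|rewrite exprn_ge0// subr_ge0 ltW].
pose c := omega R k * (s / 2) ^+ k; have c0 : 0 <= c.
  by rewrite mulr_ge0 ?omega_ge0// exprn_ge0// divr_ge0.
have axis t v : rV_section (cone r F) t v -> 0 < t /\ t < r.
  case=> /andP[p0 pr] Fp; have := Fd _ _ Fp Fr.
  rewrite rV_consZ rV_consB => Frd; have := le_trans (enorm_cons_head _ _) Frd.
  rewrite ler_norml => /andP[h _]; split; last first.
    by apply: le_lt_trans pr; apply: le_trans (enorm_cons_head _ _); exact: ler_norm.
  rewrite -(pmulr_rgt0 _ (divr_gt0 r0 p0)); lra.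
have sec t : 0 < t -> (lebesgue_rV (rV_section (cone r F) t) <= (c * t ^+ k)%:E)%E.
  move=> t0; rewrite (_ : c * t ^+ k = omega R k * ((t * s) / 2) ^+ k); last first.
    by rewrite /c -mulrA -exprMn; congr (_ * _ ^+ _); ring.
  apply: isodiametric_le.
  - exact: measurable_rV_section.
  - by rewrite mulr_ge0// ltW.
  move=> v w [_ Fv] [_ Fw]; rewrite !rV_consZ in Fv Fw.
  exact: (gnomonic_diam d0 dr t0 (Fd _ _ Fv Fr) (Fd _ _ Fw Fr) (Fd _ _ Fv Fw)).
have -> : omega R k * ((d * (r / (r - d)) ^+ 2) / 2) ^+ k * r = c * r ^+ k.+1.
  have -> : d * (r / (r - d)) ^+ 2 / 2 = (s / 2) * r.
    by rewrite /s expr_div_n; field; rewrite gt_eqF// subr_gt0.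
  by rewrite /c exprMn exprSr; ring.
have mX : measurable_fun [set: R] (fun t : R => (k.+1%:R * t ^+ k)%:E).
  by apply/measurable_EFinP; apply: measurable_funM.
rewrite EFinM -integral_exprn// lebesgue_rVS.
rewrite -ge0_integralZl//; last exact: measurable_lebesgue_section.
rewrite -ge0_integralZl//; last 2 first.
- exact: measurable_funTS mX.
- by move=> t /=; rewrite in_itv/= lee_fin => /andP[t0 _]; rewrite mulr_ge0 ?exprn_ge0.
rewrite [leRHS]integral_mkcond; apply: ge0_le_integral => //.
- by move=> t _; rewrite mule_ge0// lebesgue_rV_ge0.
- by apply: measurable_funeM; exact: measurable_lebesgue_section.
- apply: (iffLR (measurable_restrictT _ (measurable_itv _))).
  apply: measurable_funeM.
  exact: measurable_funTS mX.
move=> t _; rewrite patchE; case: ifPn => tr.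
  move: tr; rewrite inE/= in_itv/= => /andP[]; rewrite le_eqVlt => /orP[/eqP<- _|t0 _].
    rewrite (_ : rV_section _ _ = set0) ?lebesgue_rV0 ?mule0//.
      by rewrite -EFinM lee_fin; apply: mulr_ge0 => //; apply: mulr_ge0 => //; apply: exprn_ge0.
    by apply/seteqP; split => // v /axis[]; rewrite ltxx.
  apply: (@le_trans _ _ (k.+1%:R%:E * (c * t ^+ k)%:E)%E).
    by rewrite lee_wpmul2l// sec.
  by rewrite -!EFinM lee_fin mulrCA.
rewrite (_ : rV_section _ _ = set0) ?lebesgue_rV0 ?mule0//.
apply/seteqP; split => // v /axis[t0 t1]; move/negP: tr; apply.
by rewrite inE/= in_itv/= !ltW.
Qed.

(** By rotation, [F] contains the point [r e_1]. The section of the cone at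
    height [t] is the central projection of [F] to that height, and the
    isodiametric inequality bounds its volume. *)
Lemma lebesgue_rV_cone_le r d F : 0 <= d -> d < r -> closed F ->
  F `<=` sphere r -> (forall x y, F x -> F y -> enorm (x - y) <= d) ->
  (k.+1%:R%:E * lebesgue_rV (cone r F) <=
   (omega R k * ((d * (r / (r - d)) ^+ 2) / 2) ^+ k * r)%:E)%E.
Proof.
move=> d0 dr cF FS Fd; have r0 : 0 < r by exact: le_lt_trans dr.
have [F0|/set0P[x Fx]] := eqVneq F set0.
  rewrite (_ : cone r F = set0) ?lebesgue_rV0 ?mule0; last first.
    by apply/seteqP; split => // p [_]; rewrite F0.
  rewrite lee_fin mulr_ge0 ?(ltW r0)// mulr_ge0 ?omega_ge0// exprn_ge0//.
  by rewrite divr_ge0// mulr_ge0// sqr_ge0.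
have xe : enorm x = enorm (rV_cons r 0 : V).
  by rewrite (FS _ Fx) enorm_axis// ltW.
have [f [-> mC fB fE [fx fe]]] := lebesgue_rV_cone_rotate r cF xe.
apply: lebesgue_rV_cone_le_axis => //.
  by rewrite /preimage/= fe.
by move=> u v Fu Fv; rewrite -fB; exact: Fd.
Qed.

End cone.

Section cone_cap.
Context {R : realType} {k : nat}.
Local Notation V := 'rV[R]_k.+1.

(** The cap contains the central projection of the flat disc of radius [rho]
    tangent to the sphere at its centre, because that projection is a
    contraction. *)
Let section_cone_cap (r rho t : R) (v : 'rV[R]_k) : 0 < r -> 0 < rho ->
  0 < t -> t < r ^+ 2 / (r + rho) -> enorm v < t * (rho / r) ->
  rV_section (cone r (cap r (rV_cons r 0) rho)) t v.
Proof.
move=> r0 rho0 t0 tT vt; rewrite /rV_section /cone /cap/=.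
set q := enorm (rV_cons t v).
have tq : t <= q.
  by apply: le_trans (enorm_cons_head _ _); exact: ler_norm.
have q0 : 0 < q by exact: lt_le_trans tq.
have qE : q ^+ 2 = t ^+ 2 + enorm v ^+ 2 by rewrite !sqr_enorm dotp_cons expr2.
have qr : q < r.
  apply: le_lt_trans (enorm_cons_le _ _) _; rewrite gtr0_norm//.
  apply: (@lt_trans _ _ (t + t * (rho / r))); first by rewrite ltrD2l.
  rewrite (_ : t + _ = t * ((r + rho) / r)); last by field; rewrite gt_eqF.
  rewrite -ltr_pdivlMr ?divr_gt0 ?addr_gt0// (_ : r / _ = r ^+ 2 / (r + rho))//.
  by field; rewrite !gt_eqF ?addr_gt0.
split; first by rewrite q0.
have rqE : enorm ((r / q) *: rV_cons t v) = r.
  by rewrite enormZ -/q gtr0_norm ?divr_gt0// divfK// gt_eqF.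
have r0' := ltW r0; have rho0' := ltW rho0.
split=> //; rewrite le_enorm// !dotpE (dotpC (rV_cons r 0)).
rewrite -[dotp (rV_cons r 0) _]sqr_enorm enorm_axis//.
rewrite -[dotp (rV_cons t v) (rV_cons t v)]sqr_enorm -/q dotp_cons.
have -> : dotp v 0 = 0 by rewrite /dotp big1// => i _; rewrite mxE mulr0.
rewrite addr0.
rewrite [leLHS](_ : _ = 2 * r ^+ 2 * (1 - t / q)); last first.
  by field; rewrite gt_eqF.
have v2 : r ^+ 2 * enorm v ^+ 2 <= t ^+ 2 * rho ^+ 2.
  have t0' := ltW t0.
  rewrite -!exprMn ler_sqr ?nnegrE ?mulr_ge0 ?enorm_ge0//.
  by move: (ltW vt); rewrite mulrA ler_pdivlMr// mulrC.
have h1 : 2 * (1 - t / q) * t ^+ 2 <= enorm v ^+ 2.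
  have -> : enorm v ^+ 2 = q ^+ 2 - t ^+ 2 by rewrite qE; ring.
  have -> : 1 - t / q = (q - t) / q by field; rewrite gt_eqF.
  rewrite mulrAC mulrA ler_pdivrMr// mulrAC.
  have -> : (q ^+ 2 - t ^+ 2) * q = (q - t) * ((q + t) * q) by ring.
  rewrite -[leLHS]mulrA mulrCA; apply: ler_wpM2l; first by rewrite subr_ge0.
  rewrite expr2; nra.
rewrite -(ler_pM2r (exprn_gt0 2 t0)); apply: le_trans _ (_ : t ^+ 2 * rho ^+ 2 <= _).
  apply: le_trans v2.
  rewrite [leLHS](_ : _ = r ^+ 2 * (2 * (1 - t / q) * t ^+ 2)); last by ring.
  by apply: ler_wpM2l => //; exact: sqr_ge0.
by rewrite mulrC.
Qed.

Let lebesgue_rV_cone_cap_axis (r rho : R) : 0 < r -> 0 < rho ->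
  ((omega R k * rho ^+ k * r * (r / (r + rho)) ^+ k.+1)%:E <=
   k.+1%:R%:E * lebesgue_rV (cone r (cap r (rV_cons r 0 : V) rho)))%E.
Proof.
move=> r0 rho0; set C := cone _ _.
have mC : measurable C by apply: measurable_cone; exact: closed_cap.
pose T := r ^+ 2 / (r + rho).
have rr0 : 0 < r + rho by rewrite addr_gt0.
have T0 : 0 < T by rewrite divr_gt0// exprn_gt0.
pose c := omega R k * (rho / r) ^+ k.
have c0 : 0 <= c by rewrite mulr_ge0 ?omega_ge0// exprn_ge0// divr_ge0// ltW.
have -> : omega R k * rho ^+ k * r * (r / (r + rho)) ^+ k.+1 = c * T ^+ k.+1.
  have TE : T = r * (r / (r + rho)) by rewrite /T expr2 mulrA.
  have rk : (rho / r) ^+ k * r ^+ k = rho ^+ k by rewrite -exprMn divfK// gt_eqF.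
  rewrite /c TE [in RHS](exprMn k.+1 r) -rk (exprSr r).
  by move: (_ ^+ k.+1) => y; ring.
have mX : measurable_fun [set: R] (fun t : R => (k.+1%:R * t ^+ k)%:E).
  by apply/measurable_EFinP; apply: measurable_funM.
rewrite EFinM -integral_exprn// lebesgue_rVS.
rewrite -ge0_integralZl//; last 2 first.
- exact: measurable_funTS mX.
- by move=> t /=; rewrite in_itv/= lee_fin => /andP[t0 _]; rewrite mulr_ge0 ?exprn_ge0.
rewrite -ge0_integralZl//; last exact: measurable_lebesgue_section.
have mcX D : measurable_fun D (fun t : R => (c%:E * (k.+1%:R * t ^+ k)%:E)%E).
  by apply: measurable_funeM; exact: measurable_funTS mX.
rewrite (@integral_itv_bndoo _ 0 T _ true false)//.
rewrite [leLHS]integral_mkcond; apply: ge0_le_integral => //.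
- move=> t _; rewrite patchE; case: ifPn => //; rewrite inE/= in_itv/= => /andP[/ltW t0 _].
  by rewrite -EFinM lee_fin; apply: mulr_ge0 => //; apply: mulr_ge0 => //; apply: exprn_ge0.
- by apply: (iffLR (measurable_restrictT _ (measurable_itv _))).
- by apply: measurable_funeM; exact: measurable_lebesgue_section.
move=> t _; rewrite patchE; case: ifPn => tr; last by rewrite mule_ge0// lebesgue_rV_ge0.
move: tr; rewrite inE/= in_itv/= => /andP[t0 tT].
rewrite -EFinM mulrCA EFinM lee_wpmul2l//.
rewrite (_ : c * t ^+ k = omega R k * (t * (rho / r)) ^+ k); last first.
  by rewrite /c -mulrA -exprMn (mulrC t).
have tr0 : 0 < t * (rho / r) by rewrite mulr_gt0// divr_gt0.
rewrite -(lebesgue_rV_eball 0 tr0).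
apply: le_measure; rewrite ?inE; [exact: measurable_eball|exact: measurable_rV_section|].
by move=> v; rewrite /eball/= subr0 => vt; exact: section_cone_cap.
Qed.

Lemma lebesgue_rV_cone_cap (r rho : R) (x : V) : 0 < r -> 0 < rho ->
  enorm x = r ->
  ((omega R k * rho ^+ k * r * (r / (r + rho)) ^+ k.+1)%:E <=
   k.+1%:R%:E * lebesgue_rV (cone r (cap r x rho)))%E.
Proof.
move=> r0 rho0 xr; have xe : enorm x = enorm (rV_cons r 0 : V).
  by rewrite xr enorm_axis// ltW.
have [f [-> _ fB fE [fx fe]]] :=
  lebesgue_rV_cone_rotate r (closed_cap (r := r) (x := x) (rho := rho)) xe.
rewrite (_ : f @^-1` cap r x rho = cap r (rV_cons r 0) rho).
  exact: lebesgue_rV_cone_cap_axis.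
by apply/seteqP; split => u; rewrite /cap /preimage/= fE -fe fB.
Qed.

End cone_cap.

(** * The Hausdorff measure of a sphere *)

Section ediam.
Context {R : realType} {n : nat}.
Implicit Types (A : set 'rV[R]_n) (d : R).
Local Open Scope ereal_scope.

Lemma ediam_le A d : (0 <= d)%R ->
  (forall x y, A x -> A y -> (enorm (x - y) <= d)%R) -> ediam A <= d%:E.
Proof.
move=> d0 Ad; apply: ge_ereal_sup => _ [->|[[x y] [/= Ax Ay] <-]].
  by rewrite lee_fin.
by rewrite lee_fin Ad.
Qed.

Lemma enorm_le_ediam A d x y : ediam A <= d%:E -> A x -> A y ->
  (enorm (x - y) <= fine (ediam A))%R.
Proof.
move=> Ad Ax Ay; rewrite -lee_fin fineK.
  by apply: ereal_sup_ubound; right; exists (x, y).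
by rewrite ge0_fin_numE ?ediam_ge0// (le_lt_trans Ad)// ltry.
Qed.

Lemma fine_ediam_le A d : ediam A <= d%:E -> (0 <= fine (ediam A) <= d)%R.
Proof.
move=> Ad; rewrite fine_ge0 ?ediam_ge0//= -lee_fin fineK//.
by rewrite ge0_fin_numE ?ediam_ge0// (le_lt_trans Ad)// ltry.
Qed.

Lemma closure_enorm_le A d : (forall x y, A x -> A y -> (enorm (x - y) <= d)%R) ->
  forall x y, closure A x -> closure A y -> (enorm (x - y) <= d)%R.
Proof.
move=> Ad x y cx cy; apply/ler_addgt0Pr => e e0.
have e2 : (0 < e / 2)%R by rewrite divr_gt0.
have [x' [Ax' xx']] := cx _ (nbhs_eball x e2).
have [y' [Ay' yy']] := cy _ (nbhs_eball y e2).
have := Ad _ _ Ax' Ay'; have := enorm_triangle x' x y; have := enorm_triangle y' x' y.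
move: xx' yy'; rewrite /eball/= (enormB x' x); lra.
Qed.

Lemma hausdorff_gauge_le m A d : (0 <= d)%R -> ediam A <= d%:E ->
  hausdorff_gauge m A <= (omega R m * (d / 2) ^+ m)%:E.
Proof.
move=> d0 Ad; rewrite /hausdorff_gauge; case: ifPn => _.
  by rewrite lee_fin mulr_ge0 ?omega_ge0// exprn_ge0// divr_ge0.
have /andP[f0 fd] := fine_ediam_le Ad.
rewrite lee_fin ler_wpM2l ?omega_ge0// lerXn2r ?nnegrE ?divr_ge0//.
by rewrite ler_pM2r// invr_gt0.
Qed.

Lemma hausdorff_content0 m d : (0 <= d)%R -> hausdorff_content m d (set0 : set 'rV[R]_n) = 0.
Proof.
move=> d0; apply/eqP; rewrite eq_le hausdorff_content_ge0 andbT.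
apply: ereal_inf_lbound; exists (fun=> set0) => /=.
  by split => // k; rewrite ediam0 lee_fin.
by apply: eseries0 => k _ _; rewrite /hausdorff_gauge eqxx.
Qed.

Lemma hausdorff_contentU m d A B : (0 <= d)%R ->
  hausdorff_content m d (A `|` B) <=
  hausdorff_content m d A + hausdorff_content m d B.
Proof.
move=> d0.
pose mix := isOuterMeasure.Build R 'rV[R]_n (hausdorff_content m d)
  (hausdorff_content0 m d0) (@hausdorff_content_ge0 R n m d)
  (@le_hausdorff_content R n m d) (@hausdorff_content_sigma_subadditive R n m d).
pose mu : {outer_measure set 'rV[R]_n -> \bar R} :=
  HB.pack (hausdorff_content m d) mix.
exact: (outer_measureU2 mu).
Qed.

Lemma hausdorff_content_le_gauge m d A : (0 <= d)%R -> ediam A <= d%:E ->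
  hausdorff_content m d A <= hausdorff_gauge m A.
Proof.
move=> d0 Ad; apply: ereal_inf_lbound.
exists (fun i : nat => if i == 0%N then A else set0).
  split => [x Ax|[|i]//=]; first by exists 0%N.
  by rewrite ediam0 lee_fin.
rewrite nneseries_recl//=; last by move=> *; exact: hausdorff_gauge_ge0.
rewrite eseries0 ?adde0// => -[|i]//= _ _.
by rewrite /hausdorff_gauge eqxx.
Qed.

End ediam.

Section hausdorff_sphere_ge.
Context {R : realType} {k : nat}.
Local Notation V := 'rV[R]_k.+1.
Local Open Scope ereal_scope.

(** The cones over the closures of the sets of a cover of the sphere cover the
    ball, and [lebesgue_rV_cone_le] bounds the volume of each by the gauge of the
    corresponding set, up to a factor that tends to 1 with [d]. *)
Let hausdorff_content_sphere_ge (r d : R) : (0 < d < r)%R ->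
  ((k.+1%:R * omega R k.+1 * r ^+ k) * ((r - d) / r) ^+ 2 ^+ k)%:E <=
  hausdorff_content k d (sphere r : set V).
Proof.
move=> /andP[d0 dr]; have r0 : (0 < r)%R by exact: lt_trans dr.
have rd0 : (0 < r - d)%R by rewrite subr_gt0.
apply: le_ereal_inf_tmp => _ [F [SF Fd] <-].
pose G i : set V := closure (F i) `&` sphere r.
pose c : R := (((r / (r - d)) ^+ 2) ^+ k * r)%R.
have c0 : (0 < c)%R.
  by rewrite mulr_gt0// exprn_gt0// exprn_gt0// divr_gt0.
have cG i : closed (G i) by apply: closedI; [exact: closed_closure|exact: closed_sphere].
have mcG i : measurable (cone r (G i)) by exact: measurable_cone.
have GF i : k.+1%:R%:E * lebesgue_rV (cone r (G i)) <= c%:E * hausdorff_gauge k (F i).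
  have [F0|FN0] := eqVneq (F i) set0.
    rewrite (_ : cone r (G i) = set0).
      rewrite lebesgue_rV0 mule0 mule_ge0 ?hausdorff_gauge_ge0//.
      by rewrite lee_fin ltW.
    by apply/seteqP; split => // p [_]; rewrite /G F0 closure0 => -[].
  have /andP[f0 fd] := fine_ediam_le (Fd i).
  set di := fine _ in f0 fd.
  have fr : (di < r)%R by exact: le_lt_trans dr.
  apply: (le_trans (lebesgue_rV_cone_le f0 fr (cG i) _ _)).
  - by move=> x [].
  - move=> x y [cx _] [cy _]; apply: closure_enorm_le cx cy => u v Fu Fv.
    exact: enorm_le_ediam (Fd i) Fu Fv.
  rewrite /hausdorff_gauge (negbTE FN0) -EFinM lee_fin.
  rewrite [leRHS](_ : _ = omega R k * ((di / 2) * (r / (r - d)) ^+ 2) ^+ k * r)%R; last first.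
    by rewrite /c [in RHS]exprMn; ring.
  rewrite ler_wpM2r ?(ltW r0)// ler_wpM2l ?omega_ge0//.
  have rdi0 : (0 < r - di)%R by rewrite subr_gt0.
  have q0 (e : R) : (0 < r - e)%R -> (0 <= r / (r - e))%R.
    by move=> e0; rewrite divr_ge0// ltW.
  have L0 : (0 <= di * (r / (r - di)) ^+ 2 / 2)%R.
    by rewrite divr_ge0// mulr_ge0// sqr_ge0.
  have R0 : (0 <= di / 2 * (r / (r - d)) ^+ 2)%R.
    by rewrite mulr_ge0 ?sqr_ge0// divr_ge0.
  rewrite lerXn2r ?nnegrE// mulrAC ler_wpM2l ?divr_ge0//.
  rewrite lerXn2r ?nnegrE ?q0//.
  by rewrite ler_pM2l// lef_pV2 ?posrE// lerB.
have ballG : eball (0 : V) r `<=` [set 0%R] `|` \bigcup_i cone r (G i).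
  move=> p; rewrite -cone_sphere// => -[[pr Sp]|->]; [right|by left].
  have [i _ Fp] := SF _ Sp; exists i => //; split => //; split => //.
  exact: subset_closure.
have le1 : lebesgue_rV (eball (0 : V) r) <=
    \sum_(i <oo) lebesgue_rV (cone r (G i)).
  have mU : measurable (\bigcup_i cone r (G i)) by exact: bigcupT_measurable.
  have m1 : measurable [set 0%R : V].
    by apply: closed_measurable_rV;
      exact/accessible_closed_set1/hausdorff_accessible/norm_hausdorff.
  apply: (@le_trans _ _ (lebesgue_rV ([set 0%R] `|` \bigcup_i cone r (G i)))).
    by apply: le_measure; rewrite ?inE//; [exact: measurable_eball|exact: measurableU].
  apply: (@le_trans _ _ (lebesgue_rV [set 0%R : V] + lebesgue_rV (\bigcup_i cone r (G i)))).
    exact: measureU2.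
  rewrite lebesgue_rV_point add0e.
  exact: (@measure_sigma_subadditive _ _ _ (@lebesgue_rV R k.+1)).
have le2 : k.+1%:R%:E * lebesgue_rV (eball (0 : V) r) <=
    c%:E * \sum_(i <oo) hausdorff_gauge k (F i).
  apply: (@le_trans _ _ (k.+1%:R%:E * \sum_(i <oo) lebesgue_rV (cone r (G i)))).
    by rewrite lee_wpmul2l.
  rewrite -nneseriesZl; last by move=> i _; exact: lebesgue_rV_ge0.
  rewrite -nneseriesZl; last by move=> i _; exact: hausdorff_gauge_ge0.
  by apply: lee_nneseries => // i _ _; rewrite mule_ge0 ?lebesgue_rV_ge0.
rewrite -(lee_pmul2l _ (_ : 0 < c%:E))// ?lte_fin//.
apply: le_trans le2; rewrite lebesgue_rV_eball// -!EFinM lee_fin.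
rewrite [leLHS](_ : _ = k.+1%:R * (omega R k.+1 * r ^+ k.+1) *
    ((r / (r - d)) ^+ 2 * ((r - d) / r) ^+ 2) ^+ k)%R; last first.
  by rewrite /c (exprSr r k) [in RHS](exprMn k); ring.
rewrite (_ : (r / (r - d)) ^+ 2 * ((r - d) / r) ^+ 2 = 1)%R; last first.
  by field; rewrite !gt_eqF.
by rewrite expr1n mulr1.
Qed.

Lemma hausdorff_sphere_ge (r : R) : (0 < r)%R ->
  (k.+1%:R * omega R k.+1 * r ^+ k)%:E <= hausdorff k (sphere r : set V).
Proof.
move=> r0; pose A := (k.+1%:R * omega R k.+1 * r ^+ k)%R.
have le_d (d : R) : (0 < d < r)%R ->
    (A * ((r - d) / r) ^+ 2 ^+ k)%:E <= hausdorff k (sphere r : set V).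
  move=> dr; apply: le_trans (hausdorff_content_sphere_ge dr) _.
  by apply: ereal_sup_ubound; exists d => //=; case/andP: dr.
have [->|Hy] := eqVneq (hausdorff k (sphere r : set V)) +oo; first exact: leey.
have Hf : hausdorff k (sphere r : set V) \is a fin_num.
  by rewrite ge0_fin_numE ?hausdorff_ge0// ltey.
rewrite -(fineK Hf) lee_fin.
have : (A * ((r - d) / r) ^+ 2 ^+ k)%R @[d --> (0 : R)^'+] -->
    (A * ((r - 0) / r) ^+ 2 ^+ k)%R.
  apply: cvg_at_right_filter; apply: cvgM; first exact: cvg_cst.
  apply: (@cvg_comp _ _ _ (fun d : R => ((r - d) / r) ^+ 2)%R (fun x => x ^+ k)%R _
    (nbhs (((r - 0) / r) ^+ 2)%R)); last exact: (@exprn_continuous R k _).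
  apply: (@cvg_comp _ _ _ (fun d : R => (r - d) / r)%R (fun x => x ^+ 2)%R _
    (nbhs ((r - 0) / r)%R)); last exact: (@exprn_continuous R 2 _).
  by apply: cvgM; [apply: cvgB; [exact: cvg_cst|exact: cvg_id]|exact: cvg_cst].
rewrite subr0 divff ?gt_eqF// !expr1n mulr1 => /cvgr_to_le; apply; near=> d.
rewrite -lee_fin fineK//; apply: le_d; apply/andP; split; near: d.
  exact: nbhs_right_gt.
exact: nbhs_right_lt.
Unshelve. all: by end_near. Qed.

End hausdorff_sphere_ge.

Section packing.
Context {R : realType} {k : nat}.
Local Notation V := 'rV[R]_k.+1.
Variable r : R.
Hypothesis r0 : 0 < r.
Implicit Types (rho : R) (K : set V) (s : seq V).

(** The set [K] to be avoided absorbs the caps already placed, as in [fill], so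
    that volumes add up along the same recursion. *)
Fixpoint packing rho K s : Prop :=
  if s is x :: s' then
    [/\ enorm x = r, cap r x rho `&` K = set0 & packing rho (K `|` cap r x rho) s']
  else True.

Fixpoint fill rho K s : set V :=
  if s is x :: s' then fill rho (K `|` cap r x rho) s' else K.

Lemma fillP rho K s y :
  fill rho K s y <-> K y \/ exists2 x, x \in s & cap r x rho y.
Proof.
elim: s K => [|x s IH] K /=.
  by split=> [|[//|[]//]]; left.
rewrite IH; split=> [[[Ky|xy]|[z zs zy]]|[Ky|[z]]].
- by left.
- by right; exists x => //; rewrite mem_head.
- by right; exists z => //; rewrite inE zs orbT.
- by left; left.
rewrite inE => /orP[/eqP->|zs] zy; first by left; right.
by right; exists z.
Qed.

Lemma closed_fill rho K s : closed K -> closed (fill rho K s).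
Proof.
elim: s K => [|x s IH] K //= cK; apply/IH/closedU => //; exact: closed_cap.
Qed.

Lemma packing_mem rho K s x : packing rho K s -> x \in s -> enorm x = r.
Proof.
elim: s K => [//|y s IH] K /= [yr _ ps].
by rewrite inE => /orP[/eqP->//|]; exact: IH ps.
Qed.

Lemma packing_rcons rho K s x : packing rho K s -> enorm x = r ->
  cap r x rho `&` fill rho K s = set0 -> packing rho K (rcons s x).
Proof.
elim: s K => [|y s IH] K /=; first by move=> _ xr xK; split.
by move=> [yr yK ps] xr xf; split => //; exact: IH.
Qed.

(** The lower bound of [lebesgue_rV_cone_cap] for [k + 1] times the volume of
    the cone over a cap of radius [rho]. *)
Definition cap_volume rho : R :=
  omega R k * rho ^+ k * r * (r / (r + rho)) ^+ k.+1.

Lemma packing_volume rho K s : 0 < rho -> closed K -> packing rho K s ->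
  (((size s)%:R * cap_volume rho)%:E + k.+1%:R%:E * lebesgue_rV (cone r K) <=
   k.+1%:R%:E * lebesgue_rV (cone r (fill rho K s)))%E.
Proof.
move=> rho0; elim: s K => [|x s IH] K cK; first by rewrite mul0r add0e.
move=> [xr xK ps]; rewrite [fill _ _ _]/= [size _]/=.
have cKx : closed (K `|` cap r x rho).
  by apply: closedU => //; exact: closed_cap.
apply: le_trans _ (IH _ cKx ps).
have m1 : measurable (cone r K) by exact: measurable_cone.
have m2 : measurable (cone r (cap r x rho)).
  by apply: measurable_cone; exact: closed_cap.
have dKx : cone r K `&` cone r (cap r x rho) = set0.
  by apply: cone_disj; rewrite setIC.
rewrite -natr1 mulrDl mul1r EFinD -addeA leeD2l// coneU.
have -> : lebesgue_rV (cone r K `|` cone r (cap r x rho)) =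
    (lebesgue_rV (cone r K) + lebesgue_rV (cone r (cap r x rho)))%E.
  exact: (measureU (@lebesgue_rV R k.+1) m1 m2 dKx).
have := lebesgue_rV_cone_cap r0 rho0 xr; rewrite -/(cap_volume rho).
have := lebesgue_rV_ge0 (cone r (cap r x rho)).
have := lebesgue_rV_ge0 (cone r K).
move: (lebesgue_rV (cone r K)) (lebesgue_rV (cone r (cap r x rho))) => a b a0 b0 cb.
by rewrite ge0_muleDr// [leLHS]addeC leeD2l.
Qed.

Lemma cone_volume_le K : closed K ->
  (k.+1%:R%:E * lebesgue_rV (cone r K) <=
   (k.+1%:R * (omega R k.+1 * r ^+ k.+1))%:E)%E.
Proof.
move=> cK; rewrite EFinM -(lebesgue_rV_eball 0)// lee_wpmul2l//.
apply: le_measure; rewrite ?inE; [exact: measurable_cone|exact: measurable_eball|].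
by move=> p [/andP[_ pr] _]; rewrite /eball/= subr0.
Qed.

Lemma cap_volume_gt0 rho : 0 < rho -> 0 < cap_volume rho.
Proof.
move=> rho0; rewrite /cap_volume !mulr_gt0 ?omega_gt0 ?exprn_gt0//.
by rewrite divr_gt0// addr_gt0.
Qed.

(** The cones over disjoint caps are disjoint subsets of the ball, so that
    volume bounds the number of caps. *)
Lemma exists_maximal_packing rho K : 0 < rho -> closed K ->
  exists s, packing rho K s /\
    forall x, enorm x = r -> cap r x rho `&` fill rho K s !=set0.
Proof.
move=> rho0 cK; pose Q : R := k.+1%:R * (omega R k.+1 * r ^+ k.+1).
have Q0 : 0 <= Q by rewrite !mulr_ge0 ?omega_ge0// exprn_ge0// ltW.
have c0 := cap_volume_gt0 rho0.
have size_le s : packing rho K s -> (size s)%:R * cap_volume rho <= Q.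
  move=> ps; rewrite -lee_fin.
  apply: le_trans _ (cone_volume_le (@closed_fill rho K s cK)).
  apply: le_trans _ (packing_volume rho0 cK ps).
  by rewrite leeDl// mule_ge0// lebesgue_rV_ge0.
pose P (j : nat) := `[< exists2 s, packing rho K s & size s = j >].
have exP : exists j, P j by exists 0%N; apply/asboolP; exists [::].
have ubP j : P j -> (j <= Num.bound (Q / cap_volume rho))%N.
  move=> /asboolP[s ps <-]; rewrite -(ler_nat R); apply: ltW.
  apply: le_lt_trans (archi_boundP _); last by rewrite divr_ge0// ltW.
  by rewrite ler_pdivlMr// size_le.
case: (ex_maxnP exP ubP) => j /asboolP[s ps <-] maxs.
exists s; split => // x xr; apply/set0P/negP => /eqP xs.
have /maxs : P (size s).+1.
  apply/asboolP; exists (rcons s x); last by rewrite size_rcons.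
  exact: packing_rcons.
by rewrite ltnn.
Qed.

(** Fill the sphere successively with caps of radii [delta / 2 ^ j]. Since the
    cap around a point [x] of the sphere meets, at every stage [j], a cap
    already chosen, each point lies either in the caps of the first [N] stages
    or in a cap of some later stage with its radius doubled. *)
Lemma exists_sphere_packing (delta : R) : 0 < delta ->
  exists s : nat -> seq V,
  [/\ forall j x, x \in s j -> enorm x = r,
      forall J, \sum_(j < J) (size (s j))%:R * cap_volume (delta / 2 ^+ j) <=
                k.+1%:R * (omega R k.+1 * r ^+ k.+1) &
      forall N x, enorm x = r -> exists j, exists2 y, y \in s j &
        cap r y ((if (j < N)%N then 1 else 2) * (delta / 2 ^+ j)) x].
Proof.
move=> delta0; pose rho (j : nat) := delta / 2 ^+ j.
have rho0 j : 0 < rho j by rewrite divr_gt0// exprn_gt0.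
have /choice[sel selP] : forall p : nat * set V, exists s, closed p.2 ->
    packing (rho p.1) p.2 s /\
    forall x, enorm x = r -> cap r x (rho p.1) `&` fill (rho p.1) p.2 s !=set0.
  move=> [j K] /=; have [cK|ncK] := pselect (closed K); last by exists [::].
  by have [s sP] := exists_maximal_packing (rho0 j) cK; exists s.
pose fix K (j : nat) : set V :=
  if j is j'.+1 then fill (rho j') (K j') (sel (j', K j')) else set0.
pose s j := sel (j, K j).
have cK j : closed (K j).
  by elim: j => [|j IH] /=; [exact: closed0|exact: closed_fill].
have sP j := selP (j, K j) (cK j).
have KP J y : K J y <-> exists2 j, (j < J)%N & exists2 x, x \in s j & cap r x (rho j) y.
  elim: J => [|J IH] /=; first by split => // -[].
  rewrite fillP IH; split=> [[[j jJ xy]|xy]|[j]].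
  - by exists j => //; rewrite ltnW.
  - by exists J.
  rewrite ltnS leq_eqVlt => /orP[/eqP->|jJ] xy; [by right|left].
  by exists j.
exists s; split.
- by move=> j x; have [ps _] := sP j; exact: packing_mem ps.
- move=> J; rewrite -lee_fin; apply: le_trans _ (cone_volume_le (cK J)).
  elim: J => [|J IH]; first by rewrite big_ord0 mule_ge0// lebesgue_rV_ge0.
  rewrite big_ord_recr/= EFinD addeC.
  have [ps _] := sP J; apply: le_trans _ (packing_volume (rho0 J) (cK J) ps).
  by rewrite leeD2l.
move=> N x xr; have [KNx|KNx] := pselect (K N x).
  move/KP : KNx => [j jN [y ys xy]]; exists j, y => //.
  by rewrite jN mul1r.
have /nbhs_eballP[e e0 eK] : nbhs x (~` K N).
  by apply: open_nbhs_nbhs; split => //; exact: closed_openC.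
have [J JN rJ] : exists2 J, (N <= J)%N & rho J < e.
  exists (maxn N (Num.bound (delta / e))); first exact: leq_maxl.
  rewrite /rho ltr_pdivrMr ?exprn_gt0// mulrC -ltr_pdivrMr//.
  apply: (@lt_trans _ _ (Num.bound (delta / e))%:R).
    by apply: archi_boundP; rewrite divr_ge0// ltW.
  apply: (@le_lt_trans _ _ (maxn N (Num.bound (delta / e)))%:R).
    by rewrite ler_nat leq_maxr.
  by rewrite -natrX ltr_nat ltn_expl.
have [_ /(_ x xr)[u [[ur xu] Ku]]] := sP J.
have /KP[j jJ [y ys [_ yu]]] : K J.+1 u by [].
have Nj : (N <= j)%N.
  rewrite leqNgt; apply/negP => jN; apply: (eK u).
    by rewrite /eball/=; exact: le_lt_trans xu rJ.
  by apply/KP; exists j => //; exists y.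
exists j, y => //; rewrite ltnNge Nj/=; split => //.
have := enorm_triangle u x y; rewrite (enormB x u).
have : rho J <= rho j.
  by rewrite ler_pM2l// lef_pV2 ?posrE ?exprn_gt0// ler_eXn2l// ltr1n.
by move: xu yu; rewrite -/(rho j) /=; lra.
Qed.

End packing.

Lemma bounded_series_tail (R : realType) (a : nat -> R) (Q e : R) : (forall j, 0 <= a j) ->
  (forall J, \sum_(j < J) a j <= Q) -> 0 < e ->
  exists N, forall J, (N <= J)%N -> \sum_(j < J) a j - \sum_(j < N) a j <= e.
Proof.
move=> a0 aQ e0; pose S J := \sum_(j < J) a j.
have hs : has_sup (range S).
  by split; [exists (S 0%N); exists 0%N|exists Q => _ [J _ <-]; exact: aQ].
have [_ [N _ <-] SN] := sup_adherent e0 hs.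
exists N => J NJ; have : S J <= sup (range S).
  by apply: ub_le_sup; [case: hs|exists J].
by move: SN; rewrite -/(S J) -/(S N); lra.
Qed.

Section hausdorff_sphere_le.
Context {R : realType} {k : nat}.
Local Notation V := 'rV[R]_k.+1.
Variable r : R.
Hypothesis r0 : 0 < r.

Let content_caps (d rho : R) (s : seq V) : 0 <= rho -> 2 * rho <= d ->
  (hausdorff_content k d [set x | exists2 y, y \in s & cap r y rho x] <=
   ((size s)%:R * (omega R k * rho ^+ k))%:E)%E.
Proof.
move=> rho0 rhod; have d0 : 0 <= d by apply: le_trans rhod; rewrite mulr_ge0.
elim: s => [|y s IH].
  rewrite (_ : [set x | _] = set0) ?hausdorff_content0 ?mul0r//.
  by apply/seteqP; split => // x [].
rewrite (_ : [set x | _] = cap r y rho `|` [set x | exists2 y, y \in s & cap r y rho x]).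
  apply: le_trans (hausdorff_contentU _ _ _ d0) _.
  rewrite [size _]/= -natr1 mulrDl mul1r addrC EFinD; apply: leeD => //.
  have capd : (ediam (cap r y rho) <= (2 * rho)%:E)%E.
    apply: ediam_le => [|u v [_ uy] [_ vy]]; first by rewrite mulr_ge0.
    by have := enorm_triangle y u v; rewrite (enormB y v); lra.
  apply: (@le_trans _ _ (hausdorff_gauge k (cap r y rho))).
    by apply: hausdorff_content_le_gauge => //; apply: le_trans capd _; rewrite lee_fin.
  have rE : rho = 2 * rho / 2 by rewrite mulrC mulKf.
  by rewrite {2}rE; apply: hausdorff_gauge_le => //; rewrite mulr_ge0.
apply/seteqP; split => x.
  move=> [z]; rewrite inE => /orP[/eqP->|zs] zx; first by left.
  by right; exists z.
move=> [yx|[z zs zx]]; first by exists y => //; rewrite mem_head.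
by exists z => //; rewrite inE zs orbT.
Qed.

(** Cover the sphere by the caps of the first [N] stages of the packing and the
    doubled caps of the others. The cones over the packing caps have total volume
    at most that of the ball, which bounds the sum of the gauges; the doubled
    caps contribute [2 ^ k] times a tail of that convergent series. *)
Let content_sphere_le (d delta : R) : 0 < delta -> 4 * delta <= d ->
  (hausdorff_content k d (sphere r : set V) <=
   (k.+1%:R * omega R k.+1 * r ^+ k * ((r + delta) / r) ^+ k.+1)%:E)%E.
Proof.
move=> delta0 deltad.
have [s [sr sQ scov]] := exists_sphere_packing (k := k) r0 delta0.
pose rho (j : nat) := delta / 2 ^+ j.
have rho0 j : 0 < rho j by rewrite divr_gt0// exprn_gt0.
have rho_le j : rho j <= delta.
  by rewrite ler_pdivrMr ?exprn_gt0// ler_peMr ?(ltW delta0)// exprn_ege1// ler1n.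
pose a j := (size (s j))%:R * (omega R k * rho j ^+ k).
have a0 j : 0 <= a j.
  by rewrite mulr_ge0// mulr_ge0 ?omega_ge0// exprn_ge0// ltW.
set Q := k.+1%:R * omega R k.+1 * r ^+ k * ((r + delta) / r) ^+ k.+1.
have rd0 : 0 < r + delta by rewrite addr_gt0.
pose c := r * (r / (r + delta)) ^+ k.+1.
have c0 : 0 < c by rewrite mulr_gt0// exprn_gt0// divr_gt0.
have aQ J : \sum_(j < J) a j <= Q.
  rewrite -(ler_pM2r c0) [leRHS](_ : _ = k.+1%:R * (omega R k.+1 * r ^+ k.+1)).
    apply: le_trans (sQ J); rewrite mulr_suml; apply: ler_sum => j _.
    have -> : @cap_volume R k r (delta / 2 ^+ j) =
        omega R k * rho j ^+ k * (r * (r / (r + rho j)) ^+ k.+1).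
      by rewrite /cap_volume !mulrA.
    have rr0 : 0 < r + rho j by rewrite addr_gt0.
    rewrite /a -[leLHS]mulrA; apply: ler_wpM2l => //; apply: ler_wpM2l.
      by rewrite mulr_ge0 ?omega_ge0// exprn_ge0// ltW.
    rewrite ler_pM2l// lerXn2r ?nnegrE ?divr_ge0 ?(ltW r0) ?(ltW rd0) ?(ltW rr0)//.
    by rewrite ler_pM2l// lef_pV2 ?posrE// lerD2l.
  have E : ((r + delta) / r) ^+ k.+1 * (r / (r + delta)) ^+ k.+1 = 1.
    by rewrite -exprMn mulf_div (mulrC r) divff ?expr1n// mulf_neq0// gt_eqF.
  by rewrite /Q /c mulrACA E mulr1 -!mulrA -exprSr.
apply/lee_addgt0Pr => e e0.
have e20 : 0 < e / 2 ^+ k by rewrite divr_gt0// exprn_gt0.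
have [N NP] := bounded_series_tail a0 aQ e20.
pose f j : R := if (j < N)%N then 1 else 2.
have f1 j : 1 <= f j by rewrite /f; case: ifP => _; rewrite ?ler1n.
have f2 j : f j <= 2 by rewrite /f; case: ifP => _; rewrite ?ler1n.
pose b j := (size (s j))%:R * (omega R k * (f j * rho j) ^+ k).
have b0 j : 0 <= b j.
  rewrite mulr_ge0// mulr_ge0 ?omega_ge0// exprn_ge0// mulr_ge0 ?(ltW (rho0 j))//.
  exact: le_trans (f1 j).
pose W j := [set x : V | exists2 y, y \in s j & cap r y (f j * rho j) x].
have SW : sphere r `<=` \bigcup_j W j.
  by move=> x /(scov N)[j [y ys yx]]; exists j => //; exists y.
apply: (le_trans (le_hausdorff_content k d SW)).
apply: (le_trans (hausdorff_content_sigma_subadditive k d W)).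
apply: (@le_trans _ _ (\sum_(j <oo) (b j)%:E)%E).
  apply: lee_nneseries => [j _ _|j _]; first exact: hausdorff_content_ge0.
  apply: content_caps; first by rewrite mulr_ge0 ?(ltW (rho0 j))// (le_trans _ (f1 j)).
  apply: le_trans deltad; rewrite (_ : 4 = 2 * 2)%R; last by rewrite -natrM.
  rewrite -mulrA ler_pM2l// ler_pM ?(ltW (rho0 j))//.
  exact: le_trans (f1 j).
apply: lime_le; first by apply: is_cvg_nneseries => j _ _; rewrite lee_fin.
apply: nearW => J; rewrite sumEFin -EFinD lee_fin big_mkord.
pose S J := \sum_(j < J) a j.
have SS i j : (i <= j)%N -> S i <= S j.
  move=> /subnKC <-; elim: (j - i)%N => [|p IH]; first by rewrite addn0.
  by rewrite addnS /S big_ord_recr/=; apply: le_trans IH _; rewrite lerDl.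
apply: (@le_trans _ _ (S J + 2 ^+ k * (S (maxn J N) - S N))); last first.
  apply: lerD; first exact: aQ.
  by rewrite mulrC -ler_pdivlMr ?exprn_gt0// NP// leq_maxr.
elim: J => [|J IH].
  by rewrite big_ord0 addr_ge0 ?sumr_ge0// mulr_ge0 ?exprn_ge0// subr_ge0 SS// leq_maxr.
rewrite big_ord_recr/=.
have -> : S J.+1 = S J + a J by rewrite /S big_ord_recr.
rewrite addrAC; have [JN|NJ] := ltnP J N.
  have -> : maxn J.+1 N = maxn J N by rewrite (maxn_idPr JN) (maxn_idPr (ltnW JN)).
  by apply: lerD => //; rewrite /b /f JN mul1r.
move: IH; rewrite (maxn_idPl NJ) (maxn_idPl (leqW NJ)) => IH.
have -> : S J.+1 = S J + a J by rewrite /S big_ord_recr.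
have -> : b J = 2 ^+ k * a J by rewrite /b /f ltnNge NJ/= exprMn /a; ring.
by have := a0 J; lra.
Qed.

Lemma hausdorff_sphere_le :
  (hausdorff k (sphere r : set V) <= (k.+1%:R * omega R k.+1 * r ^+ k)%:E)%E.
Proof.
apply: ge_ereal_sup => _ [d /= d0 <-]; pose A := k.+1%:R * omega R k.+1 * r ^+ k.
have le_d (e : R) : 0 < e -> 4 * e <= d ->
    (hausdorff_content k d (sphere r : set V) <= (A * ((r + e) / r) ^+ k.+1)%:E)%E.
  exact: content_sphere_le.
have d4 : 0 < d / 4 by rewrite divr_gt0.
have Cf : hausdorff_content k d (sphere r : set V) \is a fin_num.
  rewrite ge0_fin_numE ?hausdorff_content_ge0// (le_lt_trans (le_d (d / 4) _ _)) ?ltry//.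
  by rewrite mulrC divfK.
rewrite -(fineK Cf) lee_fin.
have : (A * ((r + e) / r) ^+ k.+1) @[e --> (0 : R)^'+] --> A * ((r + 0) / r) ^+ k.+1.
  apply: cvg_at_right_filter; apply: cvgM; first exact: cvg_cst.
  apply: (@cvg_comp _ _ _ (fun e : R => (r + e) / r) (fun x => x ^+ k.+1) _
    (nbhs ((r + 0) / r))); last exact: (@exprn_continuous R k.+1 _).
  by apply: cvgM; [apply: cvgD; [exact: cvg_cst|exact: cvg_id]|exact: cvg_cst].
rewrite addr0 divff ?gt_eqF// expr1n mulr1 => /cvgr_to_ge; apply; near=> e.
rewrite -lee_fin fineK//; apply: le_d.
  by near: e; exact: nbhs_right_gt.
rewrite mulrC -ler_pdivlMr//; apply: ltW; near: e.
exact: nbhs_right_lt.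
Unshelve. all: by end_near. Qed.

Lemma hausdorff_sphere :
  hausdorff k (sphere r : set V) = (k.+1%:R * omega R k.+1 * r ^+ k)%:E.
Proof.
by apply/eqP; rewrite eq_le hausdorff_sphere_le hausdorff_sphere_ge.
Qed.

End hausdorff_sphere_le.

Section hausdorff_shift.
Context {R : realType} {n : nat}.
Local Notation V := 'rV[R]_n.
Local Open Scope ereal_scope.

Let shift (c : V) (A : set V) : set V := (fun x => x + c)%R @^-1` A.

Let shiftK c A : shift (- c)%R (shift c A) = A.
Proof. by apply/seteqP; split => x; rewrite /shift /preimage/= subrK. Qed.

Let ediam_shift_le c A : ediam (shift c A) <= ediam A.
Proof.
apply: ge_ereal_sup => _ [->|[[x y] [/= Ax Ay] <-]]; first exact: ediam_ge0.
apply: ereal_sup_ubound; right; exists (x + c, y + c)%R => //=.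
by rewrite opprD addrACA subrr addr0.
Qed.

Let ediam_shift c A : ediam (shift c A) = ediam A.
Proof.
apply/eqP; rewrite eq_le ediam_shift_le /= -{1}(shiftK c A).
exact: ediam_shift_le.
Qed.

Let hausdorff_shift_le m c A : hausdorff m (shift c A) <= hausdorff m A.
Proof.
apply: ge_ereal_sup => _ [d /= d0 <-].
apply: (@le_trans _ _ (hausdorff_content m d A)); last first.
  by apply: ereal_sup_ubound; exists d.
apply: le_ereal_inf_tmp => _ [F [AF Fd] <-]; apply: ereal_inf_lbound.
exists (fun i => shift c (F i)).
  by split => [x /AF [i _ Fx]|i]; [exists i|rewrite ediam_shift].
apply: eq_eseriesr => i _; rewrite /hausdorff_gauge ediam_shift.
suff -> : (shift c (F i) == set0) = (F i == set0) by [].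
apply/eqP/eqP => F0; last by rewrite F0 /shift preimage_set0.
by rewrite -(shiftK c (F i)) F0 /shift preimage_set0.
Qed.

Lemma hausdorff_shift m (c : V) (A : set V) :
  hausdorff m ((fun x => x + c)%R @^-1` A) = hausdorff m A.
Proof.
apply/eqP; rewrite eq_le hausdorff_shift_le /= -{1}(shiftK c A).
exact: hausdorff_shift_le.
Qed.

Lemma boundary_eball (x : V) (r : R) : (0 < r)%R ->
  boundary (eball x r) = [set y | enorm (y - x)%R = r].
Proof.
move=> r0; have oB : open (eball x r) by exact: open_eball.
rewrite /boundary (interior_id _).1//; apply/seteqP; split => y /=.
  move=> [cy /negP]; rewrite /eball/= -leNgt => ry; apply/eqP.
  rewrite eq_le ry andbT; apply/ler_addgt0Pr => e e0.
  have [w [xw yw]] := cy _ (nbhs_eball y e0).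
  by have := enorm_triangle w y x; move: xw yw; rewrite /eball/= (enormB w y); lra.
move=> yr; split; last by rewrite /eball/= yr ltxx.
move=> U /nbhs_eballP[e e0 eU].
pose s := (Num.min (e / 2) r)%R; have s0 : (0 < s)%R by rewrite lt_min r0 divr_gt0.
have sr : (s <= r)%R by rewrite ge_min lexx orbT.
exists (x + (1 - s / r) *: (y - x))%R; split.
  rewrite /eball/= addrAC subrr add0r enormZ yr ger0_norm; last first.
    by rewrite subr_ge0 ler_pdivrMr// mul1r.
  by rewrite mulrBl divfK ?gt_eqF// mul1r ltrBlDr ltrDl.
apply: eU; rewrite /eball/=.
rewrite (_ : x + _ - y = - (s / r) *: (y - x))%R; last first.
  by rewrite scalerBl scale1r scaleNr addrA (addrC x) subrK addrAC subrr add0r.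
rewrite enormZ yr normrN ger0_norm ?divr_ge0 ?ltW// divfK ?gt_eqF//.
apply: (@le_lt_trans _ _ (e / 2)%R); first by rewrite ge_min lexx.
lra.
Qed.

End hausdorff_shift.

Lemma sigma_boundary_eball (R : realType) k (x : 'rV[R]_k.+1) (r : R) : 0 < r ->
  sigma R k.+1 (boundary (eball x r)) =
  (k.+1%:R * omega R k.+1 * r ^+ k)%:E.
Proof.
move=> r0; rewrite -(hausdorff_sphere r0) -(hausdorff_shift k (- x) (sphere r)).
by rewrite boundary_eball.
Qed.

(** * Borel sets are measurable for Hausdorff measure *)

Section metric_outer_measure.
Context {R : realType} {n : nat}.
Local Notation V := 'rV[R]_n.
Local Open Scope ereal_scope.
Variable m : nat.

(** A cover by sets of diameter less than the distance of [A] and [B] splits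
    into a cover of [A] and one of [B]. *)
Let hausdorff_content_separated (A B : set V) (e d : R) : (0 < d)%R -> (d < e)%R ->
  (forall a b, A a -> B b -> (e <= enorm (a - b))%R) ->
  hausdorff_content m d A + hausdorff_content m d B <=
  hausdorff_content m d (A `|` B).
Proof.
move=> d0 de AB; apply: le_ereal_inf_tmp => _ [F [FAB Fd] <-].
pose G (C : set V) (i : nat) := if pselect (F i `&` C !=set0) then F i else set0.
have covG C : C `<=` \bigcup_i F i -> fine_cover d C (G C).
  move=> CF; split => [x Cx|i].
    have [i _ Fx] := CF _ Cx; exists i => //; rewrite /G.
    by case: pselect => [?|[]]; [exact: Fx|exists x].
  rewrite /G; case: pselect => [?|?]; first exact: Fd.
  by rewrite ediam0 lee_fin ltW.
have gG C i : 0 <= hausdorff_gauge m (G C i) by exact: hausdorff_gauge_ge0.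
apply: (@le_trans _ _ (\sum_(i <oo) hausdorff_gauge m (G A i) +
    \sum_(i <oo) hausdorff_gauge m (G B i))).
  apply: leeD; apply: ereal_inf_lbound.
    by exists (G A) => //; apply: covG => x Ax; apply: FAB; left.
  by exists (G B) => //; apply: covG => x Bx; apply: FAB; right.
rewrite -nneseriesD//; apply: lee_nneseries => i _; first by rewrite adde_ge0.
have g0 : hausdorff_gauge m (set0 : set V) = 0 by rewrite /hausdorff_gauge eqxx.
rewrite /G; case: pselect => [[a [Fa Aa]]|?]; last first.
  by case: pselect => [?|?]; rewrite ?g0 ?add0e ?hausdorff_gauge_ge0.
case: pselect => [[b [Fb Bb]]|?]; last by rewrite g0 adde0.
have := AB _ _ Aa Bb; rewrite leNgt; case/negP.
apply: le_lt_trans de; apply: le_trans (enorm_le_ediam (Fd i) Fa Fb) _.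
by have /andP[] := fine_ediam_le (Fd i).
Qed.

Lemma hausdorff_separated (A B : set V) (e : R) : (0 < e)%R ->
  (forall a b, A a -> B b -> (e <= enorm (a - b))%R) ->
  hausdorff m A + hausdorff m B <= hausdorff m (A `|` B).
Proof.
move=> e0 AB.
have [->|Hy] := eqVneq (hausdorff m (A `|` B)) +oo; first exact: leey.
have fH (C : set V) : C `<=` A `|` B -> hausdorff m C \is a fin_num.
  move=> CAB; rewrite ge0_fin_numE ?hausdorff_ge0//.
  by apply: le_lt_trans (le_hausdorff m CAB) _; rewrite ltey.
apply/lee_addgt0Pr => h h0; have h2 : (0 < h / 2)%R by rewrite divr_gt0.
have near_sup (C : set V) : C `<=` A `|` B ->
    exists2 d : R, (0 < d)%R & hausdorff m C <= hausdorff_content m d C + (h / 2)%:E.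
  move=> CAB; have [_ [d /= d0 <-] hd] := ub_ereal_sup_adherent h2 (fH C CAB).
  by exists d => //; rewrite -leeBlDr// ltW.
have [d1 d10 A1] := near_sup A (@subsetUl _ _ _).
have [d2 d20 B2] := near_sup B (@subsetUr _ _ _).
pose d := (Num.min (e / 2) (Num.min d1 d2))%R.
have d0 : (0 < d)%R by rewrite !lt_min d10 d20 divr_gt0.
have de : (d < e)%R.
  by apply: (@le_lt_trans _ _ (e / 2)%R); [rewrite ge_min lexx|lra].
have mono (d' : R) (C : set V) : (d <= d')%R ->
    hausdorff_content m d' C <= hausdorff_content m d C.
  move=> dd'; apply: ereal_inf_le_tmp => _ [F [CF Fd] <-]; exists F => //.
  by split => // i; apply: le_trans (Fd i) _; rewrite lee_fin.
have dd1 : (d <= d1)%R by rewrite !ge_min lexx orbT.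
have dd2 : (d <= d2)%R by rewrite !ge_min lexx !orbT.
apply: (le_trans (leeD A1 B2)); rewrite addeACA -EFinD -splitr leeD2r//.
apply: (le_trans (leeD (mono _ _ dd1) (mono _ _ dd2))).
apply: (le_trans (hausdorff_content_separated d0 de AB)).
by apply: ereal_sup_ubound; exists d.
Qed.

(** Carathéodory's criterion. The part of [X] outside the sublevel set is the
    union of the parts [f >= c + 1 / (j + 1)], which are at positive distance
    from the sublevel set, and it remains to see that the measures of the
    successive layers are summable: layers of the same parity are separated. *)
Lemma sublevel_caratheodory (f : V -> R) (c : R) :
  (forall x y, `|f x - f y| <= enorm (x - y))%R ->
  (hausdorff_outer R n m).-caratheodory [set x | (f x <= c)%R].
Proof.
move=> f1; apply: le_caratheodory_measurable => X.
set D := [set x | _]; pose mu := @hausdorff R n m; change (mu (X `&` D) + mu (X `&` ~` D) <= mu X).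
have [->|Xy] := eqVneq (mu X) +oo; first exact: leey.
have le_mu (A B : set V) : A `<=` B -> mu A <= mu B by exact: le_hausdorff.
have mu0 A : 0 <= mu A by exact: hausdorff_ge0.
have fX A : A `<=` X -> mu A \is a fin_num.
  by move=> AX; rewrite ge0_fin_numE// (le_lt_trans (le_mu _ _ AX))// ltey.
pose l (j : nat) : R := (c + j.+1%:R^-1)%R.
have ldec i j : (i < j)%N -> (l j < l i)%R.
  by move=> ij; rewrite ltrD2l ltf_pV2 ?posrE// ltr_nat.
pose E j := X `&` [set x | (l j <= f x)%R].
pose L j := X `&` [set x | (l j.+1 <= f x < l j)%R].
have sep (A B : set V) (s t : R) : (s < t)%R -> (forall x, A x -> f x <= s)%R ->
    (forall x, B x -> t <= f x)%R -> mu A + mu B <= mu (A `|` B).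
  move=> st As Bt; apply: (@hausdorff_separated _ _ (t - s)%R).
    by rewrite subr_gt0.
  move=> a b /As fa /Bt fb; apply: le_trans (f1 a b); rewrite distrC.
  by apply: le_trans (ler_norm _); lra.
have parity p J : \sum_(i < J) mu (L (2 * i + 1 + p)%N) <= mu (E (2 * J + p)%N).
  elim: J => [|J IH]; first by rewrite big_ord0.
  rewrite big_ord_recr/=; apply: (le_trans (leeD2r _ IH)); rewrite addeC.
  apply: (@le_trans _ _ (mu (L (2 * J + 1 + p)%N `|` E (2 * J + p)%N))).
    apply: (sep _ _ (l (2 * J + 1 + p)%N) (l (2 * J + p)%N)).
    - by apply: ldec; rewrite addn1 addSn.
    - by move=> x [_ /andP[_ /ltW]].
    - by move=> x [].
  apply: le_mu => x [[Xx /andP[lf _]]|[Xx lf]]; split => //=.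
    by rewrite (_ : (2 * J.+1 + p)%N = (2 * J + 1 + p).+1)//; lia.
  by apply: le_trans lf; apply/ltW/ldec; lia.
pose a i := fine (mu (L i.+1)).
have aE i : (a i)%:E = mu (L i.+1) by rewrite fineK// fX// => x [].
have a0 i : (0 <= a i)%R by exact: fine_ge0.
pose Q := (fine (mu X) * 2)%R.
have aQ J : (\sum_(i < J) a i <= Q)%R.
  apply: (@le_trans _ _ (\sum_(i < 2 * J) a i)%R).
    rewrite -(subnKC (_ : J <= 2 * J)%N); last by lia.
    by rewrite big_split_ord/= lerDl sumr_ge0.
  have -> : (\sum_(i < 2 * J) a i)%R =
      (\sum_(i < J) a (2 * i)%N + \sum_(i < J) a (2 * i).+1)%R.
    elim: J => [|J IH]; first by rewrite muln0 !big_ord0 addr0.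
    rewrite (_ : 2 * J.+1 = (2 * J).+2)%N; last by lia.
    rewrite big_ord_recr big_ord_recr/= IH.
    by rewrite [in RHS]big_ord_recr/= [X in (_ = _ + X)%R]big_ord_recr/=; ring.
  have X2 p : (\sum_(i < J) a (2 * i + p)%N <= fine (mu X))%R.
    rewrite -lee_fin fineK ?fX// -sumEFin.
    apply: le_trans (_ : mu (E (2 * J + p)%N) <= _); last by apply: le_mu => x [].
    apply: le_trans _ (parity p J); apply: lee_sum => i _.
    by rewrite aE (_ : (2 * i + p).+1 = 2 * i + 1 + p)%N//; lia.
  rewrite /Q mulr_natr mulr2n; apply: lerD.
    by have := X2 0%N; under eq_bigr do rewrite addn0.
  by have := X2 1%N; under eq_bigr do rewrite addn1.
apply/lee_addgt0Pr => e e0; have [N NP] := bounded_series_tail a0 aQ e0.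
pose W i := if (i < N)%N then set0 else L i.+1.
have cover : X `&` ~` D `<=` E N.+1 `|` \bigcup_i W i.
  move=> x [Xx /negP]; rewrite -ltNge => cf.
  have [j0 j0P] : exists j, (l j <= f x)%R.
    have [j jP] := ltr_add_invr cf; exists j; exact: ltW.
  have [jN|Nj] := leP (l N.+1) (f x); [by left|right].
  have exj : exists j, (l j <= f x)%R by exists j0.
  case: (ex_minnP exj) => j lj minj.
  have jN : (N.+1 < j)%N.
    rewrite ltnNge; apply/negP => jN; move: Nj; rewrite ltNge; case/negP.
    apply: le_trans lj; move: jN; rewrite leq_eqVlt => /orP[/eqP->//|jN].
    exact/ltW/ldec.
  case: j jN lj minj => [//|[//|j]] jN lj minj.
  exists j => //; rewrite /W ltnNge (_ : (N <= j)%N)//; split => //=.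
  rewrite lj/= ltNge; apply/negP => /minj; by rewrite ltnn.
have tail : mu (\bigcup_i W i) <= e%:E.
  apply: (le_trans (hausdorff_sigma_subadditive m W)).
  apply: lime_le; first by apply: is_cvg_nneseries => j _ _; exact: mu0.
  apply: nearW => J; rewrite big_mkord.
  have muW i : mu (W i) = (if (i < N)%N then 0 else a i)%R%:E.
    by rewrite /W; case: ifP => _; [exact: hausdorff0|rewrite aE].
  rewrite (eq_bigr (fun i : 'I_J => (if (i < N)%N then 0 else a i)%R%:E)); last first.
    by move=> i _; exact: muW.
  rewrite sumEFin lee_fin.
  apply: le_trans (NP (maxn J N) (leq_maxr _ _)).
  elim: J => [|J IH]; first by rewrite big_ord0 (maxn_idPr _)// subrr.
  rewrite big_ord_recr/=; case: ltnP => JN.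
    by move: IH; rewrite addr0 (maxn_idPr JN) (maxn_idPr (ltnW JN)).
  rewrite (maxn_idPl (leqW JN)) big_ord_recr/=.
  by move: IH; rewrite (maxn_idPl JN); lra.
have {}cover : mu (X `&` ~` D) <= mu (E N.+1) + e%:E.
  apply: (le_trans (le_mu _ _ cover)).
  apply: (le_trans (outer_measureU2 (hausdorff_outer R n m) _ _)).
  by rewrite leeD2l.
apply: (le_trans (leeD2l _ cover)); rewrite addeA leeD2r//.
apply: (@le_trans _ _ (mu ((X `&` D) `|` E N.+1))).
  apply: (sep _ _ c (l N.+1)).
  - by rewrite ltrDl invr_gt0.
  - by move=> x [].
  - by move=> x [].
by apply: le_mu => x [[]|[]].
Qed.

End metric_outer_measure.

(** Coordinates are 1-Lipschitz. *)
Lemma measurable_sigma_coord (R : realType) n (i : 'I_n) :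
  measurable_fun [set: caratheodory_type (hausdorff_outer R n n.-1)]
    (fun x => x 0 i).
Proof.
apply: (measurability _ (RGenOInfty.measurableE R)) => // _ [_ [c ->] <-].
rewrite setTI (_ : _ @^-1` _ = ~` [set x : 'rV[R]_n | x 0 i <= c]).
  apply: measurableC; apply: sublevel_caratheodory => x y.
  by have := coord_le_enorm (x - y) i; rewrite !mxE.
by apply/seteqP; split => x; rewrite /preimage/= in_itv/= andbT ltNge => /negP.
Qed.

Lemma open_measurable_sigma (R : realType) n (U : set 'rV[R]_n) : open U ->
  measurable (U : set (caratheodory_type (hausdorff_outer R n n.-1))).
Proof.
apply: (@measurable_fun_open_preimage R _ _ n
  (id : caratheodory_type (hausdorff_outer R n n.-1) -> 'rV[R]_n)).
exact: measurable_sigma_coord.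
Qed.

(** * The Kuran gap *)

Section kuran_estimates.
Context {R : realType} {n : nat}.
Implicit Types (c w : 'rV[R]_n).

Let enormB_sqr c w :
  enorm w ^+ 2 - enorm c ^+ 2 = enorm (w - c) ^+ 2 - 2 * dotp (c - w) c.
Proof. by rewrite !sqr_enorm !dotpE (dotpC c w); ring. Qed.

(** Completing the square in the numerator of [kuran_h] and dropping the square
    leaves the integrand of the flatness index. *)
Lemma kuran_h_ge_flux c w :
  - (2 * enorm c ^+ (n - 2)) * (dotp (c - w) c / enorm (w - c) ^+ n) <=
  kuran_h c w.
Proof.
rewrite /kuran_h enormB_sqr; set t := enorm c ^+ _; set D := enorm (w - c) ^+ n.
have t0 : 0 <= t by rewrite exprn_ge0// enorm_ge0.
have : 0 <= t * (enorm (w - c) ^+ 2 / D).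
  by rewrite mulr_ge0// divr_ge0 ?sqr_ge0// exprn_ge0// enorm_ge0.
by rewrite mulrBl mulrBr; lra.
Qed.

(** Away from the pole, [kuran_h c] is almost nonnegative outside the ball of
    radius [r] when [enorm c] is close to [r]. *)
Lemma kuran_h_ge_far c w (r rho : R) : 0 <= r -> r <= enorm w -> 0 < rho ->
  rho <= enorm (w - c) ->
  - (enorm c ^+ (n - 2) * (`|r ^+ 2 - enorm c ^+ 2| / rho ^+ n)) <= kuran_h c w.
Proof.
move=> r0 rw rho0 rhoD; rewrite /kuran_h -mulrN ler_wpM2l//.
  by rewrite exprn_ge0// enorm_ge0.
have D0 : 0 < enorm (w - c) by exact: lt_le_trans rhoD.
have Dn0 : 0 < enorm (w - c) ^+ n by rewrite exprn_gt0.
have rn0 : 0 < rho ^+ n by rewrite exprn_gt0.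
have rw2 : r ^+ 2 <= enorm w ^+ 2 by rewrite ler_sqr ?nnegrE ?enorm_ge0.
apply: (@le_trans _ _ (- (`|r ^+ 2 - enorm c ^+ 2| / enorm (w - c) ^+ n))).
  rewrite lerN2 ler_wpM2l// lef_pV2 ?posrE//.
  by rewrite lerXn2r// nnegrE ltW.
rewrite -mulNr ler_pM2r ?invr_gt0//.
by have := lerNnormlW (lexx `|r ^+ 2 - enorm c ^+ 2|); lra.
Qed.

Lemma kuran_fun0 c : (2 <= n)%N -> c != 0 -> kuran_fun c 0 = 0.
Proof.
move=> n2 c0; rewrite /kuran_fun /kuran_h sub0r enormN enorm0 expr0n/= sub0r.
rewrite mulNr mulrN mulrA -exprD subnK// divff ?subrr//.
by rewrite expf_neq0// gt_eqF// enorm_gt0.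
Qed.

End kuran_estimates.

Section boundary_shift.
Context {R : realType} {n : nat}.
Implicit Types (A : set 'rV[R]_n) (c : 'rV[R]_n).

Lemma shift_image A c : [set y - c | y in A] = (fun x => x + c) @^-1` A.
Proof.
apply/seteqP; split => x; first by move=> [y Ay <-]; rewrite /preimage/= subrK.
by move=> Axc; exists (x + c) => //; rewrite addrK.
Qed.

Let eball_shift (x y c : 'rV[R]_n) (e : R) : eball x e y = eball (x + c) e (y + c).
Proof. by rewrite /eball/= opprD addrACA subrr addr0. Qed.

Lemma closure_shift A c x :
  closure ((fun x => x + c) @^-1` A) x <-> closure A (x + c).
Proof.
split=> cA U /nbhs_eballP[e e0 eU].
  have [y [Ay xy]] := cA _ (nbhs_eball x e0).
  by exists (y + c); split => //; apply: eU; rewrite -eball_shift.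
have [y [Ay xy]] := cA _ (nbhs_eball (x + c) e0).
exists (y - c); split; first by rewrite /preimage/= subrK.
by apply: eU; rewrite (eball_shift _ _ c) subrK.
Qed.

Lemma interior_shift A c x :
  interior ((fun x => x + c) @^-1` A) x <-> interior A (x + c).
Proof.
split=> /nbhs_eballP[e e0 eA]; apply/nbhs_eballP; exists e => // y.
  by rewrite -{1}(subrK c y) -eball_shift => /eA; rewrite /preimage/= subrK.
by rewrite (eball_shift _ _ c) => /eA.
Qed.

Lemma boundary_shift A c :
  boundary ((fun x => x + c) @^-1` A) = (fun x => x + c) @^-1` boundary A.
Proof.
apply/seteqP; split => x [cx ix]; split.
- exact/closure_shift.
- by move=> h; apply: ix; exact/interior_shift.
- exact/closure_shift.
- by move=> h; apply: ix; exact/interior_shift.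
Qed.

Lemma closed_boundary A : closed (boundary A).
Proof.
apply: closedI; first exact: closed_closure.
by apply: open_closedC; exact: open_interior.
Qed.

End boundary_shift.

Section sigma_shift.
Context {R : realType} {n : nat}.
Local Notation T := (caratheodory_type (hausdorff_outer R n n.-1)).
Local Open Scope ereal_scope.

Lemma measurable_sigma_shift (c : 'rV[R]_n) :
  measurable_fun [set: T] (fun x : T => (x - c)%R : T).
Proof.
move=> _ A mA; rewrite setTI.
have {}mA : (hausdorff_outer R n n.-1).-caratheodory A by [].
suff : (hausdorff_outer R n n.-1).-caratheodory ((fun x => x - c)%R @^-1` A) by [].
move=> X.
have E (Y : set 'rV[R]_n) :
    hausdorff_outer R n n.-1 ((fun x => x + c)%R @^-1` Y) =
    hausdorff_outer R n n.-1 Y by exact: hausdorff_shift.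
rewrite -[LHS]E -[X in _ = X + _]E -[X in _ = _ + X]E.
rewrite (mA ((fun x => x + c)%R @^-1` X)).
congr (_ + _); apply: (congr1 (hausdorff_outer R n n.-1));
  by apply/seteqP; split => x; rewrite /preimage/= addrK.
Qed.

(** The gap is defined through the translate of [Omega] to the origin, the
    flatness index without translation; this lemma relates the two. *)
Lemma sigma_integral_shift (D : set 'rV[R]_n) (c : 'rV[R]_n) (u : T -> R) :
  measurable (D : set T) -> measurable_fun [set: T] u ->
  (sigma R n).-integrable (D : set T) (fun y => (u (y - c)%R)%:E) ->
  \int[sigma R n]_(x in (fun x => x + c)%R @^-1` D) (u x)%:E =
  \int[sigma R n]_(y in D) (u (y - c)%R)%:E.
Proof.
move=> mD mu_ iu.
have D'E : (fun x : T => x - c)%R @^-1` ((fun x => x + c)%R @^-1` D) = D.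
  by apply/seteqP; split => x; rewrite /preimage/= subrK.
have mD' : measurable ((fun x => x + c)%R @^-1` D : set T).
  have := measurable_sigma_shift (- c)%R measurableT mD.
  rewrite setTI (_ : _ @^-1` D = (fun x => x + c)%R @^-1` D)//.
  by apply/seteqP; split => x; rewrite /preimage/= opprK.
pose phi : T -> T := fun x => (x - c)%R.
pose D' : set T := (fun x => x + c)%R @^-1` D.
have ip : \int[pushforward (sigma R n) phi]_(x in D') (EFin \o u) x =
    \int[sigma R n]_(x in phi @^-1` D') ((EFin \o u) \o phi) x.
  apply: (integral_pushforward (measurable_sigma_shift c)).
  - by apply/measurable_EFinP; exact: mu_.
  - by rewrite -/phi -/D' /phi /D' D'E; exact: iu.
  - exact: mD'.
rewrite D'E in ip.
have [M ME] : exists M : {measure set T -> \bar R},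
    M = pushforward (sigma R n) phi :> (set T -> \bar R).
  unshelve eexists; first refine (pushforward (sigma R n) phi : {measure set T -> \bar R}).
    exact: measurable_sigma_shift.
  by [].
rewrite -ME in ip.
have E := @eq_measure_integral _ T R D' M (sigma R n) (EFin \o u).
transitivity (\int[sigma R n]_(x in D') (EFin \o u) x); first by [].
rewrite E; first exact: ip.
move=> A mA _; rewrite ME; apply: esym; exact: (hausdorff_shift n.-1 (- c)%R A).
Qed.

End sigma_shift.

Lemma Rintegral_split_ge d (T : measurableType d) (R : realType)
    (mu : {measure set T -> \bar R}) (D B : set T) (h g : T -> R) (k e : R) :
  measurable D -> measurable B -> (mu D < +oo)%E ->
  mu.-integrable D (EFin \o h) -> mu.-integrable D (EFin \o g) ->
  (forall y, D y -> k * (g \_ B) y - e <= h y) ->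
  k * (\int[mu]_(y in D `&` B) g y)%R - e * fine (mu D) <=
  (\int[mu]_(y in D) h y)%R.
Proof.
move=> mD mB muD ih ig gh.
have igB : mu.-integrable D (EFin \o (g \_ B)).
  rewrite (_ : EFin \o (g \_ B) = (EFin \o g) \_ B).
    apply/integrable_restrict => //; apply: integrableS ig => //.
    by apply: measurableI.
  by apply/funext => y; rewrite /= !patchE; case: ifP.
have ie : mu.-integrable D (EFin \o cst e) by
  apply: measurable_bounded_integrable => //; exact: bounded_cst.
have ikB : mu.-integrable D (EFin \o (fun y => k * (g \_ B) y)).
  rewrite (_ : EFin \o _ = (fun y => k%:E * (EFin \o (g \_ B)) y)%E).
    exact: integrableZl.
  by apply/funext => y; rewrite /= EFinM.
have ikBe : mu.-integrable D (EFin \o (fun y => k * (g \_ B) y - e)).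
  rewrite (_ : EFin \o _ = (fun y => (EFin \o (fun y => k * (g \_ B) y)%R) y -
      (EFin \o cst e) y)%E); last by apply/funext => y; rewrite /= EFinB.
  exact: integrableB.
rewrite Rintegral_mkcondr -(Rintegral_cst mu mD e) -RintegralZl// -RintegralB//.
exact: le_Rintegral.
Qed.

Lemma limf_einf_ge (R : realType) (T : choiceType) (X : filteredType T)
    (f : X -> \bar R)
    (F : set_system X) (l : R) :
  (forall e : R, 0 < e -> F [set x | ((l - e)%:E <= f x)%E]) ->
  (l%:E <= limf_einf f F)%E.
Proof.
move=> Ff; rewrite limf_einfE; apply/lee_addgt0Pr => e e0.
rewrite -leeBlDr// -EFinB; set V := [set x | ((l - e)%:E <= f x)%E].
apply: (@le_trans _ _ (ereal_inf (f @` V))).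
  by apply: le_ereal_inf_tmp => _ [x Vx <-].
by apply: ereal_sup_ubound; exists V => //; exact: Ff.
Qed.

Section kuran_gap_lower_bound.
Context {R : realType} {k : nat}.
Local Notation n := k.+1.
Local Notation V := 'rV[R]_n.
Local Notation T := (caratheodory_type (hausdorff_outer R n n.-1)).
Variables (Omega : set V) (x0 z : V).
Hypothesis n2 : (2 <= n)%N.
Hypothesis Omega_open : open Omega.
Hypothesis Omega_bounded : bounded_set Omega.
Hypothesis bOmega_fin : (sigma R n (boundary Omega) < +oo)%E.
Hypothesis Omega_x0 : Omega x0.
Hypothesis hz : touching Omega x0 z.

Let bd : set T := boundary Omega.
Let N : R := fine (sigma R n bd).
Let r : R := enorm (z - x0).

Let NE : sigma R n bd = N%:E.
Proof. by rewrite fineK// ge0_fin_numE. Qed.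

Let N0 : 0 <= N.
Proof. exact: fine_ge0. Qed.

Let mbd : measurable bd.
Proof.
rewrite /bd -(setCK (boundary Omega)); apply: measurableC.
by apply: open_measurable_sigma; apply: closed_openC; exact: closed_boundary.
Qed.

Let r_le y : bd y -> r <= enorm (y - x0).
Proof.
move=> bdy; case: hz => _ xz; rewrite /r enormB xz (enormB y).
apply: ge_inf; last by exists y.
by exists 0 => _ [w _ <-]; exact: enorm_ge0.
Qed.

Let r0 : 0 < r.
Proof.
apply: enorm_gt0; rewrite subr_eq0; apply/eqP => zx.
case: hz => -[_ +] _; apply; rewrite zx.
by rewrite (interior_id _).1.
Qed.

Let bounded_Omega : exists2 M : R, 0 <= M & forall y, closure Omega y -> enorm y <= M.
Proof.
have [M0 [_ MP]] := Omega_bounded.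
pose M1 := `|M0| + 1.
have OM y : Omega y -> enorm y <= n%:R * M1.
  move=> Oy; apply: le_trans (enorm_le_norm _) _; rewrite ler_wpM2l//.
  by apply: MP => //; rewrite /M1 ltr_pwDr// ler_norm.
exists (n%:R * M1); first by rewrite mulr_ge0// addr_ge0.
move=> y cy; rewrite -(subr0 y).
have : closure [set y : V | enorm (y - 0) <= n%:R * M1] y.
  by apply: closureS cy => w /OM; rewrite /= subr0.
by rewrite -(closure_id _).1//; exact: closed_enormB_le.
Qed.

Let flux (a : V) (y : T) : R := dotp (a - y) (a - x0) / enorm (y - a) ^+ n.

Let potential (a : V) (y : T) : R := kuran_h (a - x0) (y - x0).

Let coordB (i : 'I_n) (c : V) : measurable_fun [set: T] (fun y : T => (y - c) 0 i).
Proof.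
rewrite (_ : (fun y => _) = (fun y : T => (y : V) 0 i - c 0 i)); last first.
  by apply/funext => y; rewrite !mxE.
apply: (@measurable_funB _ T R [set: T] (fun y : T => (y : V) 0 i) (cst (c 0 i))).
  exact: measurable_sigma_coord.
exact: measurable_cst.
Qed.

Let measurable_invXn (c : V) :
  measurable_fun [set: T] (fun y : T => (enorm (y - c) ^+ n)^-1).
Proof.
apply: (measurableT_comp measurable_fun_inv); apply: measurable_funX.
by apply: measurable_fun_enorm => i; exact: coordB.
Qed.

Let measurable_flux a : measurable_fun [set: T] (flux a).
Proof.
apply: measurable_funM; last exact: measurable_invXn.
apply: measurable_fun_dotp => i; last exact: measurable_cst.
rewrite (_ : (fun y => _) = (fun y : T => a 0 i - (y : V) 0 i)); last first.
  by apply/funext => y; rewrite !mxE.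
apply: (@measurable_funB _ T R [set: T] (cst (a 0 i)) (fun y : T => (y : V) 0 i)).
  exact: measurable_cst.
exact: measurable_sigma_coord.
Qed.

Let measurable_kuran_h c : measurable_fun [set: T] (kuran_h c : T -> R).
Proof.
have m2 : measurable_fun [set: T] (fun y : T => enorm (y : V) ^+ 2).
  apply: measurable_funX; apply: measurable_fun_enorm => i.
  exact: measurable_sigma_coord.
have mB := measurable_funB m2 (measurable_cst (enorm c ^+ 2)).
have mM := measurable_funM mB (measurable_invXn c).
exact: (measurable_funM (measurable_cst (enorm c ^+ (n - 2))) mM).
Qed.

Let measurable_potential a : measurable_fun [set: T] (potential a).
Proof.
exact: (measurableT_comp (measurable_kuran_h _) (measurable_sigma_shift x0)).
Qed.

Let bounded_integrable (u : T -> R) (C : R) : measurable_fun [set: T] u ->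
  (forall y, bd y -> `|u y| <= C) -> (sigma R n).-integrable bd (EFin \o u).
Proof.
move=> mu uC; apply: measurable_bounded_integrable => //.
  exact: measurable_funTS mu.
exists C; split; first by rewrite num_real.
by move=> M CM y bdy /=; apply: le_trans (uC _ bdy) _; exact: ltW.
Qed.

Let exterior_dist a : ~ closure Omega a ->
  exists2 e, 0 < e & forall y, bd y -> e <= enorm (y - a).
Proof.
move=> ca; have : nbhs a (~` closure Omega).
  by apply: open_nbhs_nbhs; split => //; apply: closed_openC; exact: closed_closure.
move=> /nbhs_eballP[e e0 eO]; exists e => // y [cy _].
by rewrite leNgt; apply/negP => ya; exact: (eO y).
Qed.

Let bd_dist_le a : exists2 M, 0 <= M & forall y, bd y -> enorm (y - a) <= M.
Proof.
have [M M0 MP] := bounded_Omega; exists (M + enorm a).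
  by rewrite addr_ge0// enorm_ge0.
move=> y [cy _]; apply: le_trans (enormD _ _) _.
by rewrite enormN lerD2r MP.
Qed.

Let ler_dotp (x y : V) : `|dotp x y| <= enorm x * enorm y.
Proof.
rewrite ler_norml dotp_le_enorm andbT.
by have := dotp_le_enorm (- x) y; rewrite dotpNl enormN; lra.
Qed.

Let integrable_flux a : ~ closure Omega a ->
  (sigma R n).-integrable bd (EFin \o flux a).
Proof.
move=> ca; have [e e0 eP] := exterior_dist ca; have [M M0 MP] := bd_dist_le a.
apply: (@bounded_integrable _ (M * enorm (a - x0) / e ^+ n)) => // y bdy.
have D0 : 0 < enorm (y - a) by exact: lt_le_trans (eP _ bdy).
rewrite /flux normrM normfV (gtr0_norm (exprn_gt0 n D0)).
apply: ler_pM => //.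
- by rewrite invr_ge0 exprn_ge0// ltW.
- apply: le_trans (ler_dotp _ _) _; rewrite ler_wpM2r ?enorm_ge0// enormB.
  exact: MP.
by rewrite lef_pV2 ?posrE ?exprn_gt0// lerXn2r ?nnegrE ?(ltW e0) ?(ltW D0)// eP.
Qed.

Let integrable_potential a : ~ closure Omega a ->
  (sigma R n).-integrable bd (EFin \o potential a).
Proof.
move=> ca; have [e e0 eP] := exterior_dist ca; have [M M0 MP] := bd_dist_le x0.
set t := enorm (a - x0); have t0 : 0 <= t by exact: enorm_ge0.
apply: (@bounded_integrable _ (t ^+ (n - 2) * ((M ^+ 2 + t ^+ 2) / e ^+ n))) => // y bdy.
have D0 : 0 < enorm (y - a) by exact: lt_le_trans (eP _ bdy).
rewrite /potential /kuran_h (_ : y - x0 - (a - x0) = y - a); last first.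
  by rewrite opprB addrA subrK.
rewrite normrM ger0_norm ?exprn_ge0// ler_wpM2l ?exprn_ge0//.
rewrite normrM normfV (gtr0_norm (exprn_gt0 n D0)).
apply: ler_pM => //.
- by rewrite invr_ge0 exprn_ge0// ltW.
- apply: le_trans (ler_normB _ _) _.
  rewrite !ger0_norm ?sqr_ge0// lerD2r lerXn2r ?nnegrE ?enorm_ge0//.
  exact: MP.
by rewrite lef_pV2 ?posrE ?exprn_gt0// lerXn2r ?nnegrE ?(ltW e0) ?(ltW D0)// eP.
Qed.

Let I a : R := (\int[sigma R n]_(y in bd) potential a y)%R.

Let integral_potential a : ~ closure Omega a ->
  (\int[sigma R n]_(y in bd) (potential a y)%:E)%E = (I a)%:E.
Proof. by move=> ca; rewrite fineK//; exact: integrable_fin_num (integrable_potential ca). Qed.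

(** Undoing the translation in the definition of the gap. *)
Let kuran_gap_ge a : ~ closure Omega a ->
  (`| 0%:E - (N + I a)%:E / N%:E | <= kuran_gap Omega x0)%E.
Proof.
move=> ca; apply: ereal_sup_ubound; exists (a - x0).
  by rewrite shift_image => /closure_shift; rewrite subrK.
rewrite kuran_fun0//; last first.
  rewrite subr_eq0; apply/eqP => ax; apply: ca; rewrite ax.
  exact: subset_closure.
congr (`| _ - _ |)%E; rewrite /surface_mean shift_image boundary_shift.
congr (_ / _)%E; last first.
  by rewrite -NE; exact: hausdorff_shift.
have i1 : (sigma R n).-integrable bd (EFin \o cst 1).
  by apply: (@bounded_integrable _ 1) => [|y _]; [exact: measurable_cst|rewrite normr1].
have ip := integrable_potential ca.
have ik : (sigma R n).-integrable bd
    (fun y => (kuran_fun (a - x0) (y - x0))%:E).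
  exact: (integrableD mbd i1 ip).
have mk : measurable_fun [set: T] (kuran_fun (a - x0) : T -> R).
  have c1 : measurable_fun [set: T] (cst (1 : R)) by exact: measurable_cst.
  exact: (measurable_funD c1 (measurable_kuran_h (a - x0))).
rewrite (sigma_integral_shift mbd mk ik).
have E := integralD mbd i1 ip.
rewrite EFinD -integral_potential// -NE.
transitivity (\int[sigma R n]_(y in bd) ((EFin \o cst 1%R) y + (EFin \o potential a) y))%E.
  by [].
rewrite E; congr (_ + _)%E.
exact: etrans (integral_cst (sigma R n) mbd 1%E) (mul1e _).
Qed.

(** The gap could only fail to be nonnegative if it were the supremum of the
    empty set, but a bounded set has exterior points. *)
Let kuran_gap_ge0 : (0 <= kuran_gap Omega x0)%E.
Proof.
have [M M0 MP] := bounded_Omega; have M10 : 0 <= M + 1 by rewrite addr_ge0.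
have ca : ~ closure Omega (rV_cons (M + 1) 0).
  by move=> /MP; rewrite enorm_axis// leNgt ltrDl ltr01.
by apply: le_trans (kuran_gap_ge ca); exact: abse_ge0.
Qed.

(** From here on the gap is finite; otherwise the theorem is trivial. *)
Section bounded_gap.
Variable K : R.
Hypothesis gapK : kuran_gap Omega x0 = K%:E.

Let potential_le a : ~ closure Omega a -> N + I a <= K * N.
Proof.
move=> ca; have [N00|Nneq] := eqVneq N 0.
  have s0 : sigma R n bd = 0%E by rewrite NE N00.
  have mp := measurable_int (sigma R n) (integrable_potential ca).
  have := null_set_integral mbd mp s0.
  by rewrite N00 mulr0 add0r /I /Rintegral => ->.
have := kuran_gap_ge ca; rewrite gapK inver (negbTE Nneq) -EFinM sub0e -EFinN.
rewrite lee_fin normrN -ler_pdivrMr ?lt_def ?Nneq//.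
exact: le_trans (ler_norm _).
Qed.

Let J rho a : R := (\int[sigma R n]_(y in bd `&` eball z rho) flux a y)%R.

Let measurable_bd_ball rho : measurable (bd `&` eball z rho : set T).
Proof.
by apply: measurableI => //; apply: open_measurable_sigma; exact: open_eball.
Qed.

Let integral_flux rho a : ~ closure Omega a ->
  (\int[sigma R n]_(y in boundary Omega `&` eball z rho)
     (dotp (a - y) (a - x0) / enorm (y - a) ^+ n)%:E)%E = (J rho a)%:E.
Proof.
move=> ca; rewrite /J /Rintegral fineK//.
apply: integrable_fin_num; first exact: measurable_bd_ball.
exact: (integrableS mbd (measurable_bd_ball rho) (@subIsetl _ _ _) (integrable_flux ca)).
Qed.

(** Bound the potential from below by the flux inside the ball about [z] and by
    [- e] outside it, where [a] is far from the boundary points, and compare with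
    the upper bound that the gap imposes on the integral of the potential. *)
Let flux_ge a rho e : ~ closure Omega a -> 0 < rho -> 0 <= e ->
  enorm (a - z) < rho / 2 ->
  enorm (a - x0) ^+ (n - 2) *
    (`|r ^+ 2 - enorm (a - x0) ^+ 2| / (rho / 2) ^+ n) <= e ->
  (1 - K) * N - e * N <= 2 * enorm (a - x0) ^+ (n - 2) * J rho a.
Proof.
move=> ca rho0 e0 az far.
have rho20 : 0 < rho / 2 by rewrite divr_gt0.
have pw y : bd y ->
    - (2 * enorm (a - x0) ^+ (n - 2)) * (flux a \_ (eball z rho)) y - e <=
    potential a y.
  move=> bdy; rewrite patchE; case: ifPn => [_|yz].
    have := kuran_h_ge_flux (a - x0) (y - x0).
    rewrite /flux /potential !opprB !addrA !subrK; lra.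
  rewrite mulr0 sub0r; apply: le_trans (kuran_h_ge_far _ _ rho20 _).
  - by rewrite lerN2; exact: far.
  - exact: ltW.
  - exact: r_le.
  - rewrite opprB addrA subrK leNgt; apply/negP => ya; move/negP: yz; apply.
    rewrite inE /eball/=; apply: le_lt_trans (enorm_triangle a _ _) _.
    lra.
have mB : measurable (eball z rho : set T).
  by apply: open_measurable_sigma; exact: open_eball.
have := Rintegral_split_ge mbd mB bOmega_fin (integrable_potential ca)
  (integrable_flux ca) pw.
have := potential_le ca; rewrite -/N -/(I a) -/(J rho a); lra.
Qed.

(** The limit, as [a] tends to [z], of the lower bound of [flux_ge] for
    [e = 0]. *)
Let l : R := (1 - K) * N / (2 * r ^+ (n - 2)).

Let flux_limit_ge rho : 0 < rho ->
  (l%:E <= limf_einf (fun a : V =>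
    \int[sigma R n]_(y in boundary Omega `&` eball z rho)
      (dotp (a - y) (a - x0) / enorm (y - a) ^+ n)%:E)
    (within (~` closure Omega) (nbhs z)))%E.
Proof.
move=> rho0; apply: limf_einf_ge => e e0.
have rho20 : 0 < rho / 2 by rewrite divr_gt0.
have rn0 : 0 < r ^+ (n - 2) by rewrite exprn_gt0.
have N1 : 0 < N + 1 by rewrite ltr_wpDl.
(* The error [e1 * N] is at most half of what [l - e] concedes in [c1']. *)
pose e1 := e * r ^+ (n - 2) / (N + 1).
have e10 : 0 < e1 by rewrite divr_gt0// mulr_gt0.
have e1N : e1 * N <= e * r ^+ (n - 2).
  rewrite /e1 mulrAC ler_pdivrMr// ler_wpM2l ?lerDl//.
  by rewrite mulr_ge0// ltW.
have ct : (fun a : V => enorm (a - x0)) @ z --> r by exact: enormB_continuous.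
have cX m : (fun a : V => enorm (a - x0) ^+ m) @ z --> r ^+ m.
  exact: (cvg_comp (fun a : V => enorm (a - x0)) (fun t => t ^+ m) ct
    (@exprn_continuous R m r)).
have c1 : (fun a : V => enorm (a - x0) ^+ (n - 2) * (2 * (l - e))) @ z -->
    r ^+ (n - 2) * (2 * (l - e)).
  by apply: (@cvgM R V (nbhs z) _); [exact: cX|exact: cvg_cst].
have c2 : (fun a : V => enorm (a - x0) ^+ (n - 2) *
    (`|r ^+ 2 - enorm (a - x0) ^+ 2| / (rho / 2) ^+ n)) @ z -->
    r ^+ (n - 2) * (`|r ^+ 2 - r ^+ 2| / (rho / 2) ^+ n).
  apply: (@cvgM R V (nbhs z) _); first exact: cX.
  apply: (@cvgM R V (nbhs z) _); last exact: cvg_cst.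
  apply: (@cvg_norm R _ V (nbhs z) _).
  by apply: (@cvgB R _ V (nbhs z) _); [exact: cvg_cst|exact: cX].
have c3 : (fun a : V => enorm (a - z)) @ z --> enorm (z - z).
  exact: enormB_continuous.
rewrite subrr normr0 mul0r mulr0 in c2; rewrite subrr enorm0 in c3.
have lE : r ^+ (n - 2) * (2 * l) = (1 - K) * N.
  by rewrite /l; field; rewrite gt_eqF.
have c1' : r ^+ (n - 2) * (2 * (l - e)) < (1 - K) * N - e * r ^+ (n - 2).
  have : 0 < e * r ^+ (n - 2) by rewrite mulr_gt0.
  by rewrite mulrBr mulrBr lE; lra.
rewrite /within/=; near=> a => ca.
rewrite [in X in (_ <= X)%E]integral_flux// lee_fin.
have t0 : 0 < enorm (a - x0) by near: a; exact: (cvgr_gt _ ct).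
have tn0 : 0 < enorm (a - x0) ^+ (n - 2) by rewrite exprn_gt0.
have az : enorm (a - z) < rho / 2 by near: a; exact: (cvgr_lt _ c3).
have far : enorm (a - x0) ^+ (n - 2) *
    (`|r ^+ 2 - enorm (a - x0) ^+ 2| / (rho / 2) ^+ n) <= e1.
  by near: a; apply: (cvgr_le _ c2).
have near_ : enorm (a - x0) ^+ (n - 2) * (2 * (l - e)) <
    (1 - K) * N - e * r ^+ (n - 2).
  by near: a; exact: (cvgr_lt _ c1).
have := flux_ge ca rho0 (ltW e10) az far.
rewrite -(@ler_pM2l _ (enorm (a - x0) ^+ (n - 2) * 2)) ?mulr_gt0//.
by lra.
Unshelve. all: by end_near.
Qed.

(** The normalization of the flatness index and the area of the sphere combine
    to the factor [2 * r ^+ (n - 2)] that was divided out in [l]. *)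
Let flatness_ge :
  (((1 - K) * N)%:E <=
   flatness Omega x0 z * sigma R n (boundary (eball x0 r)))%E.
Proof.
rewrite /flatness sigma_boundary_eball//; set L := limf_einf _ _.
have lL : (l%:E <= L)%E.
  apply: limf_einf_ge => e e0; near=> rho.
  have rho0 : 0 < rho by near: rho; exact: nbhs_right_gt.
  apply: le_trans (flux_limit_ge rho0).
  by rewrite lee_fin lerBlDr lerDl ltW.
have w0 : 0 < omega R n by exact: omega_gt0.
have rn0 : 0 < r ^+ (n - 2) by rewrite exprn_gt0.
have c0 : 0 < 2 / (n%:R * omega R n * r).
  by rewrite divr_gt0// !mulr_gt0// ltr0n.
have S0 : 0 < n%:R * omega R n * r ^+ k by rewrite !mulr_gt0 ?exprn_gt0// ltr0n.
rewrite -/r muleAC -EFinM.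
have -> : 2 / (n%:R * omega R n * r) * (n%:R * omega R n * r ^+ k) =
    2 * r ^+ (n - 2).
  have kE : (k = (n - 2).+1)%N by move: n2; case: (k) => // m _; rewrite subn2.
  rewrite [in r ^+ k]kE exprS; field.
  by rewrite (gt_eqF w0) (gt_eqF r0) /= addrC natr1 pnatr_eq0.
apply: (@le_trans _ _ ((2 * r ^+ (n - 2))%:E * l%:E)%E).
  rewrite -EFinM lee_fin le_eqVlt /l; apply/orP; left; apply/eqP; field.
  by rewrite gt_eqF.
by rewrite lee_wpmul2l// lee_fin mulr_ge0// ltW.
Unshelve. all: by end_near.
Qed.

Lemma kuran_gap_ge_of_bounded :
  ((sigma R n (boundary Omega) -
    flatness Omega x0 z * sigma R n (boundary (eball x0 r))) /
   sigma R n (boundary Omega) <= K%:E)%E.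
Proof.
have := flatness_ge; set S := (flatness _ _ _ * _)%E => SK.
rewrite -/bd NE.
have SN : (N%:E - S <= (K * N)%:E)%E.
  move: SK; case: S => [s| |] //; last by move=> _; rewrite leNye.
  by rewrite -EFinB !lee_fin; lra.
have [N00|Nneq] := eqVneq N 0.
  (* The inverse of 0 is [+oo], and the numerator is nonpositive. *)
  rewrite N00 inve0; apply: (@le_trans _ _ 0%E); last by rewrite -gapK.
  by apply: mule_le0_ge0 => //; move: SN; rewrite N00 mulr0.
have Npos : 0 < N by rewrite lt_def Nneq.
by rewrite inver (negbTE Nneq) lee_pdivrMr.
Qed.

End bounded_gap.

Lemma kuran_gap_ge_flatness :
  ((sigma R n (boundary Omega) -
    flatness Omega x0 z * sigma R n (boundary (eball x0 r))) /
   sigma R n (boundary Omega) <= kuran_gap Omega x0)%E.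
Proof.
have := kuran_gap_ge0.
case: (kuran_gap Omega x0) (@kuran_gap_ge_of_bounded) => [K| |] h // _.
- exact: h.
- exact: leey.
Qed.

End kuran_gap_lower_bound.

Theorem theorem1p6 (R : realType) (n : nat) (hn : (2 <= n)%N)
    (Omega : set 'rV[R]_n) (Omega_open : open Omega)
    (Omega_bounded : bounded_set Omega)
    (bOmega_fin : (sigma R n (boundary Omega) < +oo)%E)
    (x0 : 'rV[R]_n) (Omega_x0 : Omega x0)
    (z : 'rV[R]_n) (hz : touching Omega x0 z) :
  let B := eball x0 (enorm (z - x0)) in
  (kuran_gap Omega x0 >=
   (sigma R n (boundary Omega) - flatness Omega x0 z * sigma R n (boundary B)) /
   sigma R n (boundary Omega))%E.
Proof.
case: n hn Omega Omega_open Omega_bounded bOmega_fin x0 Omega_x0 z hz => // k n2.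
move=> Omega oO bO fO x0 Ox0 z hz.
exact (kuran_gap_ge_flatness n2 oO bO fO Ox0 hz).
Qed.
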